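(* There exist an infinite connected simple graph $G$ with bounded degrees, which is transient and not vertex-transitive, and a vertex $o$ of $G$ such that for every $p\in[0,p_T(G))$ the following holds $\widetilde P^{o,p}$-a.s.: $$\liminf_{n\to\infty}\frac{\widetilde E^{o,p}[U_n]}{n}=\liminf_{n\to\infty}\frac{U_n}{n}<\limsup_{n\to\infty}\frac{U_n}{n}=\limsup_{n\to\infty}\frac{\widetilde E^{o,p}[U_n]}{n}.$$
   Context: $(S_n)_{n\ge0}$ is the simple random walk on $G$, and $P^x$ is its law started at $x$; $G$ is transient if this walk is transient. $\mathbb{P}_p$ is the law of Bernoulli bond percolation on $G$ with parameter $p$; $C_x$ is the open cluster of $x$. $p_T(G):=\inf\{p\in[0,1]:E^{\mathbb{P}_p}[|C_o|]=+\infty\}$ (independent of $o$). $\widetilde P^{o,p}:=P^o\otimes\mathbb{P}_p$, with expectation $\widetilde E^{o,p}$. $U_n:=\big|\bigcup_{x\in\{S_0,\dots,S_n\}}C_x\big|$. A graph is vertex-transitive if its automorphism group acts transitively on its vertices. *)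

(* Defs.v *)
From HB Require Import structures.
From mathcomp Require Import all_boot all_order all_algebra finmap.
From mathcomp Require Import all_classical all_reals all_analysis.

Set Implicit Arguments.
Unset Strict Implicit.
Unset Printing Implicit Defensive.

Import Order.TTheory GRing.Theory Num.Theory.
Import numFieldNormedType.Exports.

Local Open Scope classical_set_scope.
Local Open Scope ring_scope.

(* A connected locally finite graph has countably many vertices, so taking the
   vertices in a [countType] is no restriction for such graphs. *)
Record sgraph := SGraph {
  vertex :> countType;
  adj : rel vertex;
  adj_sym : symmetric adj;
  adj_irr : irreflexive adj }.
Arguments adj : clear implicits.

Section graph.
Variable G : sgraph.
Implicit Types x y : G.

Definition neighbours x : set G := [set y | adj G x y].

(* This is 0 when [x] has infinitely many neighbours. *)
Definition degree x : nat := #|` fset_set (neighbours x)|.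

Definition bounded_degree := exists D : nat, forall x, (neighbours x #<= `I_D)%card.

Definition connected_graph :=
  forall x y, exists s : seq G, path (adj G) x s /\ last x s = y.

Definition automorphism (f : G -> G) :=
  bijective f /\ forall x y, adj G (f x) (f y) = adj G x y.

Definition vertex_transitive :=
  forall x y, exists f : G -> G, automorphism f /\ f x = y.

Definition is_edge (e : {fset G}) : bool :=
  `[< exists x y, adj G x y /\ e = [fset x; y]%fset >].

Definition edge := {e : {fset G} | is_edge e}.

HB.instance Definition _ := Countable.on edge.

End graph.

(* For countable [T], the sigma-algebra generated by these sets is the product
   over [I] of the discrete sigma-algebras of [T]. *)
Definition coordinate_sets (I T : Type) : set (set (I -> T)) :=
  [set A | exists i t, A = [set f | f i = t]].
Arguments coordinate_sets I T : clear implicits.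

(* Measurable spaces are pointed: the point here is the constant sequence. *)
Definition based_sequence (T : Type) (x : T) : Type := nat -> T.

HB.instance Definition _ (T : Type) (x : T) := gen_eqMixin (based_sequence x).
HB.instance Definition _ (T : Type) (x : T) :=
  gen_choiceMixin (based_sequence x).
HB.instance Definition _ (T : Type) (x : T) :=
  isPointed.Build (based_sequence x) (fun=> x : T).

Definition trajectory (T : Type) (x : T) :=
  g_sigma_algebraType (coordinate_sets nat T : set (set (based_sequence x))).

(* Extension of consistent cylinder masses [m] on a finitely branching tree:
   [0, 1[ is cut into nested intervals, one of length [m s] for each history
   [s], and the law is the image of the Lebesgue measure under the map sending
   a point to the branch of intervals containing it. *)
Section discrete_extension.
Variables (R : realType) (T : countType) (x0 : T).

Fixpoint pick_branch (b : seq T) (w : T -> R) (v : R) : T :=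
  if b is t :: b' then
    if v < w t then t else pick_branch b' w (v - w t)
  else x0.

Fixpoint offset (b : seq T) (w : T -> R) (t : T) : R :=
  if b is t' :: b' then if t == t' then 0 else w t' + offset b' w t else 0.

Lemma offset_ge0 b w t : (forall t, 0 <= w t) -> 0 <= offset b w t.
Proof.
by move=> w0; elim: b => //= t' b IH; case: ifP => // _; rewrite addr_ge0.
Qed.

Lemma pick_branchP b w v t : uniq b -> (forall t, 0 <= w t) ->
  0 <= v < \sum_(u <- b) w u ->
  (pick_branch b w v == t) =
  (t \in b) && (offset b w t <= v < offset b w t + w t).
Proof.
move=> + w0; elim: b v => [|t' b IH] v /=.
  by rewrite big_nil => _ /andP[v0 /(le_lt_trans v0)]; rewrite ltxx.
move=> /andP[t'b ub]; rewrite big_cons => /andP[v0 vs].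
rewrite inE [t == t']eq_sym; have [vw|wv] := ltP v (w t').
  have [<-|tt'] := eqVneq t' t => /=; first by rewrite v0 add0r vw.
  rewrite [_ + _ <= v]leNgt (lt_le_trans vw) ?lerDl ?offset_ge0 //.
  by rewrite andbF.
rewrite IH //; last by rewrite subr_ge0 wv ltrBlDl.
have [<-|tt'] := eqVneq t' t => /=.
  by rewrite (negbTE t'b) add0r [v < _]ltNge wv andbF.
by rewrite lerBrDl ltrBlDl addrA.
Qed.

Lemma offset_le_sum b w t : t \in b -> (forall t, 0 <= w t) ->
  offset b w t + w t <= \sum_(u <- b) w u.
Proof.
move=> + w0; elim: b => //= t' b IH; rewrite inE big_cons.
have [-> _|_ /= /IH tb] := eqVneq t t'; first by rewrite add0r lerDl sumr_ge0.
by rewrite -addrA lerD2l.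
Qed.

Let measurable_prop (P : Prop) : measurable [set _ : R | P].
Proof.
have [p|np] := pselect P.
  by have -> : [set _ : R | P] = setT by apply/seteqP; split.
by have -> : [set _ : R | P] = set0 by apply/seteqP; split.
Qed.

Lemma measurable_pick_branch b w c t :
  measurable [set u : R | pick_branch b w (u - c) = t].
Proof.
elim: b c => [|t' b IH] c /=.
  exact: measurable_prop.
have mI : measurable [set u : R | u < c + w t'].
  have -> : [set u : R | u < c + w t'] = `]-oo, (c + w t')[%classic.
    by apply/seteqP; split => u /=; rewrite in_itv.
  exact: measurable_itv.
have := IH (c + w t') => mb.
have -> : [set u : R | (if u - c < w t' then t' else
     pick_branch b w (u - c - w t')) = t] =
   ([set u | u < c + w t'] `&` [set u | t' = t]) `|`
   (~` [set u | u < c + w t'] `&`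
    [set u | pick_branch b w (u - (c + w t')) = t]).
  apply/seteqP; split => u /=; rewrite opprD addrA ltrBlDl.
    by case: ifP => h; [left|right].
  by move=> [[-> //]|[/negP/negbTE -> //]].
by apply: measurableU; apply: measurableI => //; exact: measurableC.
Qed.

Variables (br : seq T -> seq T) (m : seq T -> R).
Hypothesis br_uniq : forall s, uniq (br s).
Hypothesis m_ge0 : forall s, 0 <= m s.
Hypothesis m_nil : m [::] = 1.
Hypothesis m_sum : forall s, \sum_(t <- br s) m (rcons s t) = m s.
Hypothesis m_out : forall s t, t \notin br s -> m (rcons s t) = 0.

Let next (L : seq T -> R) s (u : R) :=
  pick_branch (br s) (fun t => m (rcons s t)) (u - L s).

(* Left endpoint of the interval attached to the history [pre ++ s]. *)
Fixpoint left_end (pre s : seq T) (l : R) : R :=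
  if s is t :: s' then
    left_end (rcons pre t) s' (l + offset (br pre) (fun t => m (rcons pre t)) t)
  else l.

Let L s := left_end [::] s 0.

Lemma left_end_rcons pre s t l : left_end pre (rcons s t) l =
  left_end pre s l
  + offset (br (pre ++ s)) (fun t' => m (rcons (pre ++ s) t')) t.
Proof.
by elim: s pre l => [|a s IH] pre l /=; rewrite ?cats0 // IH cat_rcons.
Qed.

Fixpoint history (n : nat) (u : R) : seq T :=
  if n is n'.+1 then rcons (history n' u) (next L (history n' u) u) else [::].

Definition digit (u : R) (n : nat) : T := next L (history n u) u.

Lemma historyE n u : history n u = mkseq (digit u) n.
Proof. by elim: n => // n IH; rewrite mkseqS -IH. Qed.

Lemma measurable_history s : measurable [set u | history (size s) u = s].
Proof.
elim/last_ind: s => [|s t IH].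
  by rewrite (_ : [set _ | _] = setT) //; apply/seteqP; split.
rewrite size_rcons (_ : [set _ | _] =
  [set u | history (size s) u = s] `&` [set u | next L s u = t]).
  by apply: measurableI => //; exact: measurable_pick_branch.
apply/seteqP; split => u /=; first by move/rcons_inj => [-> <-].
by move=> [-> ->].
Qed.

Fixpoint admissible (pre s : seq T) :=
  if s is t :: s' then (t \in br pre) && admissible (rcons pre t) s' else true.

Lemma admissible_rcons pre s t : admissible pre (rcons s t) =
  admissible pre s && (t \in br (pre ++ s)).
Proof.
elim: s pre => [|a s IH] pre /=; first by rewrite cats0 andbT.
by rewrite IH cat_rcons andbA.
Qed.

Let L_rcons s t :
  L (rcons s t) = L s + offset (br s) (fun t' => m (rcons s t')) t.
Proof. by rewrite /L left_end_rcons. Qed.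

Let L_bounds s : admissible [::] s -> 0 <= L s /\ L s + m s <= 1.
Proof.
elim/last_ind: s => [_|s t IH]; first by rewrite m_nil /L add0r.
rewrite admissible_rcons => /andP[/IH[L0 L1] tb]; rewrite L_rcons; split.
  by rewrite addr_ge0 // offset_ge0.
rewrite (le_trans _ L1) // -addrA lerD2l -(m_sum s).
exact: (@offset_le_sum _ (fun t' => m (rcons s t'))).
Qed.

Lemma history_itv s u : 0 <= u < 1 ->
  (history (size s) u == s) = admissible [::] s && (L s <= u < L s + m s).
Proof.
move=> u01; elim/last_ind: s => [|s t IH].
  by rewrite /L /= m_nil add0r u01.
rewrite size_rcons /= eqseq_rcons IH admissible_rcons /= L_rcons.
case: (boolP (admissible _ s)) IH => //= _ IH.
have w0 t' : 0 <= m (rcons s t') by exact: m_ge0.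
have o0 := offset_ge0 (br s) t w0.
have [hin|hout] /= := boolP (L s <= u < L s + m s); last first.
  apply/esym/negbTE; apply: contra hout => /and3P[tb lu ul].
  rewrite (le_trans _ lu) ?lerDl //= (lt_le_trans ul) // -addrA lerD2l.
  by rewrite -(m_sum s); exact: (@offset_le_sum _ (fun t' => m (rcons s t'))).
move: IH; rewrite hin => /eqP ->.
rewrite /next pick_branchP //; last by rewrite m_sum subr_ge0 ltrBlDl.
by rewrite lerBrDl ltrBlDl addrA.
Qed.

Local Notation mu := (mrestr (@lebesgue_measure R) (measurable_itv `[0%R, 1%R[)).

Lemma mu_history s : mu [set u | history (size s) u = s] = (m s)%:E.
Proof.
have [ad|nad] := boolP (admissible [::] s); last first.
  have -> : m s = 0.
    elim/last_ind: s nad => [//|s t IH]; rewrite admissible_rcons negb_and.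
    case/orP => [/IH ms|/m_out //].
    have [tb|/m_out //] := boolP (t \in br s).
    move/eqP: (m_sum s); rewrite ms (big_rem t) //=.
    by rewrite paddr_eq0 ?sumr_ge0 // => /andP[/eqP].
  rewrite /mrestr (_ : _ `&` _ = set0) ?measure0 //.
  apply/seteqP; split => u //= [/eqP]; rewrite in_itv /= => + u01.
  by rewrite history_itv // (negbTE nad).
rewrite /mrestr (_ : _ `&` _ = `[L s, L s + m s[%classic).
  rewrite lebesgue_measure_itv /= lte_fin ltrDl; case: ifPn => [_|].
    by rewrite -EFinB addrAC subrr add0r.
  by rewrite lt_neqAle m_ge0 andbT negbK => /eqP <-.
have [Ls0 Ls1] := L_bounds ad.
apply/seteqP; split => u /=; rewrite !in_itv /=.
  by move=> [/eqP + u01]; rewrite history_itv // ad.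
move=> uL; have u01 : 0 <= u < 1.
  case/andP: uL => lu ul; by rewrite (le_trans _ lu) //= (lt_le_trans ul).
by split => //; apply/eqP; rewrite history_itv // ad uL.
Qed.

Lemma discrete_extension : exists P : probability (trajectory x0) R,
  forall s, P [set f | mkseq f (size s) = s] = (m s)%:E.
Proof.
have mf : measurable_fun setT (digit : measurableTypeR R -> trajectory x0).
  apply: (@measurability _ _ _ (trajectory x0) setT _ (coordinate_sets nat T)).
    by [].
  move=> _ [_ [i [t ->]] <-]; rewrite setTI.
  have -> : digit @^-1` [set f | f i = t] =
    \bigcup_(s in [set s : seq T | size s = i.+1 /\ last x0 s = t])
      [set u | history (size s) u = s].
    apply/seteqP; split => u /=.
      move=> ut; exists (history i.+1 u) => /=.
        by rewrite size_rcons last_rcons historyE size_mkseq -historyE.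
      by rewrite size_rcons [in size _]historyE size_mkseq.
    by move=> [s [si st] /= su]; rewrite -st -su si /= last_rcons.
  rewrite bigcup_mkcond; apply: countable_bigcupT_measurable => // s.
  by case: ifP => // _; exact: measurable_history.
have muT : mu setT = 1%E.
  rewrite /mrestr setTI /= lebesgue_measure_itv /= lte_fin ltr01.
  by rewrite -EFinB subr0.
pose muP := Measure_isProbability.Build _ _ _ mu muT.
pose P0 : probability _ R := HB.pack mu muP.
pose XP := isMeasurableFun.Build _ _ _ _ _ mf.
pose X : {mfun _ >-> trajectory x0} := HB.pack (digit : measurableTypeR R -> trajectory x0) XP.
exists (distribution P0 X) => s.
rewrite -mu_history /= /distribution /pushforward; congr (mu _).
by apply/seteqP; split => u /=; rewrite historyE.
Qed.

End discrete_extension.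

Lemma measurable_cylinder (T : Type) (x0 : T) (s : seq T) :
  measurable ([set f | mkseq f (size s) = s] : set (trajectory x0)).
Proof.
elim/last_ind: s => [|s t IH].
  rewrite (_ : [set _ | _] = setT); first exact: measurableT.
  by apply/seteqP; split.
have -> : [set f : trajectory x0 | mkseq f (size (rcons s t)) = rcons s t] =
  [set f | mkseq f (size s) = s] `&` [set f | f (size s) = t].
  apply/seteqP; split => f /=; rewrite size_rcons mkseqS.
    by move/rcons_inj => [-> <-].
  by move=> [-> ->].
apply: measurableI => //; apply: sub_sigma_algebra; by exists (size s), t.
Qed.

Section walk.
Variables (R : realType) (G : sgraph).
Implicit Types x y : G.

(* The walk stays put at a vertex of degree 0; this case does not occur in an
   infinite connected locally finite graph. *)
Definition srw_step x y : R :=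
  if degree x == 0%N then (x == y)%:R else (adj G x y)%:R / (degree x)%:R.

Definition is_srw_law x (P : probability (trajectory x) R) :=
  forall (n : nat) (f : nat -> G),
    P [set S | forall i, (i <= n)%N -> S i = f i] =
    ((f 0%N == x)%:R * \prod_(i < n) srw_step (f i) (f i.+1))%:E.

Let nb x : seq G := if degree x == 0%N then [:: x] else fset_set (neighbours x).

Let finite_nb x : degree x != 0%N -> finite_set (neighbours x).
Proof.
apply: contra_neqP => inf; rewrite /degree /fset_set.
by case: pselect => // /inf.
Qed.

Lemma srw_step_sum x : \sum_(y <- nb x) srw_step x y = 1.
Proof.
rewrite /nb /srw_step; have [_|d0] := eqVneq (degree x) 0%N.
  by rewrite big_seq1 eqxx.
rewrite big_seq (eq_bigr (fun=> (degree x)%:R^-1)) => [|y].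
  rewrite -big_seq big_const_seq count_predT iter_addr_0 -[_ *+ _]mulr_natl.
  by rewrite divff // pnatr_eq0.
by rewrite in_fset_set ?inE /=; [move=> ->; rewrite mul1r|exact: finite_nb].
Qed.

Lemma srw_step_out x y : y \notin nb x -> srw_step x y = 0.
Proof.
rewrite /nb /srw_step; have [_|d0] := eqVneq (degree x) 0%N.
  by rewrite inE eq_sym => /negbTE ->.
rewrite in_fset_set; last exact: finite_nb.
by rewrite notin_setE /= => /negP/negbTE ->; rewrite mul0r.
Qed.

Lemma srw_step_ge0 x y : 0 <= srw_step x y.
Proof. by rewrite /srw_step; case: ifP => _; rewrite ?divr_ge0. Qed.

Lemma srw_law_exists x : exists P, @is_srw_law x P.
Proof.
pose q (f : nat -> G) i : R :=
  if i is j.+1 then srw_step (f j) (f j.+1) else (f 0%N == x)%:R.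
pose m s := \prod_(i < size s) q (nth x s) i.
pose br s := if s is a :: s' then nb (last a s') else [:: x].
pose q' s t : R := if s is a :: s' then srw_step (last a s') t else (t == x)%:R.
have mr s t : m (rcons s t) = m s * q' s t.
  rewrite /m size_rcons big_ord_recr /=; congr (_ * _).
    apply: eq_bigr => -[[|i] ilt] _ /=; rewrite !nth_rcons ilt //.
    by rewrite (ltnW ilt).
  case: s => [//|a s] /=; rewrite -rcons_cons !nth_rcons /= ltnSn ltnn eqxx.
  by rewrite (last_nth x).
have [||||s t tb|P HP] := @discrete_extension R G x br m.
- case=> [//|a s] /=; rewrite /nb; case: ifP => // _; exact: fset_uniq.
- move=> s; apply: prodr_ge0 => -[[|i] ilt] _ //=; exact: srw_step_ge0.
- by rewrite /m big_ord0.
- move=> s; under eq_bigr do rewrite mr.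
  rewrite -big_distrr /=; case: s => [|a s] /=.
    by rewrite big_seq1 eqxx mulr1.
  by rewrite srw_step_sum mulr1.
- rewrite mr; case: s tb => [|a s] /=; last by move/srw_step_out ->; rewrite mulr0.
  by rewrite inE => /negbTE ->; rewrite mulr0.
exists P => n f.
have -> : [set S : trajectory x | forall i, (i <= n)%N -> S i = f i] =
  [set S | mkseq S (size (mkseq f n.+1)) = mkseq f n.+1].
  rewrite size_mkseq; apply/seteqP; split => S.
    move=> Sf; apply/eq_in_map => i; rewrite mem_iota /= add0n ltnS; exact: Sf.
  by move/eq_in_map => Sf i ilt; apply: Sf; rewrite mem_iota.
rewrite HP /m size_mkseq big_ord_recl; congr (_ * _)%:E.
apply: eq_bigr => i _; have i_n := ltn_ord i.
rewrite (_ : q _ _ = srw_step (nth x (mkseq f n.+1) i)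
                              (nth x (mkseq f n.+1) i.+1)) //.
by rewrite !nth_mkseq // ltnS ltnW.
Qed.

(* A probability measure satisfying [is_srw_law] is unique, since the cylinders
   form a pi-system generating the sigma-algebra. *)
Definition srw_law x : probability (trajectory x) R :=
  projT1 (cid (srw_law_exists x)).

Lemma srw_lawP x : is_srw_law (srw_law x).
Proof. exact: projT2 (cid (srw_law_exists x)). Qed.

Definition transient := forall x,
  (srw_law x [set S | exists n, (0 < n)%N /\ S n = x] < 1)%E.

End walk.

Section percolation.
Variables (R : realType) (G : sgraph).

Definition config :=
  g_sigma_algebraType (coordinate_sets (edge G) bool).

Definition is_percolation_law (p : R) (P : probability config R) :=
  forall (s : seq (edge G)) (b : edge G -> bool), uniq s ->
    P [set w | forall e, e \in s -> w e = b e] =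
    (\prod_(e <- s) (if b e then p else 1 - p))%:E.

Lemma percolation_law_exists (p : R) :
  exists P, 0 <= p <= 1 -> is_percolation_law p P.
Proof.
have [p01|/negP p01] := boolP (0 <= p <= 1); last by exists (dirac point).
have [p0 p1] := andP p01.
pose w (b : bool) := if b then p else 1 - p.
have w0 b : 0 <= w b by case: b; rewrite //= subr_ge0.
have w1 : w true + w false = 1 by rewrite /w addrC subrK.
pose m s := \prod_(b <- s) w b.
have mr s b : m (rcons s b) = m s * w b by rewrite /m -cats1 big_cat big_seq1.
have [||||s t|P HP] := @discrete_extension R bool false
  (fun=> [:: true; false]) m.
- by [].
- by move=> s; apply: prodr_ge0.
- by rewrite /m big_nil.
- by move=> s; rewrite big_cons big_seq1 !mr -mulrDr w1 mulr1.
- by case: t.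
pose E s n (J : pred nat) (b : nat -> bool) : set (trajectory false) :=
  [set f | mkseq f (size s) = s /\
    forall i, (size s <= i < size s + n)%N -> J i -> f i = b i].
have HE s n J b : measurable (E s n J b) /\ P (E s n J b) =
    (m s * \prod_(size s <= i < size s + n | J i) w (b i))%:E.
  elim: n s => [|n IH] s.
    rewrite addn0 big_geq // mulr1 -HP.
    suff -> : E s 0%N J b = [set f | mkseq f (size s) = s].
      by split => //; exact: measurable_cylinder.
    apply/seteqP; split => f /=; first by case.
    move=> fs; split => // i; rewrite addn0 => /andP[si].
    by rewrite ltnNge si.
  have Er f : E s n.+1 J b f <->
      exists2 c, J (size s) -> c = b (size s) & E (rcons s c) n J b f.
    split=> [[fs fb]|[c cb []]].
      exists (f (size s)); first by apply: fb; rewrite leqnn -addSnnS leq_addr.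
      split; first by rewrite size_rcons mkseqS fs.
      move=> i; rewrite size_rcons addSnnS => /andP[si iN]; apply: fb.
      by rewrite iN ltnW.
    rewrite size_rcons mkseqS => /rcons_inj[fs fc] fb; split => // i.
    rewrite leq_eqVlt => /andP[/predU1P[<- _|si iN]]; first by rewrite fc.
    by apply: fb; rewrite addSnnS si.
  rewrite big_ltn_cond -?addSnnS ?leq_addr //.
  have [Js|nJs] := boolP (J (size s)).
    have -> : E s n.+1 J b = E (rcons s (b (size s))) n J b.
      apply/seteqP; split => f; rewrite Er.
        by move=> [c /(_ Js) ->].
      by move=> H; exists (b (size s)).
    by have [ME ->] := IH (rcons s (b (size s))); rewrite mr size_rcons mulrA.
  have -> : E s n.+1 J b = E (rcons s true) n J b `|` E (rcons s false) n J b.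
    apply/seteqP; split => f.
      by rewrite Er => -[[] _ H]; [left|right].
    by case=> H; rewrite Er; [exists true|exists false] => //; rewrite (negbTE nJs).
  have [MT ET] := IH (rcons s true); have [MF EF] := IH (rcons s false).
  split; first exact: measurableU.
  rewrite measureU //; last first.
    apply/seteqP; split => f //= [[HT _] [HF _]].
    by move: HT HF; rewrite ![size (rcons _ _)]size_rcons => -> /rcons_inj[].
  transitivity (P (E (rcons s true) n J b) + P (E (rcons s false) n J b))%E => //.
  rewrite ET EF -EFinD !mr !size_rcons -mulrDl -mulrDr w1 mulr1 //.
pose X0 (f : trajectory false) : config := fun e => f (choice.pickle e).
have mX : measurable_fun setT X0.
  apply: (@measurability _ _ _ config setT _ (coordinate_sets (edge G) bool)).
    by [].
  move=> _ [_ [e [t ->]] <-]; rewrite setTI; apply: sub_sigma_algebra.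
  by exists (choice.pickle e), t.
pose XP := isMeasurableFun.Build _ _ _ _ _ mX.
pose X : {mfun _ >-> config} := HB.pack X0 XP.
exists (distribution P X) => _ s b us.
pose b' i := if choice.unpickle i is Some e then b e else false.
pose J := map choice.pickle s.
pose N := (\max_(e <- s) choice.pickle e).+1.
have [_] := HE [::] N (mem J) b'.
rewrite add0n /m big_nil mul1r => HN.
transitivity (P (E [::] N (mem J) b')).
  rewrite /distribution /pushforward; congr (P _); apply/seteqP; split => f /=.
    move=> H; split => // i _ /mapP[e es ->]; rewrite /b' choice.pickleK; exact: H.
  move=> [_ H] e es; have := H (choice.pickle e).
  rewrite /b' choice.pickleK; apply; last exact: map_f.
  by rewrite /= add0n ltnS; apply: leq_bigmax_seq.
rewrite HN; congr (_%:E); rewrite -big_filter.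
rewrite (perm_big J); last first.
  apply: uniq_perm; first by rewrite filter_uniq ?iota_uniq.
    by rewrite map_inj_uniq //; exact: (pcan_inj choice.pickleK).
  move=> i; rewrite mem_filter mem_index_iota /=.
  case: (boolP (i \in J)) => //= /mapP[e es ->].
  by rewrite ltnS; apply: leq_bigmax_seq.
by rewrite big_map; apply: eq_bigr => e _; rewrite /b' choice.pickleK.
Qed.

(* For [0 <= p <= 1], a probability measure satisfying [is_percolation_law p]
   is unique; outside this range the value is irrelevant. *)
Definition percolation_law (p : R) : probability config R :=
  projT1 (cid (percolation_law_exists p)).

Lemma percolation_lawP (p : R) :
  0 <= p <= 1 -> is_percolation_law p (percolation_law p).
Proof. exact: projT2 (cid (percolation_law_exists p)). Qed.

Definition open_adj (w : config) : rel G :=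
  fun x y => `[< exists e : edge G, val e = [fset x; y]%fset /\ w e >].

Definition cluster (w : config) (x : G) : set G :=
  [set y | exists s : seq G, path (open_adj w) x s /\ last x s = y].

Definition p_T (o : G) : R := inf [set p : R | 0 <= p <= 1 /\
  (\int[percolation_law p]_w counting (cluster w o) = +oo)%E].

End percolation.

Section walk_percolation.
Variables (R : realType) (G : sgraph) (o : G) (p : R).

Definition joint_law : probability (trajectory o * config G)%type R :=
  (srw_law R o \x percolation_law G p)%E.

Definition U (n : nat) (z : trajectory o * config G) : \bar R :=
  counting (\bigcup_(k in [set k | (k <= n)%N]) cluster z.2 (z.1 k)).

Definition mean_U (n : nat) : \bar R := (\int[joint_law]_z U n z)%E.

End walk_percolation.

Arguments p_T R {G} o.
Arguments joint_law {R G} o p.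
Arguments U R {G o} n z.
Arguments mean_U {R G} o p n.

(* Main.v *)
Require Import Defs.
From mathcomp Require Import all_boot all_order all_algebra finmap.
From mathcomp Require Import all_classical all_reals all_analysis.
From mathcomp Require Import measurable_realfun ring lra zify.

Set Implicit Arguments.
Unset Strict Implicit.
Unset Printing Implicit Defensive.

Import Order.TTheory GRing.Theory Num.Theory.
Import numFieldNormedType.Exports.

Local Open Scope classical_set_scope.
Local Open Scope ring_scope.

(* The graph is a spherically symmetric tree whose vertices of depth [l] have
   2 or 20 children according to the parity of [i], for [l] in the block
   [[a_i, a_i^2[] with [a_i = 2^(2^i)].  Spheres grow like [20^l] along the
   blocks of odd index, so [p < p_T] forces [20 p < 1], hence subcritical
   clusters everywhere.

   On a tree, every vertex [w] has a highest vertex [top w] in its cluster, and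
   [U_n] counts the [w] such that [top w] has been visited, because the visited
   set contains the ancestors of its elements.  So [U_n] is the sum over the
   visited [v] of the number [Y_v] of [w] with [top w = v].  The events
   [top w = u] and [top w' = v] with [u <> v] are independent or incompatible, so
   the [Y_v] are nonpositively correlated, and given the walk the variance of
   [U_n] is at most [C n].  Its conditional mean is a weight of the visited set
   depending on depths only, whose variance is again at most [C n]: add the steps
   one at a time, and use that the mean weight [H_n(x)] depends on the depth of
   [x] only and is Lipschitz in it.  Chebyshev along squares and monotonicity
   give [U_n / n - E U_n / n -> 0] almost surely.

   Finally [E U_n / n] oscillates: at the end of a block with 20 children the
   walk has speed about 19/21 and every new depth yields a new vertex, while at
   the end of a block with 2 children only about 2n/3 steps are away from the
   root, each contributing at most about [(1 - p) / (1 - 2 p)] in mean. *)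

(** * The tree *)

(** The gap between the two rates has to hold for every subcritical [p], and this fixes the
    branching numbers. The large value 20 forces [p < 1 / 20], so that [(1 - 2 * p)^-1 <= 10 / 9]:
    in a binary block clusters add little, and the rate there is at most about [(1 - p) * (2 / 3) *
    (9 / 8) = (1 - p) * (3 / 4)], while the rate in the other blocks is at least about
    [(1 - p) * (19 / 21)]. With closer branching numbers, large clusters near the threshold could
    compensate the lower speed. Each block ends at the square of its starting depth [a], because the
    mean time spent above the block is only of order [a]; at times of order [a ^ 2] the past is
    negligible. No stationarity is available for an ergodic theorem, hence the variance bounds
    linear in [n]. Their delicate term is the correlation between a return to the current vertex and
    the weight collected later. It stays bounded because returns happen early, at a uniform
    geometric rate, and a walk that has returned collects almost the same mean weight as a fresh
    one. *)

Definition branching (l : nat) : nat :=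
  if odd (trunc_log 2 (trunc_log 2 l)) then 20 else 2.

Lemma branching_ge2 l : (2 <= branching l)%N.
Proof. by rewrite /branching; case: ifP. Qed.

Lemma branching_le20 l : (branching l <= 20)%N.
Proof. by rewrite /branching; case: ifP. Qed.

(* A vertex is the list of the child labels met on the way up to the root, so
   that [behead] is the parent map and [size] the depth. *)
Fixpoint valid (s : seq nat) : bool :=
  if s is c :: s' then (c < branching (size s'))%N && valid s' else true.

Definition vert := {s : seq nat | valid s}.

Lemma valid_behead s : valid s -> valid (behead s).
Proof. by case: s => //= c s /andP[]. Qed.

Definition root : vert := exist _ [::] isT.
Definition parent (v : vert) : vert := exist _ (behead (val v)) (valid_behead (valP v)).
Definition depth (v : vert) : nat := size (val v).
Definition children (v : vert) : seq vert :=
  pmap insub [seq c :: val v | c <- iota 0 (branching (depth v))].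
Definition nbrs (v : vert) : seq vert :=
  if v == root then children v else parent v :: children v.
(** The clause [v != w] removes the loop at the root, where [parent root = root]. *)
Definition tadj : rel vert := fun v w => (v != w) && ((parent v == w) || (parent w == v)).

Lemma parent_root : parent root = root. Proof. by apply: val_inj. Qed.
Lemma depth_root : depth root = 0%N. Proof. by []. Qed.
Lemma depth_parent v : depth (parent v) = (depth v).-1.
Proof. by rewrite /depth /= size_behead. Qed.
Lemma depth_eq0 v : (depth v == 0%N) = (v == root).
Proof. by rewrite -val_eqE /depth size_eq0. Qed.
Lemma depth_gt0 v : (0 < depth v)%N = (v != root).
Proof. by rewrite lt0n depth_eq0. Qed.

Lemma mem_children v w : (w \in children v) = (w != root) && (parent w == v).
Proof.
rewrite /children mem_pmap_sub; apply/mapP/andP.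
  move=> [c]; rewrite mem_iota => /= cb wE; split.
    by rewrite -val_eqE /= wE.
  by rewrite -val_eqE /= wE.
rewrite /depth -val_eqE -[parent w == v]val_eqE /= => -[w0 /eqP <-].
have := valP w; rewrite /=; case: (sval w) w0 => [|c s] //= _ /andP[cb _].
by exists c; rewrite ?mem_iota.
Qed.

Lemma uniq_children v : uniq (children v).
Proof.
rewrite /children; apply: pmap_sub_uniq; rewrite map_inj_uniq ?iota_uniq //.
by move=> a b [].
Qed.

Lemma size_children v : size (children v) = branching (depth v).
Proof.
rewrite /children size_pmap_sub count_map -[RHS](size_iota 0).
apply/eqP; rewrite -all_count; apply/allP => c; rewrite mem_iota /= => cb.
by rewrite cb (valP v).
Qed.

Lemma depth_child v w : w \in children v -> depth w = (depth v).+1.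
Proof.
rewrite mem_children -depth_gt0 => /andP[w0 /eqP <-].
by rewrite depth_parent prednK.
Qed.

Lemma tadj_sym : symmetric tadj.
Proof. by move=> v w; rewrite /tadj eq_sym orbC. Qed.
Lemma tadj_irr : irreflexive tadj.
Proof. by move=> v; rewrite /tadj eqxx. Qed.

Definition osc_tree : sgraph := SGraph tadj_sym tadj_irr.

Lemma parent_eq v : (parent v == v) = (v == root).
Proof.
apply/idP/eqP => [/eqP pv|->]; last by rewrite parent_root.
apply/eqP; rewrite -depth_eq0; have := depth_parent v; rewrite pv; case: (depth v) => //=.
by move=> n /esym /n_Sn.
Qed.

Lemma mem_nbrs v w : (w \in nbrs v) = tadj v w.
Proof.
rewrite /nbrs /tadj; have [->|v0] := eqVneq v root.
  rewrite mem_children parent_root eq_sym (eq_sym root).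
  by have [->|] := eqVneq w root.
rewrite inE mem_children (eq_sym w (parent v)).
have [vw|vw] /= := eqVneq v w.
  by rewrite -vw !parent_eq v0 (negbTE v0).
case: (parent v == w) => //=; have [->|] //= := eqVneq w root.
by rewrite parent_root eq_sym (negbTE v0).
Qed.

Lemma uniq_nbrs v : uniq (nbrs v).
Proof.
rewrite /nbrs; case: eqVneq => [_|v0]; rewrite /= uniq_children // andbT.
rewrite mem_children negb_and negbK; apply/orP.
have [|p0] := eqVneq (parent v) root; [by left|right].
apply/eqP => /(congr1 depth); rewrite !depth_parent.
by move: p0; rewrite -depth_gt0 depth_parent; lia.
Qed.

Lemma size_nbrs v : size (nbrs v) = ((v != root) + branching (depth v))%N.
Proof. by rewrite /nbrs; case: eqVneq => _ /=; rewrite size_children. Qed.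

Lemma size_nbrs_gt0 v : (0 < size (nbrs v))%N.
Proof. by rewrite size_nbrs; have := branching_ge2 (depth v); lia. Qed.

(** * Automorphisms of the tree *)

Fixpoint relabel (t : nat -> nat -> nat) (s : seq nat) : seq nat :=
  if s is c :: s' then t (size s') c :: relabel t s' else [::].

Definition swap (a b c : nat) := if c == a then b else if c == b then a else c.

Lemma swapK a b : involutive (swap a b).
Proof.
move=> c; rewrite /swap; have [->|ca] := eqVneq c a.
  by rewrite eqxx; case: eqVneq => [->|//].
have [->|cb] := eqVneq c b; first by rewrite eqxx.
by rewrite (negbTE ca) (negbTE cb).
Qed.

Lemma size_relabel t s : size (relabel t s) = size s.
Proof. by elim: s => //= c s ->. Qed.

Lemma relabelK t : (forall l, involutive (t l)) -> involutive (relabel t).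
Proof. by move=> tK; elim=> //= c s IH; rewrite size_relabel tK IH. Qed.

Lemma valid_relabel t s : (forall l c, c < branching l -> t l c < branching l)%N ->
  valid s -> valid (relabel t s).
Proof.
by move=> tb; elim: s => //= c s IH /andP[cb /IH ->]; rewrite size_relabel tb.
Qed.

(** At each depth, exchange the two labels that [x] and [y] carry there. The exchange depends on the
    depth alone, so relabelling commutes with [behead] and is a tree automorphism. *)
Lemma relabel_transitive x y : valid x -> valid y -> size x = size y ->
  exists t, [/\ forall l, involutive (t l),
    forall l c, (c < branching l -> t l c < branching l)%N & relabel t x = y].
Proof.
elim: x y => [|c x IH] [|c' y] //= => [_ _ _|].
  by exists (fun _ c => c).
move=> /andP[cx vx] /andP[cy vy] [sxy].
have [t [tK tb txy]] := IH _ vx vy sxy.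
exists (fun l => if l == size x then swap c c' else t l); split => [l|l a|].
- by case: eqP => // _; exact: swapK.
- case: eqP => [->|_]; last exact: tb.
  by rewrite /swap; case: (eqVneq a c) => _ ab; [rewrite sxy|case: eqP].
- rewrite eqxx /swap eqxx; congr (_ :: _).
  (* Relabelling [x] only reads levels below [size x], so the new value of [t] at that level does
     not affect it; the inequality is the invariant for the induction on suffixes. *)
  rewrite -txy; have : (size x <= size x)%N by [].
  move: {1 4 5}x => s; elim: s => //= a s IHs hs.
  by rewrite (ltn_eqF hs) IHs // ltnW.
Qed.

Lemma automorphism_transitive x y : depth x = depth y ->
  exists f : vert -> vert,
    [/\ involutive f, forall v, parent (f v) = f (parent v),
        forall v, depth (f v) = depth v & f x = y].
Proof.
move=> xy; have [t [tK tb txy]] := relabel_transitive (valP x) (valP y) xy.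
pose f (v : vert) : vert :=
  exist _ (relabel t (val v)) (valid_relabel tb (valP v)).
exists f; split=> [v|v|v|]; try exact: val_inj.
- by apply: val_inj; rewrite /= relabelK.
- by apply: val_inj => /=; case: (val v).
- by rewrite /depth /= size_relabel.
Qed.

Lemma nbrs_automorphism (f : vert -> vert) x : involutive f ->
  (forall v, parent (f v) = f (parent v)) -> perm_eq (nbrs (f x)) (map f (nbrs x)).
Proof.
move=> fK fp; apply: uniq_perm; first exact: uniq_nbrs.
  by rewrite map_inj_uniq ?uniq_nbrs //; exact: inv_inj.
have nbf a b : tadj (f a) (f b) = tadj a b.
  by rewrite /tadj !fp !(inj_eq (inv_inj fK)).
move=> y; rewrite mem_nbrs -{1}(fK y) nbf -mem_nbrs.
by rewrite -[in RHS](fK y) (mem_map (inv_inj fK)).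
Qed.

(** * Expectations over walk paths *)

Section path_expectation.
Variable R : realType.
Implicit Types (f g : vert -> R) (F : seq vert -> R) (x y z : vert).

Definition step_mean f x : R := (\sum_(y <- nbrs x) f y) / (size (nbrs x))%:R.

(** The expectation of [F] over [n] steps from [x], with the start included in the path. The
    recursion makes first-step analysis a computation; [walk_mean_rcons] is the last-step form, and
    [walk_integral] the link with the law of the walk. *)
Fixpoint walk_mean n x F : R :=
  if n is n'.+1 then step_mean (fun y => walk_mean n' y (fun s => F (x :: s))) x
  else F [:: x].

Lemma nbrsR_gt0 x : 0 < (size (nbrs x))%:R :> R.
Proof. by rewrite ltr0n size_nbrs_gt0. Qed.

Lemma eq_step_mean f g x : (forall y, tadj x y -> f y = g y) -> step_mean f x =
  step_mean g x.
Proof.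
by move=> fg; congr (_ / _); apply: eq_big_seq => y; rewrite mem_nbrs; exact: fg.
Qed.

Lemma step_mean_le f g x : (forall y, tadj x y -> f y <= g y) -> step_mean f x <=
  step_mean g x.
Proof.
move=> fg; rewrite ler_pM2r ?invr_gt0 ?nbrsR_gt0 // big_seq [leRHS]big_seq.
by apply: ler_sum => y; rewrite mem_nbrs; exact: fg.
Qed.

Lemma step_mean_cst c x : step_mean (fun=> c) x = c.
Proof.
rewrite /step_mean big_const_seq count_predT iter_addr_0 -[_ *+ _]mulr_natr mulfK //.
exact: lt0r_neq0 (nbrsR_gt0 _).
Qed.

Lemma step_meanD f g x : step_mean (fun y => f y + g y) x = step_mean f x + step_mean g x.
Proof. by rewrite /step_mean big_split mulrDl. Qed.

Lemma step_meanZ c f x : step_mean (fun y => c * f y) x = c * step_mean f x.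
Proof. by rewrite /step_mean -mulr_sumr mulrA. Qed.

Lemma step_meanB f g x : step_mean (fun y => f y - g y) x = step_mean f x - step_mean g x.
Proof. by rewrite /step_mean sumrB mulrBl. Qed.

Lemma walk_mean_le n x F F' :
  (forall s, path tadj x s -> size s = n -> F (x :: s) <= F' (x :: s)) ->
  walk_mean n x F <= walk_mean n x F'.
Proof.
elim: n x F F' => [|n IH] x F F' h /=; first exact: h.
apply: step_mean_le => y xy; apply: IH => s ys sn; apply: h => /=; first by rewrite xy.
by rewrite sn.
Qed.

Lemma eq_walk_mean n x F F' :
  (forall s, path tadj x s -> size s = n -> F (x :: s) = F' (x :: s)) ->
  walk_mean n x F = walk_mean n x F'.
Proof.
by move=> h; apply/eqP; rewrite eq_le; apply/andP; split;
  apply: walk_mean_le => s xs sn; rewrite h.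
Qed.

Lemma walk_mean_cst n x c : walk_mean n x (fun=> c) = c.
Proof.
elim: n x => [//|n IH] x /=; rewrite -[RHS](step_mean_cst c x).
by apply: eq_step_mean => y _; exact: IH.
Qed.

Lemma walk_meanD n x F F' : walk_mean n x (fun s => F s + F' s) =
  walk_mean n x F + walk_mean n x F'.
Proof.
by elim: n x F F' => [//|n IH] x F F' /=; rewrite -step_meanD; apply: eq_step_mean => y _.
Qed.

Lemma walk_meanB n x F F' : walk_mean n x (fun s => F s - F' s) =
  walk_mean n x F - walk_mean n x F'.
Proof.
by elim: n x F F' => [//|n IH] x F F' /=; rewrite -step_meanB; apply: eq_step_mean => y _.
Qed.

Lemma walk_meanZ n x c F : walk_mean n x (fun s => c * F s) = c * walk_mean n x F.
Proof.
by elim: n x F => [//|n IH] x F /=; rewrite -step_meanZ; apply: eq_step_mean => y _.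
Qed.

Lemma walk_mean_rcons n x F : walk_mean n.+1 x F =
  walk_mean n x (fun s => step_mean (fun y => F (rcons s y)) (last root s)).
Proof.
elim: n x F => [//|n IH] x F.
have -> : walk_mean n.+2 x F = step_mean (fun y => walk_mean n.+1 y (fun s => F (x ::
  s))) x by [].
by rewrite [RHS]/=; apply: eq_step_mean => y xy; rewrite IH; apply: eq_walk_mean.
Qed.

Lemma walk_mean_last n x f : walk_mean n x (fun s => f (last root s)) =
  iter n step_mean f x.
Proof.
elim: n x => [//|n IH] x; rewrite /=; apply: eq_step_mean => y xy; rewrite -IH.
by apply: eq_walk_mean.
Qed.

Lemma step_mean_automorphism (a : vert -> vert) f x : involutive a ->
  (forall v, parent (a v) = a (parent v)) -> step_mean f (a x) = step_mean (f \o a) x.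
Proof.
move=> aK ap; rewrite /step_mean (perm_size (nbrs_automorphism x aK ap)) size_map.
by rewrite (perm_big _ (nbrs_automorphism x aK ap)) big_map.
Qed.

Lemma walk_mean_automorphism (a : vert -> vert) n x F : involutive a ->
  (forall v, parent (a v) = a (parent v)) ->
  walk_mean n (a x) F = walk_mean n x (F \o map a).
Proof.
move=> aK ap; elim: n x F => [//|n IH] x F /=.
by rewrite step_mean_automorphism //; apply: eq_step_mean => y _ /=; rewrite IH.
Qed.

(** A strict supersolution. Away from the root, with [b] children, one step multiplies it by
    [(3 / 2 + 2 / 3 * b) / (1 + b)], which decreases in [b] and equals [17 / 18] at [b = 2]. It
    controls hitting probabilities, return times and occupation times. *)
Definition decay x : R := (2 / 3) ^+ depth x.

Lemma decay_gt0 x : 0 < decay x.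
Proof. by apply: exprn_gt0; lra. Qed.

Lemma step_mean_depth (h : nat -> R) x : step_mean (fun y => h (depth y)) x =
  (((x != root)%:R * h (depth x).-1 + (branching (depth x))%:R * h (depth x).+1)
   / ((x != root)%:R + (branching (depth x))%:R)).
Proof.
rewrite /step_mean size_nbrs natrD; congr (_ / _); rewrite /nbrs.
have hc : \sum_(y <- children x) h (depth y) = (branching (depth x))%:R * h (depth x).+1.
  rewrite big_seq (eq_bigr (fun=> h (depth x).+1)); last first.
    by move=> y /depth_child ->.
  rewrite -big_seq big_const_seq count_predT size_children iter_addr_0.
  by rewrite mulr_natl.
case: eqVneq => _ /=; first by rewrite hc mul0r add0r.
by rewrite big_cons hc depth_parent mul1r.
Qed.

Lemma branching_ge2R l : 2 <= (branching l)%:R :> R.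
Proof. by rewrite (ler_nat R 2) branching_ge2. Qed.

Lemma step_mean_decay x : step_mean decay x <= 17 / 18 * decay x.
Proof.
rewrite /decay (step_mean_depth (fun l => (2 / 3) ^+ l)).
have b2 := branching_ge2R (depth x); have [x0|x0] := eqVneq x root; rewrite /=.
  rewrite mul0r !add0r mulrAC mulfV ?mul1r; last by lra.
  rewrite exprS; apply: ler_wpM2r; [exact: ltW (decay_gt0 x)|lra].
rewrite !mul1r ler_pdivrMr; last by lra.
rewrite -depth_gt0 in x0; move: b2; case: (depth x) x0 => // l _ /=.
have := @exprn_gt0 R l (2 / 3); rewrite !exprS; set a := (2 / 3) ^+ l.
set b := (branching _)%:R; move=> /(_ ltac:(lra)) a0 b2.
rewrite -subr_ge0 (_ : _ - _ = a * ((2 / 3) * (17 / 18) * (1 + b) - 1 - 4 / 9 * b)).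
  by apply: mulr_ge0; lra.
by field.
Qed.

End path_expectation.

(** * Mean and variance of a depth-dependent weight of the visited set *)

Section visited_weight.
Variables (R : realType) (zeta : vert -> R) (K : R).
Hypothesis zeta_depth : forall x y, depth x = depth y -> zeta x = zeta y.
Hypothesis zeta_bnd : forall x, 0 <= zeta x <= K.
Implicit Types (x y z : vert) (s : seq vert).

Let K0 : 0 <= K.
Proof. by have /andP[] := zeta_bnd root; exact: le_trans. Qed.

Definition weight s : R := \sum_(v <- undup s) zeta v.
Definition mean_weight n x : R := walk_mean n x weight.

Lemma weight_ge0 s : 0 <= weight s.
Proof. by apply: sumr_ge0 => v _; case/andP: (zeta_bnd v). Qed.

Lemma weight_cons x s : weight (x :: s) = weight s + (x \notin s)%:R * zeta x.
Proof.
rewrite /weight /=; case: ifP => _ /=; first by rewrite mul0r addr0.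
by rewrite big_cons mul1r addrC.
Qed.

Lemma eq_weight s s' : s =i s' -> weight s = weight s'.
Proof. by move=> ss; apply: perm_big; exact: perm_undup. Qed.

Lemma weight_rcons s x : weight (rcons s x) = weight s + (x \notin s)%:R * zeta x.
Proof. by rewrite -weight_cons; apply: eq_weight => y; rewrite mem_rcons. Qed.

(** The start adds its weight to that of the later path exactly when this path avoids it. *)
Lemma mean_weight_step n x : mean_weight n.+1 x = step_mean (mean_weight n) x +
  zeta x * (1 - step_mean (fun y => walk_mean n y (fun s => (x \in s)%:R)) x).
Proof.
rewrite mulrBr mulr1 -step_meanZ -{1}(step_mean_cst (zeta x) x) -step_meanB
  -step_meanD /mean_weight /=.
apply: eq_step_mean => y _; rewrite -walk_meanZ -{1}(walk_mean_cst n y (zeta x))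
  -walk_meanB -walk_meanD.
apply: eq_walk_mean => s _ _; rewrite weight_cons; case: (_ \in _) => /=; ring.
Qed.

Lemma mean_weight_ge n x : mean_weight n x <= mean_weight n.+1 x.
Proof.
rewrite [leRHS]/mean_weight walk_mean_rcons; apply: walk_mean_le => s _ _.
rewrite -[leLHS](step_mean_cst _ (last root (x :: s))); apply: step_mean_le => y _.
rewrite weight_rcons lerDl mulr_ge0 //; by case/andP: (zeta_bnd y).
Qed.

Lemma mean_weight_leD n x : mean_weight n.+1 x <= mean_weight n x + K.
Proof.
rewrite /mean_weight -{1}(walk_mean_cst n x K) walk_mean_rcons -walk_meanD;
  apply: walk_mean_le => s _ _.
rewrite -[leRHS](step_mean_cst _ (last root (x :: s))); apply: step_mean_le => y _.
rewrite weight_rcons lerD2l; have /andP[z0 zK] := zeta_bnd y.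
by case: (_ \in _) => /=; rewrite ?mul0r ?mul1r.
Qed.

(** An automorphism carrying [x] to [y] preserves depths, hence weights, and transports the walk. *)
Lemma mean_weight_depth n x y : depth x = depth y -> mean_weight n x = mean_weight n y.
Proof.
move=> /automorphism_transitive[a [aK ap al <-]].
rewrite /mean_weight walk_mean_automorphism //; apply: eq_walk_mean => s _ _ /=.
rewrite /weight -map_cons undup_map_inj; last exact: inv_inj.
by rewrite big_map; apply: eq_bigr => v _; apply: zeta_depth; rewrite al.
Qed.

Lemma walk_mean_mem_01 n x y : 0 <= walk_mean n y (fun s => (x \in s)%:R : R) <= 1.
Proof.
apply/andP; split; [rewrite -{1}(walk_mean_cst n y 0)|rewrite -[leRHS](walk_mean_cst
  n y 1)];
  by apply: walk_mean_le => s _ _; case: (_ \in _).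
Qed.

Lemma step_mean_walk_mean_mem_01 n x :
  0 <= step_mean (fun y => walk_mean n y (fun s => (x \in s)%:R : R)) x <= 1.
Proof.
apply/andP; split; [rewrite -{1}(@step_mean_cst R 0 x)|rewrite
  -[leRHS](@step_mean_cst R 1 x)];
  by apply: step_mean_le => y _; have /andP[] := walk_mean_mem_01 n x y.
Qed.

(** Both quantities lie below [mean_weight n.+1 x] by an amount in [[0, K]]: one by adding a last
    step, the other by adding a first step. *)
Lemma mean_weight_harmonic n x : `|mean_weight n x - step_mean (mean_weight n) x| <= K.
Proof.
have := mean_weight_step n x; have := mean_weight_ge n x; have := mean_weight_leD n x.
have := step_mean_walk_mean_mem_01 n x; have := zeta_bnd x;
  set r := step_mean (fun _ => _) x.
move=> /andP[z0 zK] /andP[r0 r1] h1 h2 h3.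
have : 0 <= zeta x * (1 - r) <= K.
  rewrite mulr_ge0 //=; last by lra.
  rewrite (le_trans _ zK) // -[leRHS]mulr1 ler_wpM2l //; lra.
by move=> /andP[]; rewrite ler_norml; lra.
Qed.

(* At a depth [l] with [b] children per vertex, near-harmonicity reads
   [b * (H(l+1) - H(l)) = (H(l) - H(l-1)) + O((b + 1) K)], a recursion that
   contracts because [b >= 2]. *)
Lemma mean_weight_lipschitz_child n x y :
  y \in children x -> `|mean_weight n y - mean_weight n x| <= 3 * K.
Proof.
move: {2}(depth x) (erefl (depth x)) => l; elim: l x y => [|l IH] x y lx yx.
  have x0 : x = root by apply/eqP; rewrite -depth_eq0 lx.
  (* At the root all neighbours have the same depth, so the average is the common value. *)
  have -> : mean_weight n y = step_mean (mean_weight n) x.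
    rewrite -[LHS](step_mean_cst _ x); apply: eq_step_mean => z;
      rewrite -mem_nbrs /nbrs x0 eqxx -x0.
    by move=> zx; apply: mean_weight_depth; rewrite (depth_child zx) (depth_child yx).
  rewrite distrC; apply: le_trans (mean_weight_harmonic n x) _; have := K0; lra.
have x0 : x != root by rewrite -depth_gt0 lx.
have := IH (parent x) x; rewrite depth_parent lx => /(_ erefl).
rewrite mem_children x0 eqxx => /(_ isT) h.
have := mean_weight_harmonic n x.
have -> : step_mean (mean_weight n) x =
  (mean_weight n (parent x) + (branching (depth x))%:R * mean_weight n y) / (1 +
    (branching (depth x))%:R).
  rewrite /step_mean size_nbrs x0 natrD; congr (_ / _);
    rewrite /nbrs (negbTE x0) big_cons.
  congr (_ + _); rewrite big_seq (eq_bigr (fun=> mean_weight n y)); last first.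
    by move=> z zx; apply: mean_weight_depth; rewrite (depth_child zx) (depth_child yx).
  rewrite -big_seq big_const_seq count_predT size_children iter_addr_0.
  by rewrite mulr_natl.
have := branching_ge2R R (depth x); set b := (branching _)%:R => b2.
move: h; set a := mean_weight n (parent x); set c := mean_weight n x;
  set d := mean_weight n y => h.
have b1 : 0 < 1 + b by lra.
rewrite (_ : c - (a + b * d) / (1 + b) = ((1 + b) * c - a - b * d) / (1 + b)); last first.
  by field; apply: lt0r_neq0.
rewrite normrM normfV (gtr0_norm b1) ler_pdivrMr // => h2.
have bpos : 0 < b by lra.
rewrite -(ler_pM2l bpos) -[X in X * _](gtr0_norm bpos) -normrM.
move: h h2; rewrite !ler_norml => /andP[h1 h2] /andP[h3 h4].
(* The constant 3 closes the induction: [3 * K + (1 + b) * K <= b * (3 * K)] amounts to [b >= 2] up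
   to the factor [2 * K]. *)
have : 0 <= K * (b - 2) by rewrite mulr_ge0 //; lra.
by move=> hK; apply/andP; split; lra.
Qed.

Lemma mean_weight_lipschitz n x y :
  tadj x y -> `|mean_weight n y - mean_weight n x| <= 3 * K.
Proof.
move=> xy; have : (y \in children x) || (x \in children y).
  rewrite !mem_children; case/andP: xy => nxy /orP[/eqP pxy|/eqP pyx].
    apply/orP; right; rewrite pxy eqxx andbT; apply: contraNneq nxy => x0.
    by rewrite -pxy x0 parent_root.
  apply/orP; left; rewrite pyx eqxx andbT; apply: contraNneq nxy => y0.
  by rewrite -pyx y0 parent_root.
case/orP => h; first exact: mean_weight_lipschitz_child.
by rewrite distrC; exact: mean_weight_lipschitz_child.
Qed.

(* Expectation of [tau 1(tau <= n)], where [tau] is the hitting time of [x] by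
   the walk started at the last argument. *)
Fixpoint hit_time x n z : R :=
  if n is n'.+1 then
    if z == x then 0
    else step_mean (fun y => hit_time x n' y + walk_mean n' y (fun s => (x \in s)%:R)) z
  else 0.

Lemma hit_step x n z : z != x ->
  walk_mean n.+1 z (fun s => (x \in s)%:R : R) =
  step_mean (fun y => walk_mean n y (fun s => (x \in s)%:R)) z.
Proof.
move=> zx /=; apply: eq_step_mean => y _; apply: eq_walk_mean => s _ _.
by rewrite !inE [x == z]eq_sym (negbTE zx).
Qed.

Lemma hit_self x n : walk_mean n x (fun s => (x \in s)%:R : R) = 1.
Proof. by rewrite -[RHS](walk_mean_cst n x 1); apply: eq_walk_mean => s _ _;
  rewrite inE eqxx. Qed.

(** Optional stopping for the supermartingale [decay], which equals [decay R x] at the hitting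
    time. *)
Lemma hit_prob_le x n z :
  walk_mean n z (fun s => (x \in s)%:R) <= decay R z / decay R x.
Proof.
have u0 := decay_gt0 R; elim: n z => [|n IH] z.
  rewrite /= inE; case: eqVneq => [->|_]; last by rewrite divr_ge0 ?ltW.
  by rewrite divff ?lt0r_neq0.
have [->|zx] := eqVneq z x; first by rewrite hit_self divff ?lt0r_neq0.
rewrite hit_step //; apply: le_trans (_ :
  step_mean (fun y => (decay R x)^-1 * decay R y) z <= _).
  by apply: step_mean_le => y _; rewrite mulrC; exact: IH.
rewrite step_meanZ mulrC ler_pM2r ?invr_gt0 //; apply: le_trans (step_mean_decay R z) _.
by have := u0 z; lra.
Qed.

(** One step adds the hitting probability to the expectation, and the constant is preserved because
    [(17 + 1) * (17 / 18) = 17]. *)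
Lemma hit_time_le x n z : hit_time x n z <= 17 * (decay R z / decay R x).
Proof.
have u0 := decay_gt0 R; elim: n z => [|n IH] z /=.
  by rewrite mulr_ge0 // divr_ge0 ?ltW.
case: eqVneq => [->|zx]; first by rewrite divff ?lt0r_neq0 // mulr1.
apply: le_trans (_ : step_mean (fun y => 18 * (decay R x)^-1 * decay R y) z <= _).
  apply: step_mean_le => y _; have := IH y; have := hit_prob_le x n y.
  rewrite -mulrA [_^-1 * _]mulrC; lra.
rewrite step_meanZ mulrAC [leRHS]mulrA ler_pM2r ?invr_gt0 //.
by have := step_mean_decay R z; lra.
Qed.

(* After hitting [x] at time [tau] the walk starts afresh with [n - tau] steps
   left, and these lose at most [K tau]. *)
Lemma weight_hit_ge x n z :
  walk_mean n z (fun s => (x \in s)%:R) * mean_weight n x - K * hit_time x n z <=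
  walk_mean n z (fun s => (x \in s)%:R * weight s).
Proof.
elim: n z => [|n IH] z.
  rewrite /= !inE mulr0 subr0; case: eqVneq => [->|_]; last by rewrite !mul0r.
  by rewrite !mul1r.
have [->|zx] := eqVneq z x.
  rewrite hit_self mul1r /hit_time eqxx mulr0 subr0; apply: walk_mean_le => s _ _.
  by rewrite inE eqxx mul1r.
rewrite hit_step //= (negbTE zx) mulrC -!step_meanZ -step_meanB;
  apply: step_mean_le => y _.
apply: le_trans (_ : walk_mean n y (fun s => (x \in s)%:R * weight s) <= _); last first.
  apply: walk_mean_le => s _ _; rewrite [x \in z :: _]inE [x == z]eq_sym (negbTE zx) /=.
  rewrite ler_wpM2l // [leRHS]weight_cons lerDl mulr_ge0 //.
  by case/andP: (zeta_bnd z).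
apply: le_trans (IH y); have := mean_weight_leD n x;
  have /andP[] := walk_mean_mem_01 n x y.
set q := walk_mean n y _; set t := hit_time x n y => q0 q1 h.
have : 0 <= q * (mean_weight n x + K - mean_weight n.+1 x) by rewrite mulr_ge0 //; lra.
lra.
Qed.

(** The variance is at most the mean square deviation from any centre [A]. *)
Lemma step_mean_variance_le f c A x : (forall y, tadj x y -> `|f y - A| <= c) ->
  step_mean (fun y => f y ^+ 2) x - step_mean f x ^+ 2 <= c ^+ 2 :> R.
Proof.
move=> h; have -> : step_mean (fun y => f y ^+ 2) x =
    step_mean (fun y => (f y - A) ^+ 2) x + (2 * A) * step_mean f x - A ^+ 2.
  rewrite -step_meanZ -{1}(step_mean_cst (A ^+ 2) x) -step_meanD -step_meanB;
    apply: eq_step_mean => y _; ring.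
have : step_mean (fun y => (f y - A) ^+ 2) x <= c ^+ 2.
  rewrite -{1}(step_mean_cst (c ^+ 2) x); apply: step_mean_le => y /h fc.
  by rewrite -[X in X <= _]real_normK ?num_real // lerXn2r // nnegrE (le_trans _ fc).
by have := sqr_ge0 (step_mean f x - A); rewrite sqrrB; lra.
Qed.

(** Each first step adds at most [46 = 9 + 2 * 18 + 1] times [K ^+ 2]: the square of the Lipschitz
    constant [3 * K], twice the covariance between the later weight and the weight [zeta x] counted
    when [x] is avoided, and the variance of that single term. *)
Lemma weight_variance n x :
  walk_mean n x (fun s => weight s ^+ 2) - mean_weight n x ^+ 2 <= 46 * K ^+ 2 * n%:R.
Proof.
elim: n x => [|n IH] x.
  by rewrite mulr0 /mean_weight /= subrr.
set Q := fun y => walk_mean n y (fun s => weight s ^+ 2).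
set B := fun y => walk_mean n y (fun s => (x \in s)%:R * weight s).
set q := fun y => walk_mean n y (fun s => (x \in s)%:R : R).
have -> : walk_mean n.+1 x (fun s => weight s ^+ 2) =
    step_mean Q x + 2 * zeta x * step_mean (mean_weight n) x - 2 * zeta x * step_mean B x
    + zeta x ^+ 2 * (1 - step_mean q x).
  rewrite mulrBr mulr1 -!step_meanZ -{1}(step_mean_cst (zeta x ^+ 2) x) -step_meanD
    -!step_meanB -step_meanD.
  apply: eq_step_mean => y _; rewrite /q /B /Q /mean_weight -!walk_meanZ.
  rewrite -{1}(walk_mean_cst n y (zeta x ^+ 2)) -walk_meanD -!walk_meanB -walk_meanD.
  apply: eq_walk_mean => s _ _; rewrite weight_cons; case: (_ \in _) => /=; ring.
have := mean_weight_step n x; rewrite -/q => H1.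
have := step_mean_walk_mean_mem_01 n x; rewrite -/q => /andP[r0 r1].
have /andP[z0 zK] := zeta_bnd x.
have hv : step_mean (fun y => mean_weight n y ^+ 2) x - step_mean (mean_weight n) x
  ^+ 2 <= (3 * K) ^+ 2.
  by apply: (@step_mean_variance_le _ _ (mean_weight n x)) => y;
    exact: mean_weight_lipschitz.
have hQ : step_mean Q x <= step_mean (fun y => mean_weight n y ^+ 2) x + 46 * K ^+ 2
  * n%:R.
  rewrite -(step_mean_cst (46 * K ^+ 2 * n%:R) x) -step_meanD; apply: step_mean_le => y _.
  by have := IH y; rewrite /Q; lra.
(* A return to [x] restarts the walk, and the weight lost is at most [K] times the mean return time
   over the event of return, which [decay] bounds by 17. *)
have hB : step_mean q x * mean_weight n x - K * 17 <= step_mean B x.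
  apply: le_trans (_ : step_mean (fun y => mean_weight n x * q y - K * hit_time x n
    y) x <= _).
    rewrite step_meanB !step_meanZ [X in X - _]mulrC lerD2l lerN2 ler_wpM2l //.
    apply: le_trans (_ : step_mean (fun y => 17 / decay R x * decay R y) x <= _).
      apply: step_mean_le => y _; have := hit_time_le x n y.
      by rewrite [decay R y / _]mulrC mulrA.
    rewrite step_meanZ mulrAC ler_pdivrMr ?decay_gt0 //.
    by have := step_mean_decay R x; have := decay_gt0 R x; lra.
  by apply: step_mean_le => y _; rewrite mulrC; exact: weight_hit_ge.
have hH : step_mean (mean_weight n) x <= mean_weight n x + K.
  apply: le_trans (mean_weight_leD n x); rewrite H1 lerDl mulr_ge0 //; lra.
have hrB : step_mean q x * step_mean (mean_weight n) x - step_mean B x <= 18 * K.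
  have : 0 <= step_mean q x * (mean_weight n x + K - step_mean (mean_weight n) x) by
    rewrite mulr_ge0 //; lra.
  have : 0 <= K * (1 - step_mean q x) by rewrite mulr_ge0 //; lra.
  lra.
have hz : zeta x * (step_mean q x * step_mean (mean_weight n) x - step_mean B x) <=
  18 * K ^+ 2.
  apply: le_trans (_ : zeta x * (18 * K) <= _); first by rewrite ler_wpM2l.
  by rewrite mulrCA ler_wpM2l // expr2 ler_wpM2r.
have hz2 : zeta x ^+ 2 * ((1 - step_mean q x) * step_mean q x) <= K ^+ 2.
  apply: le_trans (_ : zeta x ^+ 2 * 1 <= _); last first.
    by rewrite mulr1 lerXn2r ?nnegrE.
  rewrite ler_wpM2l ?sqr_ge0 //.
  have : 0 <= (1 - step_mean q x) * (1 - step_mean q x) by rewrite mulr_ge0 //; lra.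
  lra.
rewrite H1 -[n.+1%:R]natr1.
move: hv hQ hz hz2.
set r := step_mean q x; set b := step_mean B x; set h := step_mean (mean_weight n) x.
set z := zeta x; set P2 := step_mean (fun _ => _) x; set PQ := step_mean Q x;
  set nn := n%:R.
move=> hv hQ hz hz2.
rewrite (_ : _ - _ = PQ - h ^+ 2 + 2 * (z * (r * h - b)) + z ^+ 2 * ((1 - r) * r)).
  rewrite [_ * (nn + 1)]mulrDr mulr1; move: hv; rewrite exprMn; lra.
ring.
Qed.

End visited_weight.

(** * Elementary properties of the graph *)

Lemma neighboursE (x : osc_tree) : neighbours x = [set` [fset y in nbrs x]%fset].
Proof. by apply/seteqP; split => y /=; rewrite in_fset /= mem_nbrs. Qed.

Lemma degreeE (x : osc_tree) : degree x = size (nbrs x).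
Proof.
rewrite /degree neighboursE set_fsetK card_fseq undup_id //; exact: uniq_nbrs.
Qed.

Lemma infinite_osc_tree : infinite_set [set: osc_tree].
Proof.
suff : infinite_set (depth @` [set: vert]).
  by apply: contra_not => finG; exact: finite_image.
have -> : depth @` [set: vert] = setT; last exact: infinite_nat.
apply/seteqP; split => // l _.
elim: l => [|l [v _ lv]]; first by exists root.
have [w wv] : exists w, w \in children v.
  have := size_children v; have := branching_ge2 (depth v).
  by case: (children v) => [|w c] /=; [case: branching|exists w; rewrite inE eqxx].
by exists w => //; rewrite (depth_child wv) lv.
Qed.

Lemma path_to_root (x : vert) : exists s, path tadj x s /\ last x s = root.
Proof.
move: {2}(depth x) (erefl (depth x)) => l; elim: l x => [|l IH] x lx.
  by exists [::]; split => //; apply/eqP; rewrite -depth_eq0 lx.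
have [s [ps ls]] : exists s, path tadj (parent x) s /\ last (parent x) s = root.
  by apply: IH; rewrite depth_parent lx.
exists (parent x :: s); rewrite /= ps ls; split => //.
by rewrite /tadj eqxx andbT eq_sym parent_eq -depth_gt0 lx.
Qed.

Lemma connected_osc_tree : connected_graph osc_tree.
Proof.
move=> x y; have [s [ps ls]] := path_to_root x; have [t [pt lt]] := path_to_root y.
exists (s ++ rev (belast y t)); split; last by rewrite last_cat ls -lt;
  case: t {pt lt} => //= a t; rewrite rev_cons last_rcons.
rewrite cat_path ps ls -lt rev_path /=.
by rewrite (eq_path (e' := tadj)) // => a b; exact: tadj_sym.
Qed.

Lemma bounded_degree_osc_tree : bounded_degree osc_tree.
Proof.
exists 21%N => x; rewrite neighboursE.
have /card_eq_fsetP/card_eqPle[h _] := erefl #|` [fset y in nbrs x]%fset|.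
apply: card_le_trans h _; rewrite card_le_II card_fseq undup_id ?uniq_nbrs //.
by rewrite size_nbrs; have := branching_le20 (depth x); case: (_ != _); lia.
Qed.

(** The root has degree 2 and its children have degree 3. *)
Lemma not_vertex_transitive_osc_tree : ~ vertex_transitive osc_tree.
Proof.
have [c cr] : exists c, c \in children root.
  have := size_children root; rewrite depth_root /=.
  by case: (children root) => [//|w c] /= _; exists w; rewrite inE eqxx.
move=> /(_ root c)[f [[[g fK gK] fa] frc]].
have : perm_eq (nbrs (f root)) (map f (nbrs root)).
  apply: uniq_perm; first exact: uniq_nbrs.
    by rewrite map_inj_uniq ?uniq_nbrs //; exact: can_inj fK.
  move=> y; rewrite mem_nbrs -(gK y) (mem_map (can_inj fK)) mem_nbrs.
  exact: fa.
move/perm_size; rewrite size_map frc !size_nbrs (depth_child cr) depth_root eqxx.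
by move: cr; rewrite mem_children => /andP[-> _].
Qed.

(** * The law of the walk, and transience *)

Section walk_law.
Variable R : realType.
Implicit Types (x y z : vert) (s : seq vert).

Lemma srw_stepE x y : srw_step R (x :
  osc_tree) y = (y \in nbrs x)%:R / (size (nbrs x))%:R.
Proof.
by rewrite /srw_step degreeE eqn0Ngt size_nbrs_gt0 mem_nbrs.
Qed.

Fixpoint path_weight s : R :=
  if s is x :: s' then
    if s' is [::] then 1 else path_weight s' / (size (nbrs x))%:R
  else 1.

Fixpoint paths n x : seq (seq vert) :=
  if n is n'.+1 then flatten [seq map (cons x) (paths n' y) | y <- nbrs x]
  else [:: [:: x]].

Lemma mem_paths n x s : (s \in paths n x) =
  [&& ohead s == Some x, path tadj x (behead s) & size s == n.+1].
Proof.
elim: n x s => [|n IH] x s /=.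
  rewrite inE; apply/eqP/and3P => [->|]; first by split.
  by case: s => [|y [|z s]] [] //= /eqP[->].
apply/flatten_mapP/and3P => [[y yx /mapP[s' + ->]]|].
  rewrite IH => /and3P[]; case: s' => [|y' s'] //= /eqP[->] ys sn.
  by rewrite -mem_nbrs yx ys.
case: s => [|x' [|y s]] [] //= /eqP[->] /andP[xy ys] sn.
exists y; first by rewrite mem_nbrs.
by apply: map_f; rewrite IH /= eqxx ys.
Qed.

Lemma uniq_paths n x : uniq (paths n x).
Proof.
elim: n x => [//|n IH] x /=; apply: allpairs_uniq_dep => /=.
- exact: uniq_nbrs.
- by move=> y _; exact: IH.
- move=> [y s] [y' s'] /allpairsPdep[y1 [s1 [_ + [-> ->]]]] /allpairsPdep[y2 [s2 [_ +
  [-> ->]]]] /= [] /= e.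
  rewrite !mem_paths e => /and3P[/eqP h _ _] /and3P[/eqP h' _ _].
  by move: h'; rewrite h => -[->].
Qed.

Lemma walk_mean_paths n x (F : seq vert -> R) :
  walk_mean n x F = \sum_(s <- paths n x) path_weight s * F s.
Proof.
elim: n x F => [|n IH] x F /=; first by rewrite big_seq1 mul1r.
rewrite big_flatten big_map /= /step_mean mulr_suml; apply: eq_bigr => y _.
rewrite IH mulr_suml big_map big_seq [RHS]big_seq; apply: eq_bigr => s.
by rewrite mem_paths; case: s => [|y' s] //= _; rewrite mulrAC.
Qed.

Lemma srw_law_cylinder n x s : s \in paths n x ->
  srw_law R (x : osc_tree) [set S : trajectory (x :
    osc_tree) | mkseq S n.+1 = s] = (path_weight s)%:E.
Proof.
rewrite mem_paths => /and3P[/eqP hs ps /eqP sn].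
have := @srw_lawP R osc_tree x n (nth root s).
have -> : [set S : trajectory (x :
  osc_tree) | forall i, (i <= n)%N -> S i = nth root s i] =
    [set S | mkseq S n.+1 = s].
  apply/seteqP; split => S /=.
    move=> h; apply: (@eq_from_nth _ root); rewrite size_mkseq // => i il.
    by rewrite nth_mkseq // h.
  by move=> <- i il; rewrite nth_mkseq.
move=> ->; congr (_%:E).
have -> : nth root s 0 = x by case: s hs {ps sn} => //= y s [].
rewrite eqxx mul1r; elim: n x s hs ps sn => [|n IH] x [|x' [|y s]] //= [->].
  by rewrite big_ord0.
move=> /andP[xy ys] [sn]; rewrite big_ord_recl /= srw_stepE mem_nbrs xy mul1r mulrC.
by congr (_ / _); apply: (IH y (y :: s)) => //=; rewrite sn.
Qed.

Lemma measurable_walk d (T : measurableType d) x n (F : seq vert -> T) :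
  measurable_fun setT (fun S : trajectory (x : osc_tree) => F (mkseq S n)).
Proof.
move=> _ B _; rewrite setTI.
have -> : (fun S : trajectory (x : osc_tree) => F (mkseq S n)) @^-1` B =
    \bigcup_(s in [set s | size s = n /\ B (F s)])
      [set S | mkseq S (size s) = s].
  apply/seteqP; split => S /=.
    by move=> h; exists (mkseq S n) => /=; rewrite ?size_mkseq.
  by move=> [s [<- h] /= ->].
rewrite bigcup_mkcond; apply: countable_bigcupT_measurable => [|s];
  first exact: countableP.
by case: ifP => // _; exact: measurable_cylinder.
Qed.

(** The cylinders over the finitely many paths of the tree have total mass 1, by [walk_mean_cst];
    off a null set the integrand is a finite combination of their indicators. *)
Lemma walk_integral x n (F : seq vert -> R) : (forall s, 0 <= F s) ->
  (\int[srw_law R (x : osc_tree)]_S (F (mkseq S n.+1))%:E = (walk_mean n x F)%:E)%E.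
Proof.
move=> F0; set P := srw_law R (x : osc_tree).
pose C s : set (trajectory (x : osc_tree)) := [set S | mkseq S n.+1 = s].
have mC s : measurable (C s).
  have := @measurable_walk _ bool x n.+1 (pred1 s) measurableT [set true] I.
  by rewrite setTI (_ : _ @^-1` _ = C s) //; apply/seteqP; split => S /= /eqP.
have sumC (H : seq vert -> R) (S : trajectory (x : osc_tree)) :
    \sum_(s <- paths n x) H s * \1_(C s) S =
    if mkseq S n.+1 \in paths n x then H (mkseq S n.+1) else 0.
  have CE s : \1_(C s) S = (mkseq S n.+1 == s)%:R :> R.
    by rewrite indicE; congr (nat_of_bool _)%:R; apply/idP/eqP; rewrite inE.
  under eq_bigr do rewrite CE.
  case: ifPn => [m_in|m_out].
    rewrite (bigD1_seq (mkseq S n.+1)) ?uniq_paths //= eqxx mulr1 big1 ?addr0 //.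
    by move=> s /negbTE; rewrite eq_sym => ->; rewrite mulr0.
  rewrite big_seq big1 // => s s_in; case: eqP => [h|_]; last by rewrite mulr0.
  by rewrite h s_in in m_out.
have int_sum (H : seq vert -> R) : (forall s, 0 <= H s) ->
    (\int[P]_S (\sum_(s <- paths n x) H s * \1_(C s) S)%:E = (walk_mean n x H)%:E)%E.
  move=> H0; under eq_integral do rewrite -sumEFin.
  rewrite walk_mean_paths -sumEFin ge0_integral_sum //.
  - rewrite big_seq [RHS]big_seq; apply: eq_bigr => s s_in.
    under eq_integral do rewrite EFinM.
    rewrite ge0_integralZl_EFin //; last first.
      by apply/measurable_EFinP; exact: measurable_indic.
    rewrite (integral_indic _ measurableT (mC s)) setIT mulrC EFinM.
    by congr (_ * _)%E; exact: srw_law_cylinder.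
  - move=> s; apply/measurable_EFinP; apply: measurable_funM => //.
  - by move=> s S _; rewrite lee_fin mulr_ge0.
rewrite -int_sum //; apply: ge0_ae_eq_integral => //.
- exact: (measurable_walk _ (fun s => (F s)%:E)).
- under eq_fun do rewrite sumC.
  exact: (measurable_walk _ (fun s => (if s \in paths n x then F s else 0)%:E)).
- by move=> S _; rewrite lee_fin.
- by move=> S _; rewrite lee_fin sumC; case: ifP.
pose A := [set S : trajectory (x : osc_tree) | mkseq S n.+1 \in paths n x].
have mA : measurable A.
  have := @measurable_walk _ bool x n.+1 (fun s => s \in paths n x) measurableT [set
    true] I.
  by rewrite setTI (_ : _ @^-1` _ = A) //; apply/seteqP; split => S.
exists (~` A); split; first exact: measurableC.
- have PA : P A = 1%E.
    have := int_sum (fun=> 1) (fun=> ler01); rewrite walk_mean_cst => <-.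
    transitivity (P (A `&` setT)); first by rewrite setIT.
    rewrite -(integral_indic P measurableT mA); apply: eq_integral => S _.
    rewrite sumC indicE; congr (_%:E).
    by case: ifP => h; [rewrite mem_set|rewrite memNset // /A /= h].
  by apply: etrans (probability_setC P mA) _; rewrite PA subee.
- move=> S /= /not_implyP[_] h SA; apply: h; rewrite sumC.
  by rewrite (SA : is_true _).
Qed.

Lemma walk_prob x n (a : pred (seq vert)) :
  srw_law R (x : osc_tree) [set S : trajectory (x :
    osc_tree) | a (mkseq S n.+1)] = (walk_mean n x (fun s => (a s)%:R))%:E.
Proof.
rewrite -walk_integral //; set A := [set S | _].
have mA : measurable A.
  have := @measurable_walk _ bool x n.+1 a measurableT [set true] I.
  by rewrite setTI (_ : _ @^-1` _ = A) //; apply/seteqP; split => S.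
transitivity (srw_law R (x : osc_tree) (A `&` setT)); first by rewrite setIT.
rewrite -(integral_indic (srw_law R (x : osc_tree)) measurableT mA);
  apply: eq_integral => S _.
by rewrite indicE /A; congr ((nat_of_bool _)%:R%:E); apply/idP/idP; rewrite inE.
Qed.

(** A step goes away from the root with probability at least [2 / 3], after which a return has
    probability at most [2 / 3]; and [1 / 3 + 2 / 3 * (2 / 3) = 7 / 9]. *)
Lemma step_mean_escape x : step_mean (fun y => Order.min 1 (decay R y / decay R x)) x
  <= 7 / 9.
Proof.
have u0 := decay_gt0 R.
apply: le_trans (_ : step_mean (fun y => if (depth x < depth y)%N then 2 / 3 else 1 :
  R) x <= _).
  apply: step_mean_le => y; rewrite -mem_nbrs /nbrs => xy; case: ltnP => h; last first.
    by rewrite ge_min lexx.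
  have yc : depth y = (depth x).+1.
    move: xy; case: eqP => _; first exact: depth_child.
    rewrite inE => /orP[/eqP yE|]; last exact: depth_child.
    by move: h; rewrite yE depth_parent; lia.
  rewrite ge_min ler_pdivrMr // /decay yc exprS.
  by rewrite lexx orbT.
rewrite (step_mean_depth (fun l => if (depth x < l)%N then 2 / 3 else 1 : R)) ltnSn.
have -> : (depth x < (depth x).-1)%N = false by lia.
have := branching_ge2R R (depth x); set b := (branching _)%:R => b2.
by case: (x != root); rewrite /= ?mul0r ?mul1r ?add0r ?ler_pdivrMr; lra.
Qed.

Lemma transient_osc_tree : transient R osc_tree.
Proof.
move=> x; set P := srw_law R (x : osc_tree).
pose A n := [set S : trajectory (x : osc_tree) | x \in map S (iota 1 n.+1)].
have AE : [set S : trajectory (x :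
  osc_tree) | exists n, (0 < n)%N /\ S n = x] = \bigcup_n A n.
  apply/seteqP; split => S /=.
    move=> [[|n] []] // _ Sn; exists n => //; rewrite /A.
    by apply/mapP; exists n.+1; rewrite ?mem_iota ?Sn //; lia.
  move=> [n _ /mapP[k]]; rewrite mem_iota => /= kn Sk.
  by exists k; split => //; lia.
(* The bound does not depend on the horizon, so it passes to the increasing union of the [A n]. *)
have PA n : (P (A n) <= (7 / 9)%:E)%E.
  apply: le_trans (_ : (walk_mean n.+1 x (fun s => (x \in behead s)%:R))%:E <= _)%E.
    by rewrite -walk_prob.
  rewrite lee_fin /=.
  apply: le_trans (step_mean_escape x); apply: step_mean_le => y _.
  rewrite le_min; apply/andP; split; first by have /andP[] := walk_mean_mem_01 R n x y.
  exact: hit_prob_le.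
have mA n : measurable (A n).
  have := @measurable_walk _ bool x n.+2 (fun s => x \in behead s) measurableT [set
    true] I.
  by rewrite setTI (_ : _ @^-1` _ = A n) //; apply/seteqP; split => S.
have cv : (P \o A) n @[n --> \oo] --> P (\bigcup_n A n).
  apply: nondecreasing_cvg_mu => //; first exact: bigcupT_measurable.
  move=> m n mn; apply/subsetPset => S /mapP[k]; rewrite mem_iota => kn Sk.
  by apply/mapP; exists k => //; rewrite mem_iota; lia.
rewrite AE; apply: (@le_lt_trans _ _ (7 / 9)%:E); last by rewrite lte_fin; lra.
rewrite -(cvg_lim _ cv) //; apply: lime_le; first by apply/cvg_ex; eexists; exact: cv.
by apply: nearW.
Qed.

End walk_law.

(** * Ancestors and clusters *)

Section ancestors.
Implicit Types (u v w x c : vert).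

Definition up l w := iter (depth w - l) parent w.
Definition anc v w := (depth v <= depth w)%N && (up (depth v) w == v).

Lemma depth_iter_parent k w : depth (iter k parent w) = (depth w - k)%N.
Proof. by elim: k => [|k IH]; rewrite ?subn0 //= depth_parent IH subnS. Qed.

Lemma depth_up l w : (l <= depth w)%N -> depth (up l w) = l.
Proof. by move=> lw; rewrite depth_iter_parent subKn. Qed.

Lemma up_up l m w : (l <= m <= depth w)%N -> up l (up m w) = up l w.
Proof.
move=> /andP[lm mw]; rewrite /up depth_iter_parent -iterD; congr (iter _ _ _); lia.
Qed.

Lemma anc_refl w : anc w w.
Proof. by rewrite /anc /up subnn leqnn /= eqxx. Qed.

Lemma anc_depth v w : anc v w -> (depth v <= depth w)%N.
Proof. by case/andP. Qed.

Lemma anc_up l w : (l <= depth w)%N -> anc (up l w) w.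
Proof. by move=> lw; rewrite /anc depth_up // lw eqxx. Qed.

Lemma anc_trans v u w : anc v u -> anc u w -> anc v w.
Proof.
move=> /andP[vu /eqP uE] /andP[uw /eqP wE]; rewrite /anc (leq_trans vu uw) /=.
by rewrite -(@up_up _ (depth u)) ?vu // wE uE.
Qed.

Lemma anc_eq_depth v w : anc v w -> depth v = depth w -> v = w.
Proof. by move=> /andP[_ /eqP h] e; rewrite -{1}h e /up subnn. Qed.

Lemma anc_parent v w : anc v w = (v == w) || (w != root) && anc v (parent w).
Proof.
have [->|vw] /= := eqVneq v w; first exact: anc_refl.
have [e0|w0] /= := eqVneq w root.
  apply/negbTE; apply: contraNN vw => vw; have := anc_depth vw.
  rewrite e0 depth_root leqn0 => /eqP h.
  by apply/eqP; rewrite -e0; apply: anc_eq_depth => //; rewrite h e0 depth_root.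
have lw : depth w = (depth (parent w)).+1 by rewrite depth_parent prednK // depth_gt0.
rewrite /anc leq_eqVlt lw ltnS.
have [lvw|lvw] /= := eqVneq (depth v) (depth (parent w)).+1.
  rewrite lvw ltnn /= /up -lw subnn /=; apply/eqP => h; by rewrite h eqxx in vw.
case: leqP => //= h; rewrite /up lw subSn // iterSr //.
Qed.

(** When [anc v w], this encodes the edges of the geodesic from [v] to [w], each edge by its lower
    endpoint; hence [v] itself is left out. *)
Definition chain v w := [seq up l w | l <- iota (depth v).+1 (depth w - depth v)].

Lemma mem_chain v w x : (x \in chain v w) = anc x w && (depth v < depth x)%N.
Proof.
apply/mapP/andP => [[l]|[/andP[lx /eqP xE] vx]].
  rewrite mem_iota => /andP[vl lw] ->; have lw' : (l <= depth w)%N by lia.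
  by rewrite anc_up // depth_up.
by exists (depth x) => //; rewrite mem_iota vx /=; lia.
Qed.

Lemma uniq_chain v w : uniq (chain v w).
Proof.
rewrite map_inj_in_uniq ?iota_uniq // => i j; rewrite !mem_iota => hi hj.
by move=> /(congr1 depth); rewrite !depth_up //; lia.
Qed.

Lemma size_chain v w : size (chain v w) = (depth w - depth v)%N.
Proof. by rewrite size_map size_iota. Qed.

Lemma deepest_common_ancestor v w w' : anc v w -> anc v w' ->
  exists c, [/\ anc v c, anc c w, anc c w' &
    forall x, anc x w -> anc x w' -> (depth x <= depth c)%N].
Proof.
move=> vw vw'; pose p l := [&& (l <= depth w)%N, (l <= depth w')%N & up l w == up l w'].
have pv : exists l, p l.
  exists (depth v); case/andP: vw => lw /eqP; case/andP: vw' => lw' /eqP.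
  by rewrite /p lw lw' => -> ->; rewrite eqxx.
have pm l : p l -> (l <= depth w)%N by case/and3P.
have [l /and3P[lw lw' /eqP ll] lmax] := ex_maxnP pv pm.
exists (up l w); split.
- have vl : (depth v <= l)%N.
    apply: lmax; case/andP: vw => hw /eqP; case/andP: vw' => hw' /eqP.
    by rewrite /p hw hw' => -> ->; rewrite eqxx.
  by rewrite /anc depth_up // vl up_up ?vl //=; case/andP: vw.
- exact: anc_up.
- by rewrite ll; exact: anc_up.
- move=> x /andP[xw /eqP xE] /andP[xw' /eqP xE']; rewrite depth_up //; apply: lmax.
  by rewrite /p xw xw' xE xE' eqxx.
Qed.

Fixpoint sphere m : seq vert :=
  if m is m'.+1 then flatten [seq children v | v <- sphere m'] else [:: root].

Lemma mem_sphere m w : (w \in sphere m) = (depth w == m).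
Proof.
elim: m w => [|m IH] w /=; first by rewrite inE depth_eq0.
apply/flatten_mapP/idP => [[v + /depth_child ->]|/eqP lw]; first by rewrite IH eqSS.
exists (parent w); first by rewrite IH depth_parent lw.
by rewrite mem_children eqxx -depth_gt0 lw.
Qed.

Lemma uniq_sphere m : uniq (sphere m).
Proof.
elim: m => //= m IH; elim: (sphere m) IH => //= v s IHs /andP[vs us].
rewrite cat_uniq uniq_children IHs // andbT; apply/hasPn => w.
move=> /flatten_mapP[u us' wu]; apply: contra vs => wv.
by move: wu wv; rewrite !mem_children => /andP[_ /eqP wu] /andP[_ /eqP wv];
  rewrite -wv wu.
Qed.

Fixpoint ball N : seq vert := if N is N'.+1 then ball N' ++ sphere N' else [::].

Lemma mem_ball N w : (w \in ball N) = (depth w < N)%N.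
Proof. by elim: N => //= N IH; rewrite mem_cat IH mem_sphere [RHS]ltnS [RHS]leq_eqVlt
  orbC. Qed.

Lemma uniq_ball N : uniq (ball N).
Proof.
elim: N => //= N IH; rewrite cat_uniq IH uniq_sphere andbT; apply/hasPn => w.
by rewrite mem_sphere mem_ball => /eqP ->; rewrite ltnn.
Qed.

Lemma count_anc_sphere v m : (depth v <= m)%N ->
  (\sum_(w <- sphere m) anc v w = \prod_(depth v <= i < m) branching i)%N.
Proof.
elim: m => [|m IH].
  rewrite leqn0 => /[dup] v0; rewrite depth_eq0 => /eqP ->.
  by rewrite /= big_seq1 anc_refl depth_root big_geq.
rewrite leq_eqVlt => /orP[/eqP vm|]; last rewrite ltnS => vm.
  rewrite vm big_geq // (bigD1_seq v) ?uniq_sphere ?mem_sphere ?vm // anc_refl.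
  rewrite big_seq_cond big1 ?addn0 // => w /andP[]; rewrite mem_sphere => /eqP wm wv.
  by apply/eqP; rewrite eqb0; apply: contra wv => /anc_eq_depth ->; rewrite ?vm ?wm.
rewrite big_nat_recr //= -IH // big_flatten big_map big_distrl /=.
rewrite big_seq [RHS]big_seq; apply: eq_bigr => t; rewrite mem_sphere => /eqP tm.
rewrite big_seq (eq_bigr (fun=> anc v t : nat)); last first.
  move=> c tc; rewrite anc_parent; move: (tc); rewrite mem_children => /andP[-> /eqP ->].
  by case: eqP => //= vc; move: vm; rewrite vc (depth_child tc) tm ltnn.
by rewrite -big_seq big_const_seq count_predT size_children iter_addn_0 tm.
Qed.

(** The last step leads either to the parent of a visited vertex, visited by induction together with
    its own parent, or to a child of a visited vertex. *)
Lemma visited_parent_closed (s : seq vert) v : path tadj root s ->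
  v \in root :: s -> parent v \in root :: s.
Proof.
elim/last_ind: s v => [|s y IH] v /=; first by rewrite !inE => _ /eqP ->;
  rewrite parent_root.
rewrite rcons_path -rcons_cons !mem_rcons => /andP[ps ly].
rewrite inE => /orP[/eqP ->|/(IH _ ps) h]; last by rewrite inE h orbT.
case/andP: ly => _ /orP[/eqP <-|/eqP ->].
  have := IH (parent (last root s)) ps (IH _ ps (mem_last _ _)).
  by rewrite [in X in _ -> X]inE => ->; rewrite orbT.
by rewrite inE mem_last orbT.
Qed.

End ancestors.

(** * Open clusters on the tree *)

Section clusters.
Implicit Types (w : config osc_tree) (u v x y : vert).

(* Says whether the edge above [v] is open; it is false at the root, where
   [parent root = root]. *)
Definition opn w v : bool := open_adj w (v : osc_tree) (parent v).

Lemma open_adjP w x y : open_adj w (x : osc_tree) y ->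
  (opn w x /\ y = parent x) \/ (opn w y /\ x = parent y).
Proof.
move=> /asboolP[e [exy we]]; have /asboolP[a [b [adj_ab eab]]] := valP e.
have /andP[_ ab] : tadj a b := adj_ab.
have oa z t : val e = [fset z; t]%fset -> parent z = t -> opn w z.
  by move=> h zt; apply/asboolP; exists e; rewrite zt.
have : (x == a) && (y == b) || (x == b) && (y == a).
  have : x \in [fset a; b]%fset by rewrite -eab exy in_fset2 eqxx.
  have : y \in [fset a; b]%fset by rewrite -eab exy in_fset2 eqxx orbT.
  have : a \in [fset x; y]%fset by rewrite -exy eab in_fset2 eqxx.
  have : b \in [fset x; y]%fset by rewrite -exy eab in_fset2 eqxx orbT.
  rewrite !in_fset2 [b == x]eq_sym [b == y]eq_sym [a == x]eq_sym [a == y]eq_sym.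
  by case: (x == a); case: (y == a); case: (x == b); case: (y == b).
have eba : val e = [fset b; a]%fset by rewrite eab fsetUC.
move: ab => /orP[/eqP ab|/eqP ba] /orP[/andP[/eqP xa /eqP yb]|/andP[/eqP xb /eqP ya]].
- by left; rewrite xa yb -ab; split; [exact: (oa a b)|].
- by right; rewrite xb ya -ab; split; [exact: (oa a b)|].
- by right; rewrite xa yb -ba; split; [exact: (oa b a)|].
- by left; rewrite xb ya -ba; split; [exact: (oa b a)|].
Qed.

Lemma open_adj_sym w : symmetric (open_adj w : rel osc_tree).
Proof. by move=> x y; apply/asboolP/asboolP => -[e [h we]]; exists e;
  rewrite h fsetUC. Qed.

Lemma opn_root w : opn w root = false.
Proof.
apply/negP => /asboolP[e [h _]]; have /asboolP[a [b [adj_ab eab]]] := valP e.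
have ab : tadj a b := adj_ab; have := tadj_irr root.
have /fsetP h' : [fset a; b]%fset = [fset root; root]%fset by rewrite -eab h parent_root.
have := h' a; have := h' b; rewrite !in_fset2 !eqxx orbT !orbb => /esym/eqP bE
  /esym/eqP aE.
by rewrite -{1}aE -bE ab.
Qed.

(** The argument [n] is fuel; [depth v] is enough, since the climb stops at the root at the
    latest. *)
Fixpoint topn w n v :=
  if n is n'.+1 then if opn w v then topn w n' (parent v) else v else v.
Definition top w v := topn w (depth v) v.

Lemma top_rec w v : top w v = if opn w v then top w (parent v) else v.
Proof.
rewrite /top depth_parent; have [->|] := eqVneq v root; first by rewrite opn_root.
by rewrite -depth_gt0; case: (depth v).
Qed.

Lemma parent_ind (Q : vert -> Prop) :
  Q root -> (forall v, v != root -> Q (parent v) -> Q v) -> forall v, Q v.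
Proof.
move=> Q0 QS v; move: {2}(depth v) (erefl (depth v)) => l; elim: l v => [|l IH] v lv.
  by have /eqP -> : v == root by rewrite -depth_eq0 lv.
by apply: QS; [rewrite -depth_gt0 lv|apply: IH; rewrite depth_parent lv].
Qed.

Lemma topP w v u : top w v = u <-> [/\ anc u v, ~~ opn w u &
  forall x, anc x v -> (depth u < depth x)%N -> opn w x].
Proof.
elim/parent_ind: v u => [|v v0 IH] u; rewrite top_rec.
  rewrite opn_root; split=> [<-|[/[dup] /anc_depth + /anc_eq_depth h]].
    split; rewrite ?anc_refl ?opn_root // => x /anc_depth.
    by rewrite leqn0 => /eqP ->; rewrite ltn0.
  by rewrite leqn0 => /eqP u0; rewrite h.
case: ifPn => ov; last first.
  split=> [<-|[uv ou h]].
    split; rewrite ?anc_refl // => x /anc_depth h1 h2; lia.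
  apply/eqP; move: uv; rewrite anc_parent eq_sym v0 => /predU1P[->//|uv].
  have := h v (anc_refl v); rewrite (negbTE ov) => hF; apply: contraTT isT => _.
  apply/negP => _; have /hF // : (depth u < depth v)%N.
  by have := anc_depth uv; rewrite depth_parent; have := depth_gt0 v; rewrite v0; lia.
rewrite IH; split=> -[uv ou h].
  split; [by rewrite anc_parent v0 uv orbT|by []|move=> x].
  rewrite anc_parent v0 => /predU1P[->//|xv]; exact: h xv.
split; [|by []|move=> x xv; apply: h; by rewrite anc_parent v0 xv orbT].
move: uv; rewrite anc_parent v0 => /predU1P[uv|//].
by move: ou; rewrite uv ov.
Qed.

Lemma top_open_adj w x y : open_adj w (x : osc_tree) y -> top w x = top w y.
Proof.
by case/open_adjP => [[ox ->]|[oy ->]]; [rewrite top_rec ox|rewrite [RHS]top_rec oy].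
Qed.

(** An open edge preserves the top; conversely, the open climbs from [x] and [y] to a common top
    join into an open path. *)
Lemma clusterP w x y : Defs.cluster w (x : osc_tree) y <-> top w x = top w y.
Proof.
split=> [[s [ps <-]]|].
  elim: s x ps => //= z s IH x /andP[xz zs]; rewrite (top_open_adj xz); exact: IH.
have ct v : exists s, path (open_adj w) (v : osc_tree) s /\ last v s = top w v.
  elim/parent_ind: v => [|v v0 [s [ps ls]]].
    by exists [::]; rewrite top_rec opn_root.
  rewrite top_rec; case: ifPn => [ov|_]; last by exists [::].
  by exists (parent v :: s); rewrite /= ps ls; split => //; rewrite andbT.
move=> xy; have [s [ps ls]] := ct x; have [t [pt lt]] := ct y.
exists (s ++ rev (belast y t)); split; last first.
  by rewrite last_cat ls xy -lt; case: t {pt lt} => //= a t; rewrite rev_cons last_rcons.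
rewrite cat_path ps ls xy -lt rev_path /=.
by rewrite (eq_path (e' := open_adj w)) // => a b; exact: open_adj_sym.
Qed.

Lemma top_mem w (s : seq vert) v : path tadj root s -> v \in root :: s ->
  top w v \in root :: s.
Proof.
move=> ps; elim/parent_ind: v => [|v v0 IH] vs; first by rewrite top_rec opn_root.
rewrite top_rec; case: ifP => // _; apply: IH; exact: visited_parent_closed.
Qed.

End clusters.

(** * Moments of cluster sizes *)

Section percolation_field.
Variables (R : realType) (p : R).
Hypothesis p01 : 0 <= p <= 1.
Implicit Types (u v w x c : vert).
Local Notation P := (percolation_law osc_tree p).

Let p0 : 0 <= p. Proof. by case/andP: p01. Qed.
Let p1 : p <= 1. Proof. by case/andP: p01. Qed.

Lemma is_edge_parent v : v != root -> is_edge [fset (v : osc_tree); parent v]%fset.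
Proof.
move=> v0; apply/asboolP; exists v, (parent v); split => //=.
by rewrite /tadj eqxx /= andbT eq_sym parent_eq.
Qed.

Lemma some_child : exists v, v != root.
Proof.
have := size_children root; have := branching_ge2 (depth root).
case E : (children root) => [|w c] /=; first by case: branching.
by exists w; have := mem_children root w; rewrite E inE eqxx /= => /esym/andP[].
Qed.

Lemma parent_edge_exists : exists f : vert -> edge osc_tree,
  forall v, v != root -> val (f v) = [fset (v : osc_tree); parent v]%fset.
Proof.
have [v0 v00] := some_child.
(* A default edge, used as value at the root, which has no edge above it. *)
pose e0 : edge osc_tree := exist (fun e => is_edge e) _ (is_edge_parent v00).
exists (fun v => insubd e0 [fset (v : osc_tree); parent v]%fset) => v vr.
by rewrite val_insubd is_edge_parent.
Qed.

Definition parent_edge : vert -> edge osc_tree := projT1 (cid parent_edge_exists).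

Lemma val_parent_edge v : v != root -> val (parent_edge v) = [fset (v : osc_tree);
  parent v]%fset.
Proof. exact: projT2 (cid parent_edge_exists) v. Qed.

Lemma opnE (w : config osc_tree) v : v != root -> opn w v = w (parent_edge v).
Proof.
move=> vr; apply/asboolP/idP => [[e [h we]]|h].
  suff -> : parent_edge v = e by [].
  by apply: val_inj; rewrite val_parent_edge // h.
by exists (parent_edge v); rewrite val_parent_edge.
Qed.

Lemma parent_edge_inj u v : u != root -> v != root ->
  parent_edge u = parent_edge v -> u = v.
Proof.
move=> u0 v0 /(congr1 val); rewrite !val_parent_edge // => /fsetP uv.
have := uv u; rewrite !in_fset2 eqxx /= => /esym/predU1P[//|/eqP upv].
have := uv v; rewrite !in_fset2 eqxx /= => /predU1P[//|/eqP vpu].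
have := congr1 depth upv; have := congr1 depth vpu; rewrite !depth_parent.
by have := depth_gt0 u; have := depth_gt0 v; rewrite u0 v0; lia.
Qed.

Lemma measurable_opn v b : measurable [set w : config osc_tree | opn w v = b].
Proof.
have [->|v0] := eqVneq v root.
  case: b; first rewrite (_ : mkset _ = set0) //.
    by apply/seteqP; split => w //=; rewrite opn_root.
  rewrite (_ : mkset _ = setT) //.
  by apply/seteqP; split => w //=; rewrite opn_root.
rewrite (_ : mkset _ = [set w : config osc_tree | w (parent_edge v) = b]).
  by apply: sub_sigma_algebra; exists (parent_edge v), b.
by apply/seteqP; split => w /=; rewrite opnE.
Qed.

Lemma measurable_cyl (s : seq vert) (b : vert -> bool) :
  measurable [set w : config osc_tree | forall x, x \in s -> opn w x = b x].
Proof.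
elim: s => [|x s IH].
  by rewrite (_ : mkset _ = setT) //; apply/seteqP; split.
rewrite (_ : mkset _ = [set w : config osc_tree | opn w x = b x] `&`
   [set w : config osc_tree | forall x, x \in s -> opn w x = b x]).
  by apply: measurableI => //; exact: measurable_opn.
apply/seteqP; split => w /=.
  move=> h; split=> [|y ys]; apply: h; rewrite inE ?eqxx ?ys ?orbT //.
by move=> [hx hs] y; rewrite inE => /predU1P[->//|]; exact: hs.
Qed.

(** The absent edge above the root counts as closed with probability 1, in agreement with
    [opn_root]. *)
Definition opn_weight (b : vert -> bool) v : R :=
  if v == root then (~~ b v)%:R else if b v then p else 1 - p.

Lemma percolation_cyl (s : seq vert) (b : vert -> bool) : uniq s ->
  P [set w : config osc_tree | forall x, x \in s -> opn w x = b x] =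
  (\prod_(x <- s) opn_weight b x)%:E.
Proof.
move=> us; have [/hasP[x xs /andP[/eqP xr bx]]|/hasPn rb] :=
    boolP (has (fun x => (x == root) && b x) s).
  rewrite (_ : mkset _ = set0); last first.
    by apply/seteqP; split => w //= /(_ x xs); rewrite bx xr opn_root.
  rewrite measure0 (bigD1_seq x) //= /opn_weight xr eqxx -xr bx mul0r //.
pose s' := [seq x <- s | x != root].
have us' : uniq (map parent_edge s').
  rewrite map_inj_in_uniq ?filter_uniq // => u v.
  by rewrite !mem_filter => /andP[u0 _] /andP[v0 _]; exact: parent_edge_inj.
(* The prescribed states are transported from vertices to edges by inverting [parent_edge] on
   [s']. *)
pose b' e := b (nth root s' (index e (map parent_edge s'))).
have b'E x : x \in s' -> b' (parent_edge x) = b x.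
  move=> xs; rewrite /b'; congr b.
  have h : parent_edge x \in map parent_edge s' by rewrite map_f.
  have := nth_index (parent_edge root) h.
  rewrite (nth_map root) -?(size_map parent_edge) ?index_mem // => /parent_edge_inj -> //.
    have : nth root s' (index (parent_edge x) [seq parent_edge i | i <- s']) \in s'.
      by rewrite mem_nth // -(size_map parent_edge) index_mem.
    by rewrite mem_filter => /andP[].
  by move: xs; rewrite mem_filter => /andP[].
have := percolation_lawP (G := osc_tree) p01 b' us'.
rewrite (_ : [set w : config osc_tree | forall e, e \in map parent_edge s' -> w e =
  b' e] =
    [set w : config osc_tree | forall x, x \in s -> opn w x = b x]); last first.
  apply/seteqP; split => w /= h.
    move=> x xs; have [x0|x0] := eqVneq x root.
      have := rb x xs; rewrite x0 eqxx /= => /negbTE ->; exact: opn_root.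
    have xs' : x \in s' by rewrite mem_filter x0.
    by rewrite opnE // h ?map_f // b'E.
  move=> _ /mapP[x xs' ->]; rewrite b'E // -h; last by move: xs';
    rewrite mem_filter => /andP[].
  by rewrite opnE //; move: xs'; rewrite mem_filter => /andP[].
move=> ->; congr (_%:E); rewrite big_map big_filter [RHS](bigID (fun x => x == root)) /=.
rewrite [X in X * _]big1_seq ?mul1r.
  rewrite big_seq_cond [RHS]big_seq_cond; apply: eq_bigr => x /andP[xs x0].
  by rewrite /opn_weight (negbTE x0) b'E // mem_filter x0.
by move=> x /andP[x0 xs]; rewrite /opn_weight x0; have := rb x xs; rewrite x0 /= => ->.
Qed.

Definition top_event v w : set (config osc_tree) := [set e | top e w = v].

Definition top_prob v w : R :=
  (anc v w)%:R * (opn_weight (fun=> false) v * p ^+ (depth w - depth v)).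

Lemma opn_weight01 b v : 0 <= opn_weight b v <= 1.
Proof.
rewrite /opn_weight; case: ifP => _; first by case: (b v); rewrite /= ?lexx ?ler01.
by case: ifP => _; rewrite ?p01 // subr_ge0 p1 lerBlDl lerDr p0.
Qed.

Lemma top_prob_ge0 v w : 0 <= top_prob v w.
Proof.
have /andP[h _] := opn_weight01 (fun=> false) v.
by rewrite /top_prob mulr_ge0 // mulr_ge0 // exprn_ge0.
Qed.

Lemma top_eventE v w : anc v w -> top_event v w =
  [set e : config osc_tree | forall x, x \in v :: chain v w -> opn e x = (x != v)].
Proof.
move=> vw; apply/seteqP; split => e /=.
  move=> /topP[_ ov h] x; rewrite inE => /predU1P[->|].
    by rewrite eqxx (negbTE ov).
  rewrite mem_chain => /andP[xw vx]; rewrite h //.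
  by apply/esym; apply: contraTneq vx => ->; rewrite ltnn.
move=> h; apply/topP; split => //.
  by rewrite (h v) ?inE ?eqxx.
move=> x xw vx; rewrite (h x) ?inE ?mem_chain ?xw ?vx ?orbT //.
by apply: contraTneq vx => ->; rewrite ltnn.
Qed.

Lemma top_event0 v w : ~~ anc v w -> top_event v w = set0.
Proof.
by move=> vw; apply/seteqP; split => e //= /topP[]; rewrite (negbTE vw).
Qed.

Lemma measurable_top_event v w : measurable (top_event v w).
Proof.
have [vw|vw] := boolP (anc v w); last by rewrite top_event0.
rewrite top_eventE //; exact: measurable_cyl.
Qed.

Lemma uniq_vchain v w : uniq (v :: chain v w).
Proof. by rewrite /= uniq_chain mem_chain ltnn andbF. Qed.

Lemma prod_vchain v w (b : vert -> bool) : anc v w -> b v = false ->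
  (forall x, x \in chain v w -> b x) ->
  \prod_(x <- v :: chain v w) opn_weight b x =
  opn_weight (fun=> false) v * p ^+ (depth w - depth v).
Proof.
move=> vw bv bc; rewrite big_cons; congr (_ * _).
  by rewrite /opn_weight bv.
rewrite big_seq (eq_bigr (fun=> p)); last first.
  move=> x xc; rewrite /opn_weight bc //; move: xc; rewrite mem_chain => /andP[_ h].
  by rewrite -depth_eq0; case: eqP h => // ->.
by rewrite -big_seq big_const_seq count_predT size_chain;
  elim: (_ - _)%N => //= n ->; rewrite exprS.
Qed.

Lemma prob_top_event v w : P (top_event v w) = (top_prob v w)%:E.
Proof.
rewrite /top_prob; have [vw|vw] := boolP (anc v w);
  last by rewrite top_event0 // measure0 mul0r.
rewrite top_eventE // mul1r percolation_cyl ?uniq_vchain // prod_vchain ?eqxx //.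
move=> x; rewrite mem_chain => /andP[_]; apply: contraTneq => ->; by rewrite ltnn.
Qed.

Lemma top_event_chain e v w x : top_event v w e -> x \in v :: chain v w -> top e x = v.
Proof.
move=> /topP[vw ov h]; rewrite inE => /predU1P[->|].
  by rewrite top_rec (negbTE ov).
rewrite mem_chain => /andP[xw vx]; apply/topP; split => //.
  case/andP: vw => lvw /eqP vE; rewrite -vE; case/andP: xw => lxw /eqP <-.
  rewrite -(@up_up _ (depth x)) ?lxw ?(ltnW vx) //; apply: anc_up.
  by rewrite depth_up // ltnW.
by move=> y yx vy; apply: h => //; exact: anc_trans xw.
Qed.

(** If the two lists of examined edges meet, a common vertex would have both [u] and [v] as its top,
    so the events are incompatible; if they are disjoint, the events are independent. *)
Lemma prob_top_event_neq u v w w' : u != v ->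
  (P (top_event u w `&` top_event v w') <= (top_prob u w * top_prob v w')%:E)%E.
Proof.
move=> uv.
have [uw|uw] := boolP (anc u w); last first.
  by rewrite top_event0 // set0I measure0 lee_fin mulr_ge0 // top_prob_ge0.
have [vw|vw] := boolP (anc v w'); last first.
  by rewrite (top_event0 vw) setI0 measure0 lee_fin mulr_ge0 // top_prob_ge0.
have [/hasP[x xv xu]|/hasPn dis] := boolP (has (mem (u :: chain u w)) (v :: chain v w')).
  rewrite (_ : _ `&` _ = set0).
    by rewrite measure0 lee_fin (mulr_ge0 (top_prob_ge0 u w) (top_prob_ge0 v w')).
  apply/seteqP; split => e //= [/top_event_chain/(_ xu) h /top_event_chain/(_ xv)].
  by rewrite h => /eqP; rewrite (negbTE uv).
pose b x := if x \in u :: chain u w then x != u else x != v.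
rewrite (_ : _ `&` _ = [set e : config osc_tree | forall x,
    x \in (u :: chain u w) ++ (v :: chain v w') -> opn e x = b x]); last first.
  rewrite !top_eventE //; apply/seteqP; split => e.
    move=> [h1 h2] x; rewrite mem_cat /b; case: ifP => [/h1//|_] /=; exact: h2.
  move=> h; split => x xs.
    by rewrite h ?mem_cat ?xs // /b xs.
  rewrite h ?mem_cat ?xs ?orbT // /b; have := dis x xs.
  by rewrite inE /= => /negbTE ->.
rewrite percolation_cyl; last first.
  rewrite cat_uniq !uniq_vchain andbT andTb; apply/hasPn => x xs.
  exact: dis x xs.
rewrite big_cat /= /top_prob uw vw !mul1r lee_fin !prod_vchain //.
- have := dis v (mem_head _ _); rewrite /b !inE => /negbTE ->; by rewrite eqxx.
- move=> x xs; have := dis x; rewrite [x \in v :: _]inE xs orbT => /(_ isT).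
  rewrite /b inE => /negbTE ->; move: xs; rewrite mem_chain => /andP[_].
  by apply: contraTneq => ->; rewrite ltnn.
- by rewrite /b mem_head eqxx.
- move=> x xs; rewrite /b inE xs orbT; move: xs; rewrite mem_chain => /andP[_].
  by apply: contraTneq => ->; rewrite ltnn.
Qed.

Definition two_point v w : R := (anc v w)%:R * p ^+ (depth w - depth v).

Lemma two_point_ge0 v w : 0 <= two_point v w.
Proof. by rewrite mulr_ge0 // exprn_ge0. Qed.

(* The paths from [v] to [c], from [c] to [w] and from [c] to [w'] are edge
   disjoint when [c] is the deepest common ancestor of [w] and [w']. *)
Lemma prob_top_event_same N v w w' : w \in ball N ->
  (P (top_event v w `&` top_event v w') <=
   (\sum_(c <- ball N) two_point v c * (two_point c w * two_point c w'))%:E)%E.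
Proof.
move=> wN; have T0 c : 0 <= two_point v c * (two_point c w * two_point c w').
  exact: mulr_ge0 (two_point_ge0 _ _) (mulr_ge0 (two_point_ge0 _ _) (two_point_ge0 _ _)).
have S0 : 0 <= \sum_(c <- ball N) two_point v c * (two_point c w * two_point c w').
  by apply: sumr_ge0.
have [vw|vw] := boolP (anc v w); last by rewrite top_event0 // set0I measure0 lee_fin.
have [vw'|vw'] := boolP (anc v w');
  last by rewrite (top_event0 vw') setI0 measure0 lee_fin.
have [c [vc cw cw' cmax]] := deepest_common_ancestor vw vw'.
pose s := chain v c ++ (chain c w ++ chain c w').
have us : uniq s.
  rewrite !cat_uniq !uniq_chain /= andbT; apply/andP; split.
    apply/hasPn => x; rewrite mem_cat !mem_chain -andb_orl => /andP[_ cx].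
    by apply/negP => /andP[/anc_depth]; lia.
  apply/hasPn => x; rewrite !mem_chain => /andP[xw' cx]; apply/negP => /andP[xw _].
  by have := cmax x xw xw'; lia.
apply: (@le_trans _ _ (P [set e :
  config osc_tree | forall x, x \in s -> opn e x = true])).
  apply: le_measure; rewrite ?inE.
  - by apply: measurableI; exact: measurable_top_event.
  - exact: measurable_cyl.
  - move=> e [/topP[_ _ h] /topP[_ _ h']] x /=; rewrite !mem_cat !mem_chain.
    case/or3P => /andP[xa lx].
    + by apply: h => //; exact: anc_trans cw.
    + by apply: h => //; apply: leq_ltn_trans lx; exact: anc_depth.
    + by apply: h' => //; apply: leq_ltn_trans lx; exact: anc_depth.
have cN : c \in ball N.
  by move: wN; rewrite !mem_ball; apply: leq_ltn_trans; exact: anc_depth.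
rewrite percolation_cyl // lee_fin [leRHS](bigD1_seq c) ?uniq_ball //=.
apply: ler_wpDr; first exact: sumr_ge0.
have pc a b : \prod_(x <- chain a b) opn_weight (fun=> true) x = p ^+ (depth b - depth a).
  rewrite big_seq (eq_bigr (fun=> p)); last first.
    move=> x; rewrite mem_chain /opn_weight -depth_eq0 => /andP[_ h].
    by case: eqP h => // ->.
  by rewrite -big_seq big_const_seq count_predT size_chain;
    elim: (_ - _)%N => //= n ->; rewrite exprS.
by rewrite /s !big_cat /= !pc /two_point vc cw cw' !mul1r.
Qed.

End percolation_field.

(** * First and second moments of sums of indicators *)

Section indicator_sums.
Context d (T : measurableType d) (R : realType) (mu : probability T R).
Variables (I : eqType) (E : I -> set T).
Hypothesis mE : forall i, measurable (E i).

Lemma integral_sum_indic (r : seq I) :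
  (\int[mu]_t (\sum_(i <- r) \1_(E i) t)%:E = \sum_(i <- r) mu (E i))%E.
Proof.
under eq_integral do rewrite -sumEFin.
rewrite ge0_integral_sum //.
- by apply: eq_bigr => i _; rewrite (integral_indic mu measurableT (mE i)) setIT.
- by move=> i; apply/measurable_EFinP; exact: measurable_indic.
Qed.

Lemma integral_sum_indic_sqr (r : seq I) :
  (\int[mu]_t ((\sum_(i <- r) \1_(E i) t) ^+ 2)%:E =
   \sum_(i <- r) \sum_(j <- r) mu (E i `&` E j))%E.
Proof.
have -> : (\sum_(i <- r) \sum_(j <- r) mu (E i `&` E j) =
    \sum_(i <- r) \int[mu]_t (\sum_(j <- r) \1_(E i `&` E j) t)%:E)%E.
  apply: eq_bigr => i _; under eq_integral do rewrite -sumEFin.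
  rewrite ge0_integral_sum //.
  - apply: eq_bigr => j _.
    by rewrite (integral_indic mu measurableT (measurableI _ _ (mE i) (mE j))) setIT.
  - move=> j; apply/measurable_EFinP; apply: measurable_indic; exact: measurableI.
rewrite -ge0_integral_sum //.
- apply: eq_integral => t _; rewrite sumEFin expr2 big_distrl /=; congr (_%:E).
  by apply: eq_bigr => i _; rewrite big_distrr /=; apply: eq_bigr => j _; rewrite indicI.
- move=> i; apply/measurable_EFinP; apply: measurable_sum => j.
  by apply: measurable_indic; exact: measurableI.
- by move=> i t _; rewrite lee_fin sumr_ge0.
Qed.

End indicator_sums.

(** * Exhaustion by balls *)

Section counting_balls.
Variable R : realType.

(** Truncation turns a possibly infinite cardinality into a finite sum of indicators; monotone
    convergence removes it afterwards. *)
Definition ball_count (B : set vert) N : R := \sum_(w <- ball N) (w \in B)%:R.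

Lemma ball_count_ge0 B N : 0 <= ball_count B N.
Proof. by apply: sumr_ge0. Qed.

Lemma ball_count_nd B : nondecreasing_seq (ball_count B).
Proof.
apply/nondecreasing_seqP => N; rewrite /ball_count /= big_cat lerDl.
exact: sumr_ge0.
Qed.

Lemma ball_countE B N : ball_count B N = (size [seq w <- ball N | w \in B])%:R.
Proof.
rewrite /ball_count -natr_sum size_filter -sum1_count [in RHS]big_mkcond.
by congr (_%:R); apply: eq_bigr => w _; case: (_ \in _).
Qed.

Lemma fset_sub_ball (X : {fset vert}) : exists N, {subset X <= ball N}.
Proof.
exists (\max_(w <- X) depth w).+1 => w wX; rewrite mem_ball ltnS.
exact: leq_bigmax_seq.
Qed.

Lemma ball_count_cvg B : (ball_count B N)%:E @[N --> \oo] --> (counting B : \bar R).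
Proof.
rewrite /counting; case: ifPn => /asboolP Bfin.
  have [N BN] := fset_sub_ball (fset_set B).
  apply: cvg_near_cst; exists N => // n /= Nn; congr (_%:E).
  rewrite ball_countE; congr (_%:R).
  rewrite -(undup_id (filter_uniq _ (uniq_ball n))) -card_fseq; congr (#|` _|).
  apply/fsetP => w; rewrite !inE /= mem_filter in_fset_set //.
  case: (boolP (w \in B)) => //= wB; rewrite mem_ball.
  have := BN w; rewrite in_fset_set // => /(_ wB); rewrite mem_ball => /leq_trans; exact.
apply/cvgeryP/cvgryPge => M; have [X XB Xn] := infinite_set_fset (Num.trunc `|M|).+1 Bfin.
have [N XN] := fset_sub_ball X; exists N => // n /= Nn.
apply: (@le_trans _ _ (#|` X|)%:R).
  apply: (le_trans (ler_norm M)); apply: (@le_trans _ _ (Num.trunc `|M|).+1%:R).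
    by rewrite ltW // truncnS_gt.
  by rewrite ler_nat.
rewrite ball_countE ler_nat; apply: uniq_leq_size; first exact: fset_uniq.
move=> w wX; rewrite mem_filter; apply/andP; split.
  by rewrite inE; exact: XB.
by have := XN w wX; rewrite !mem_ball => /leq_trans; exact.
Qed.

End counting_balls.

(** * Subcritical bounds, and moments for a fixed visited set *)

Section cluster_moments.
Variables (R : realType) (p : R).
Hypothesis p0 : 0 <= p.
Hypothesis p20 : 20 * p < 1.
Implicit Types (u v w x c : vert).
Local Notation P := (percolation_law osc_tree p).

Let p01 : 0 <= p <= 1. Proof. by rewrite p0 /=; move: p20 p0; lra. Qed.

Definition chi_max : R := (1 - 20 * p)^-1.

Lemma chi_max_ge1 : 1 <= chi_max.
Proof. rewrite /chi_max invf_ge1 ?subr_gt0 //; move: p0; lra. Qed.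

(** The mean number of descendants of depth below [N] joined to a given vertex of depth [l] by an
    open path; the term [m = l] is the vertex itself. *)
Definition chi_ball N l : R :=
  \sum_(l <= m < N) p ^+ (m - l) * (\prod_(l <= i < m) branching i)%:R.

Lemma sum_two_point v N : \sum_(w <- ball N) two_point p v w = chi_ball N (depth v).
Proof.
elim: N => [|N IH]; first by rewrite /chi_ball big_nil big_geq.
rewrite /= big_cat IH /=.
have -> : \sum_(w <- sphere N) two_point p v w =
    (\sum_(w <- sphere N) anc v w)%:R * p ^+ (N - depth v).
  rewrite natr_sum mulr_suml big_seq [RHS]big_seq; apply: eq_bigr => w.
  by rewrite mem_sphere => /eqP wN; rewrite /two_point wN.
have [vN|Nv] := leqP (depth v) N.
  by rewrite count_anc_sphere // /chi_ball big_nat_recr //= mulrC.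
rewrite /chi_ball !big_geq ?(ltnW Nv) // big_seq big1 ?mul0r ?addr0 // => w.
rewrite mem_sphere => /eqP wN; apply/eqP; rewrite eqb0; apply/negP => /anc_depth.
by rewrite wN leqNgt Nv.
Qed.

Lemma chi_ball_nd l : nondecreasing_seq (chi_ball ^~ l).
Proof.
apply/nondecreasing_seqP => N; rewrite /chi_ball; have [lN|Nl] := leqP l N.
  by rewrite big_nat_recr //= lerDl mulr_ge0 // exprn_ge0.
by rewrite !big_geq // ltnW.
Qed.

Lemma geometric_le (r : R) n : 0 <= r -> r < 1 ->
  \sum_(0 <= j < n) r ^+ j <= (1 - r)^-1.
Proof.
move=> r0 r1; rewrite -[leRHS]mul1r ler_pdivlMr ?subr_gt0 // mulrC.
have : (1 - r) * \sum_(0 <= j < n) r ^+ j = 1 - r ^+ n.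
  elim: n => [|n IH]; first by rewrite big_geq // expr0 subrr mulr0.
  by rewrite big_nat_recr //= mulrDr IH exprS; ring.
by move=> ->; rewrite gerBl exprn_ge0.
Qed.

Lemma prod_branching_le l k b : (forall i, (l <= i < l + k)%N -> (branching i <= b)%N) ->
  (\prod_(l <= i < l + k) branching i <= b ^ k)%N.
Proof.
elim: k => [|k IH] h; first by rewrite addn0 big_geq.
rewrite addnS big_nat_recr ?leq_addr //= expnSr leq_mul ?h //.
  by apply: IH => i /andP[li ik]; apply: h; rewrite li addnS ltnS ltnW.
by rewrite leq_addr addnS ltnS leqnn.
Qed.

Lemma chi_ball_le N l : chi_ball N l <= chi_max.
Proof.
have p20' : 0 <= 20 * p by rewrite mulr_ge0.
apply: le_trans (geometric_le (N - l) p20' p20).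
rewrite /chi_ball -[X in index_iota X N]add0n big_addn; apply: ler_sum => j _.
rewrite addnK exprMn mulrC ler_wpM2r ?exprn_ge0 // -natrX ler_nat.
rewrite addnC; apply: prod_branching_le => i _; exact: branching_le20.
Qed.

Lemma chi_ball_ge1 l : 1 <= chi_ball l.+1 l.
Proof. by rewrite /chi_ball big_nat1 subnn expr0 mul1r big_geq. Qed.

Definition chi l : R := limn (chi_ball ^~ l).

Lemma chi_ball_cvgn l : cvgn (chi_ball ^~ l).
Proof.
apply: nondecreasing_is_cvgn; first exact: chi_ball_nd.
by exists chi_max => _ [N _ <-]; exact: chi_ball_le.
Qed.

Lemma chi_ball_le_chi N l : chi_ball N l <= chi l.
Proof. exact: (nondecreasing_cvgn_le (@chi_ball_nd l) (@chi_ball_cvgn l) N). Qed.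

Lemma chi_ge1 l : 1 <= chi l.
Proof. by apply: le_trans (chi_ball_ge1 l) _; exact: chi_ball_le_chi. Qed.

Lemma chi_le b l : (forall N, chi_ball N l <= b) -> chi l <= b.
Proof. by move=> h; apply: limr_le; [exact: chi_ball_cvgn|exact: nearW]. Qed.

(** The mean number of vertices whose top is [v]: the edge above [v] is closed, independently of the
    edges below. *)
Definition top_mass v : R := opn_weight p (fun=> false) v * chi (depth v).

Lemma top_mass_depth u v : depth u = depth v -> top_mass u = top_mass v.
Proof. by rewrite /top_mass /opn_weight -!depth_eq0 => ->. Qed.

Lemma top_mass_bnd v : 0 <= top_mass v <= chi_max.
Proof.
have /andP[w0 w1] := opn_weight01 p01 (fun=> false) v.
have z1 := chi_ge1 (depth v); have z2 :
  chi (depth v) <= chi_max by apply: chi_le => N; exact: chi_ball_le.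
have z0 := le_trans ler01 z1; apply/andP; split; first exact: mulr_ge0.
by apply: le_trans z2; rewrite -[leRHS]mul1r ler_wpM2r.
Qed.

Lemma top_mass_ge v : 1 - p <= top_mass v.
Proof.
have z1 := chi_ge1 (depth v); rewrite /top_mass /opn_weight; case: ifP => _ /=.
  by rewrite mul1r (le_trans _ z1) // gerBl.
rewrite -[leLHS]mulr1 ler_wpM2l //; by move: p01 => /andP[_]; rewrite subr_ge0.
Qed.

Section fixed_walk.
Variable L : seq vert.
Hypothesis uL : uniq L.
Let B (e : config osc_tree) : set vert := [set w | top e w \in L].
Let I N := [seq (w, v) | w <- ball N, v <- L].
Let E (i : vert * vert) := top_event i.2 i.1.

Let mE i : measurable (E i). Proof. exact: measurable_top_event. Qed.

Let count_indic N e : ball_count R (B e) N = \sum_(i <- I N) \1_(E i) e.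
Proof.
rewrite big_allpairs /=; apply: eq_bigr => w _.
have indE v : \1_(E (w, v)) e = (v == top e w)%:R :> R.
  rewrite indicE /E /top_event /=; congr (nat_of_bool _)%:R.
  by apply/idP/eqP; rewrite inE.
under eq_bigr do rewrite indE.
have -> : (w \in B e) = (top e w \in L) by apply/idP/idP; rewrite inE.
rewrite -natr_sum; congr (_%:R); rewrite -(count_uniq_mem _ uL) -sum1_count.
by rewrite big_mkcond; apply: eq_bigr => v _ /=; case: (v == _).
Qed.

Let sum_a N : \sum_(i <- I N) top_prob p i.2 i.1 =
  \sum_(v <- L) opn_weight p (fun=> false) v * chi_ball N (depth v).
Proof.
rewrite big_allpairs exchange_big /=; apply: eq_bigr => v _.
rewrite -sum_two_point mulr_sumr; apply: eq_bigr => w _.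
by rewrite /top_prob /two_point mulrCA.
Qed.

Let mcount N : measurable_fun setT (fun e : config osc_tree => ball_count R (B e) N).
Proof.
have -> : (fun e : config osc_tree => ball_count R (B e) N) =
    (fun e => \sum_(i <- I N) \1_(E i) e) by apply/funext => e; exact: count_indic.
by apply: measurable_sum => i; exact: measurable_indic.
Qed.

Lemma mean_count N : (\int[P]_e (ball_count R (B e) N)%:E =
  (\sum_(v <- L) opn_weight p (fun=> false) v * chi_ball N (depth v))%:E)%E.
Proof.
under eq_integral do rewrite count_indic.
rewrite integral_sum_indic // -sum_a -sumEFin; apply: eq_bigr => i _.
exact: prob_top_event.
Qed.

(** Pairs with distinct tops contribute at most the product of their probabilities; adding this
    product for equal tops as well completes the square. For equal tops the three-path bound is
    summed over [w], [w'] and then [c], each sum giving a factor at most [chi_max], hence the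
    cube. *)
Lemma sqr_count N : (\int[P]_e (ball_count R (B e) N ^+ 2)%:E <=
  ((\sum_(v <- L) top_mass v) ^+ 2 + (size L)%:R * chi_max ^+ 3)%:E)%E.
Proof.
under eq_integral do rewrite count_indic.
rewrite integral_sum_indic_sqr //.
pose S (v w w' : vert) := \sum_(c <- ball N) two_point p v c * (two_point p c w *
  two_point p c w').
have S0 v w w' : 0 <= S v w w'.
  apply: sumr_ge0 => c _; exact: mulr_ge0 (two_point_ge0 p01 _ _)
    (mulr_ge0 (two_point_ge0 p01 _ _) (two_point_ge0 p01 _ _)).
have PEle i j : i \in I N -> (P (E i `&` E j) <=
    (top_prob p i.2 i.1 * top_prob p j.2 j.1 + (i.2 == j.2)%:R * S i.2 i.1 j.1)%:E)%E.
  move=> /allpairsP[[w v] [/= wN vL ->]]; case: j => [w' v'] /=.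
  have a0 := mulr_ge0 (top_prob_ge0 p01 v w) (top_prob_ge0 p01 v' w').
  have [<-|vv'] := eqVneq v v'.
    apply: le_trans (prob_top_event_same p01 v w' wN) _.
    by rewrite lee_fin mul1r lerDr (mulr_ge0 (top_prob_ge0 p01 v w) (top_prob_ge0 p01
      v w')).
  by rewrite mul0r addr0; exact: prob_top_event_neq.
apply: (@le_trans _ _ (\sum_(i <- I N) \sum_(j <- I N)
   (top_prob p i.2 i.1 * top_prob p j.2 j.1 + (i.2 == j.2)%:R * S i.2 i.1 j.1)%:E)%E).
  rewrite big_seq [leRHS]big_seq; apply: lee_sum => i iI; apply: lee_sum => j _.
  exact: PEle.
under eq_bigr do rewrite sumEFin.
rewrite sumEFin lee_fin.
have -> : \sum_(i <- I N) \sum_(j <- I N)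
   (top_prob p i.2 i.1 * top_prob p j.2 j.1 + (i.2 == j.2)%:R * S i.2 i.1 j.1) =
  (\sum_(i <- I N) top_prob p i.2 i.1) ^+ 2 +
  \sum_(i <- I N) \sum_(j <- I N) (i.2 == j.2)%:R * S i.2 i.1 j.1.
  rewrite expr2 mulr_suml -big_split; apply: eq_bigr => i _ /=.
  by rewrite mulr_sumr -big_split.
have w01 v := opn_weight01 p01 (fun=> false) v.
have zN0 l : 0 <= chi_ball N l.
  by apply: sumr_ge0 => m _; rewrite mulr_ge0 // exprn_ge0.
apply: lerD.
  rewrite sum_a lerXn2r ?nnegrE ?sumr_ge0 // => [v _|v _|].
  - by rewrite mulr_ge0 //; case/andP: (w01 v).
  - by case/andP: (top_mass_bnd v).
  - apply: ler_sum => v _; rewrite ler_wpM2l ?chi_ball_le_chi //; by case/andP: (w01 v).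
have -> : \sum_(i <- I N) \sum_(j <- I N) (i.2 == j.2)%:R * S i.2 i.1 j.1 =
    \sum_(v <- L) \sum_(c <- ball N) two_point p v c * chi_ball N (depth c) ^+ 2.
  rewrite big_allpairs exchange_big /= big_seq [RHS]big_seq.
  apply: eq_bigr => v vL.
  under eq_bigr => w _.
    rewrite big_allpairs /=.
    under eq_bigr => w' _.
      rewrite (bigD1_seq v) //= eqxx mul1r big1 ?addr0; last first.
        by move=> v' /negbTE; rewrite eq_sym => ->; rewrite mul0r.
      over.
    rewrite /S exchange_big /=.
    over.
  rewrite exchange_big /=; apply: eq_bigr => c _.
  under eq_bigr => w _ do rewrite -mulr_sumr -mulr_sumr sum_two_point mulrCA.
  by rewrite -mulr_suml sum_two_point expr2 mulrCA.
have K0 : 0 <= chi_max by apply: le_trans chi_max_ge1.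
apply: (@le_trans _ _ (\sum_(v <- L) chi_max ^+ 3)); last first.
  by rewrite big_const_seq count_predT iter_addr_0 mulr_natl.
apply: ler_sum => v _; apply: (@le_trans _ _ (\sum_(c <- ball N) two_point p v c *
  chi_max ^+ 2)).
  apply: ler_sum => c _; rewrite ler_wpM2l ?two_point_ge0 //.
  by rewrite lerXn2r ?nnegrE ?chi_ball_le.
by rewrite -mulr_suml sum_two_point [chi_max ^+ 3]exprS ler_wpM2r ?exprn_ge0 ?chi_ball_le.
Qed.

Let limB (e : config osc_tree) :
  counting (B e) = limn (fun N => (ball_count R (B e) N)%:E).
Proof. by apply/esym/cvg_lim => //; exact: ball_count_cvg. Qed.

Lemma mean_clusters :
  (\int[P]_e counting [set w | top e w \in L] = (\sum_(v <- L) top_mass v)%:E)%E.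
Proof.
under eq_integral do rewrite [counting _]limB.
rewrite monotone_convergence //; last 3 first.
- by move=> N; apply/measurable_EFinP; exact: mcount.
- by move=> N e _; rewrite lee_fin ball_count_ge0.
- by move=> e _ m n mn; rewrite lee_fin ball_count_nd.
under eq_fun do rewrite mean_count.
apply/cvg_lim => //; apply/fine_cvgP; split; first exact: nearW.
pose g (s : seq vert) N := \sum_(v <- s) opn_weight p (fun=> false) v * chi_ball N
  (depth v).
suff : forall s, g s N @[N --> \oo] --> \sum_(v <- s) top_mass v by exact.
elim=> [|v s IH].
  rewrite big_nil (_ : (fun N => g [::] N) = fun=> 0); first exact: cvg_cst.
  by apply/funext => N; rewrite /g big_nil.
rewrite big_cons (_ : (fun N => g (v :: s) N) =
  fun N => opn_weight p (fun=> false) v * chi_ball N (depth v) + g s N).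
  apply: cvgD IH; apply: cvgMl_tmp; exact: chi_ball_cvgn.
by apply/funext => N; rewrite /g big_cons.
Qed.

Lemma sqr_clusters :
  (\int[P]_e (counting [set w | top e w \in L] * counting [set w | top e w \in L])
   <= ((\sum_(v <- L) top_mass v) ^+ 2 + (size L)%:R * chi_max ^+ 3)%:E)%E.
Proof.
have limBB (e : config osc_tree) : (counting (B e) * counting (B e) =
    limn (fun N => (ball_count R (B e) N ^+ 2)%:E))%E.
  apply/esym/cvg_lim => //; under eq_fun do rewrite expr2 EFinM.
  apply: cvgeM; [|exact: ball_count_cvg|exact: ball_count_cvg].
  rewrite /counting; case: ifP => _; first exact: mule_def_fin.
  exact: mule_def_neq0_infty.
under eq_integral do rewrite [(_ * _)%E]limBB.
rewrite monotone_convergence //; last 3 first.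
- by move=> N; apply/measurable_EFinP; apply: measurable_funX; exact: mcount.
- by move=> N e _; rewrite lee_fin exprn_ge0 // ball_count_ge0.
- by move=> e _ m n mn; rewrite lee_fin lerXn2r ?nnegrE ?ball_count_ge0 // ball_count_nd.
apply: lime_le; last by apply: nearW => N; exact: sqr_count.
apply: ereal_nondecreasing_is_cvgn => m n mn; apply: ge0_le_integral => //.
- by move=> e _; rewrite lee_fin exprn_ge0 // ball_count_ge0.
- by apply/measurable_EFinP; apply: measurable_funX; exact: mcount.
- by apply/measurable_EFinP; apply: measurable_funX; exact: mcount.
- by move=> e _; rewrite lee_fin lerXn2r ?nnegrE ?ball_count_ge0 // ball_count_nd.
Qed.

End fixed_walk.
End cluster_moments.

(** * Moments of [U n] *)

Section joint_moments.
Variables (R : realType) (p : R).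
Hypothesis p0 : 0 <= p.
Hypothesis p20 : 20 * p < 1.
Local Notation o := (root : osc_tree).
Local Notation J := (joint_law o p).
Implicit Types z : (trajectory o * config osc_tree)%type.

Let p01 : 0 <= p <= 1. Proof. by rewrite p0 /=; move: p20 p0; lra. Qed.

Definition reached n z : set vert :=
  [set w | exists2 k, (k <= n)%N & top z.2 w = top z.2 (z.1 k)].

Lemma U_reached n z : U R n z = counting (reached n z).
Proof.
rewrite /U; congr counting; apply/seteqP; split => w /=.
  by move=> [k kn /clusterP kw]; exists k.
by move=> [k kn kw]; exists k => //; apply/clusterP.
Qed.

Lemma measurable_walk_at k (u : vert) :
  measurable [set S : trajectory o | S k = u].
Proof. by apply: sub_sigma_algebra; exists k, u. Qed.

Lemma measurable_reached n w : measurable [set z | reached n z w].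
Proof.
have -> : [set z | reached n z w] = \bigcup_(k in [set k | (k <= n)%N])
    \bigcup_u \bigcup_v ([set S : trajectory o | S k = u] `*`
      ([set e : config osc_tree | top e u = v] `&` [set e | top e w = v])).
  apply/seteqP; split => -[S e] /=.
    by move=> [k kn h]; exists k => //; exists (S k) => //; exists (top e w).
  move=> [k kn [u _ [v _ [/= Su [h1 h2]]]]]; exists k => //=.
  by rewrite h2 Su.
apply: bigcup_measurable => k _.
apply: countable_bigcupT_measurable => [|u]; first exact: countableP.
apply: countable_bigcupT_measurable => [|v]; first exact: countableP.
apply: measurableX; first exact: measurable_walk_at.
by apply: measurableI; exact: measurable_top_event.
Qed.

Lemma measurable_ball_count n N :
  measurable_fun setT (fun z => ball_count R (reached n z) N).
Proof.
apply: measurable_sum => w.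
have -> : (fun z => (w \in reached n z)%:R : R) = \1_[set z | reached n z w].
  apply/funext => z; rewrite indicE.
  suff -> : (w \in reached n z) = (z \in [set z | reached n z w]) by [].
  by apply/idP/idP; rewrite !inE.
by apply: measurable_indic; exact: measurable_reached.
Qed.

Lemma measurable_U n : measurable_fun setT (U R n :
  trajectory o * config osc_tree -> \bar R).
Proof.
apply: (emeasurable_fun_cvg (fun N z => (ball_count R (reached n z) N)%:E)).
  by move=> N; apply/measurable_EFinP; exact: measurable_ball_count.
by move=> z _; rewrite U_reached; exact: ball_count_cvg.
Qed.

Lemma U_ge0 n z : (0 <= U R n z)%E.
Proof. by rewrite /U /counting; case: ifP => _; rewrite ?leey // lee_fin. Qed.

Lemma U_nd m n z : (m <= n)%N -> (U R m z <= U R n z)%E.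
Proof.
move=> mn; rewrite !U_reached.
apply: (lee_cvg_to (@ball_count_cvg R (reached m z)) (@ball_count_cvg R (reached n z))).
apply: nearW => N; rewrite lee_fin; apply: ler_sum => w _.
rewrite ler_nat; case: (boolP (w \in reached m z)) => // /set_mem[k km h].
by rewrite mem_set //; exists k => //; exact: leq_trans mn.
Qed.

Lemma ae_paths n : {ae srw_law R o, forall S, mkseq S n.+1 \in paths n root}.
Proof.
exists [set S | ~~ (mkseq S n.+1 \in paths n root)]; split.
- have := @measurable_walk _ bool root n.+1 (fun s => s \notin paths n root)
  measurableT [set true] I.
  by rewrite setTI (_ : _ @^-1` _ = [set S :
    trajectory o | mkseq S n.+1 \notin paths n root]) //; apply/seteqP; split => S.
- apply: etrans (walk_prob R root n (fun s => s \notin paths n root)) _.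
  rewrite (eq_walk_mean (F' := fun=> 0)) ?walk_mean_cst // => s ps sn.
  by rewrite mem_paths /= ps sn !eqxx.
- by move=> S /= /negP.
Qed.

Lemma reached_path n z : mkseq z.1 n.+1 \in paths n root ->
  reached n z = [set w | top z.2 w \in undup (mkseq z.1 n.+1)].
Proof.
case: z => S e /=; rewrite mem_paths => /and3P[h ps _].
have E : mkseq S n.+1 = root :: behead (mkseq S n.+1).
  by move: h; rewrite /mkseq /= => /eqP[->].
apply/seteqP; split => w.
  move=> [k kn tw]; change (is_true (top e w \in undup (mkseq S n.+1))).
  rewrite [top e w](tw : _ = top e (S k)) mem_undup E; apply: top_mem ps _.
  by rewrite -E; apply/mapP; exists k => //; rewrite mem_iota.
change (is_true (top e w \in undup (mkseq S n.+1)) -> reached n (S, e) w).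
rewrite mem_undup => /mapP[k]; rewrite mem_iota => /= kn tS; exists k => //=.
(* The edge above a top is closed, so a top is its own top. *)
have /topP[_ ot _] := erefl (top e w).
by rewrite -tS [RHS]top_rec (negbTE ot).
Qed.

Let L n (S : trajectory o) := undup (mkseq S n.+1).

Lemma mean_UE n : mean_U o p n = (mean_weight (top_mass p) n root)%:E.
Proof.
rewrite /mean_U /joint_law fubini_tonelli1; last 2 first.
- exact: measurable_U.
- exact: U_ge0.
rewrite -walk_integral; last exact: weight_ge0 (top_mass_bnd p0 p20).
apply: ge0_ae_eq_integral => //.
- apply: measurable_fun_fubini_tonelli_F; [exact: measurable_U|exact: U_ge0].
- exact: (measurable_walk _ (fun s => (weight (top_mass p) s)%:E)).
- by move=> S _; apply: integral_ge0 => e _; exact: U_ge0.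
- by move=> S _; rewrite lee_fin; exact: weight_ge0 (top_mass_bnd p0 p20) _.
have := ae_paths n; apply: (@filterS _ _ (ae_filter_ringOfSetsType (srw_law R o))) =>
  S hS _; rewrite /fubini_F.
rewrite -(mean_clusters p0 p20 (undup_uniq (mkseq S n.+1))).
by apply: eq_integral => e _; rewrite U_reached reached_path.
Qed.

(** The constant is [47 = 46 + 1]: the variance of the conditional mean over the walk, plus a
    conditional variance of at most [chi_max p ^+ 3] per visited vertex; [chi_max p >= 1] merges the
    powers. *)
Lemma mean_sqr_U n : (\int[J]_z (U R n z * U R n z) <=
  (mean_weight (top_mass p) n root ^+ 2 + 47 * chi_max p ^+ 3 * n.+1%:R)%:E)%E.
Proof.
have K1 := chi_max_ge1 p0 p20; have K0 : 0 <= chi_max p by apply: le_trans K1.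
have mU2 : measurable_fun setT (fun z => U R n z * U R n z)%E.
  by apply: emeasurable_funM; exact: measurable_U.
have U20 z : (0 <= U R n z * U R n z)%E by rewrite mule_ge0 ?U_ge0.
rewrite /joint_law fubini_tonelli1 //.
pose F s : R := weight (top_mass p) s ^+ 2 + n.+1%:R * chi_max p ^+ 3.
have F0 s : 0 <= F s by rewrite /F addr_ge0 ?sqr_ge0 // mulr_ge0 // exprn_ge0.
apply: (@le_trans _ _ (\int[srw_law R o]_S (F (mkseq S n.+1))%:E)%E).
  apply: ae_ge0_le_integral => //.
  - by move=> S _; apply: integral_ge0.
  - exact: measurable_fun_fubini_tonelli_F.
  - by move=> S _; rewrite lee_fin.
  - exact: (measurable_walk _ (fun s => (F s)%:E)).
  have := ae_paths n; apply: (@filterS _ _ (ae_filter_ringOfSetsType (srw_law R o)))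
    => S hS _; rewrite /fubini_F.
  apply: (@le_trans _ _ ((\sum_(v <- L n S) top_mass p v) ^+ 2 + (size (L n S))%:R *
    chi_max p ^+ 3)%:E).
    apply: le_trans (sqr_clusters p0 p20 (undup_uniq (mkseq S n.+1))).
    rewrite le_eqVlt; apply/orP; left; apply/eqP; apply: eq_integral => e _.
    by rewrite U_reached reached_path.
  rewrite lee_fin lerD2l ler_wpM2r ?exprn_ge0 // ler_nat.
  by rewrite (leq_trans (size_undup _)) // size_mkseq.
rewrite walk_integral // lee_fin /F walk_meanD walk_mean_cst.
have := weight_variance (@top_mass_depth _ p) (top_mass_bnd p0 p20) n root.
have : chi_max p ^+ 2 <= chi_max p ^+ 3 by rewrite ler_weXn2l.
rewrite -[n.+1%:R]natr1; have : 0 <= n%:R :> R by [].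
have : 0 <= chi_max p ^+ 3 by rewrite exprn_ge0.
set a := chi_max p ^+ 3; set b := chi_max p ^+ 2; set x := n%:R => a0 x0 ba h.
have : 0 <= (a - b) * x by rewrite mulr_ge0 // subr_ge0.
lra.
Qed.

End joint_moments.

(** * A law of large numbers for monotone sequences *)

Section law_of_large_numbers.
Context d (T : measurableType d) (R : realType) (P : probability T R).
Implicit Types (X : nat -> T -> \bar R) (m : nat -> R) (t : T).

Lemma mulee_ge0 (x : \bar R) : (0 <= x * x)%E.
Proof.
by case: x => [x| |] //=; rewrite -?EFinM ?lee_fin -?expr2 ?sqr_ge0 // mule_ge0 ?leey.
Qed.

(** [Y] may be infinite, so the expansion is arranged as [(Y - a)^2 + 2 a Y = Y^2 + a^2], with
    nonnegative terms only. *)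
Lemma variance_le (Y : T -> \bar R) (a c : R) :
  measurable_fun setT Y -> (forall t, 0 <= Y t)%E -> 0 <= a ->
  (\int[P]_t Y t = a%:E)%E -> (\int[P]_t (Y t * Y t) <= (a ^+ 2 + c)%:E)%E ->
  (\int[P]_t ((Y t - a%:E) * (Y t - a%:E)) <= c%:E)%E.
Proof.
move=> mY Y0 a0 EY EYY.
have mD : measurable_fun setT (fun t => Y t - a%:E)%E.
  by apply: emeasurable_funB => //; exact: measurable_cst.
have mDD : measurable_fun setT (fun t => (Y t - a%:E) * (Y t - a%:E))%E.
  exact: emeasurable_funM.
have mYY : measurable_fun setT (fun t => Y t * Y t)%E by exact: emeasurable_funM.
have maY : measurable_fun setT (fun t => (2 * a)%:E * Y t)%E.
  by apply: emeasurable_funM => //; exact: measurable_cst.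
have aa0 : 0 <= 2 * a by rewrite mulr_ge0.
have : (\int[P]_t ((Y t - a%:E) * (Y t - a%:E) + (2 * a)%:E * Y t) =
        \int[P]_t (Y t * Y t + (a ^+ 2)%:E))%E.
  apply: eq_integral => t _; have := Y0 t; case: (Y t) => [y _| _|//].
    by rewrite -EFinB -!EFinM -!EFinD; congr (_%:E); ring.
  rewrite /= !mulyy /= addye; first by [].
  have [->|a1] := eqVneq a 0; first by rewrite mulr0 mul0e.
  by rewrite gt0_muley // lte_fin; lra.
rewrite ge0_integralD //; last 2 first.
- by move=> t _; exact: mulee_ge0.
- by move=> t _; rewrite mule_ge0 ?lee_fin.
rewrite ge0_integralD //; last 2 first.
- by move=> t _; exact: mulee_ge0.
- by move=> t _; rewrite lee_fin sqr_ge0.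
have Ecst : (\int[P]_t (a ^+ 2)%:E = (a ^+ 2)%:E)%E.
  by rewrite integral_cst // -[RHS]mule1; congr (_ * _)%E; exact: probability_setT.
rewrite ge0_integralZl_EFin // EY Ecst.
move=> h; have : (\int[P]_t ((Y t - a%:E) * (Y t - a%:E)) + ((2 * a)%:E * a%:E)
    <= (a ^+ 2 + c)%:E + (a ^+ 2)%:E)%E by rewrite h; apply: leeD2r.
rewrite -EFinM -EFinD -leeBrDr // -EFinB => /le_trans; apply.
by rewrite lee_fin; lra.
Qed.

(** Telescoping, from [1 / a^2 <= 2 / a - 2 / (a + 1)] for [a >= 1]. *)
Lemma sum_inv_sqr n : \sum_(0 <= k < n) ((k.+1%:R : R) ^+ 2)^-1 <= 2.
Proof.
suff : \sum_(0 <= k < n) ((k.+1%:R : R) ^+ 2)^-1 <= 2 - 2 * (n.+1%:R)^-1.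
  by move/le_trans; apply; rewrite gerBl mulr_ge0.
elim: n => [|n IH]; first by rewrite big_geq // invr1; lra.
rewrite big_nat_recr //=; apply: le_trans (lerD IH (lexx _)) _.
have n1 : (1 : R) <= n.+1%:R by rewrite ler1n.
rewrite -[n.+2%:R]natr1; set a := n.+1%:R in n1 *.
rewrite -subr_ge0 (_ : _ - _ = (a ^+ 2 * (a + 1))^-1 * (a - 1)); last first.
  by field; apply/andP; split; apply: lt0r_neq0; lra.
by rewrite mulr_ge0 ?subr_ge0 // invr_ge0 mulr_ge0 ?sqr_ge0 //; lra.
Qed.

(** The squared deviations at time [k^2], divided by [k^4], have means of order [1 / k^2]. Their sum
    is thus integrable, hence almost everywhere finite, and its terms tend to 0; this does the work
    of Chebyshev and Borel-Cantelli together. *)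
Lemma ae_subsequence X m (C : R) : 0 <= C ->
  (forall n, measurable_fun setT (X n)) -> (forall n t, 0 <= X n t)%E ->
  (forall n, 0 <= m n) -> (forall n, \int[P]_t X n t = (m n)%:E)%E ->
  (forall n, \int[P]_t (X n t * X n t) <= (m n ^+ 2 + C * n.+1%:R)%:E)%E ->
  {ae P, forall t, forall e : R, 0 < e -> exists N, forall k, (N <= k)%N ->
     X (k ^ 2)%N t \is a fin_num /\
     `|fine (X (k ^ 2)%N t) - m (k ^ 2)%N| <= e * (k ^ 2)%:R}.
Proof.
move=> C0 mX X0 m0 EX EXX.
pose D n t : \bar R := ((X n t - (m n)%:E) * (X n t - (m n)%:E))%E.
pose f k t : \bar R := ((((k.+1)%:R ^+ 4)^-1)%:E * D (k.+1 ^ 2)%N t)%E.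
have D0 n t : (0 <= D n t)%E by exact: mulee_ge0.
have mD n : measurable_fun setT (D n).
  by apply: emeasurable_funM; apply: emeasurable_funB => //; exact: measurable_cst.
have w0 k : 0 <= ((k.+1)%:R ^+ 4)^-1 :> R by rewrite invr_ge0 exprn_ge0.
have f0 k t : (0 <= f k t)%E by rewrite mule_ge0.
have mf k : measurable_fun setT (f k).
  by apply: emeasurable_funM => //; exact: measurable_cst.
pose Z t : \bar R := (\sum_(k <oo) f k t)%E.
have Z0 t : (0 <= Z t)%E by exact: nneseries_ge0.
have mZ : measurable_fun setT Z by apply: ge0_emeasurable_sum.
have intf k : (\int[P]_t f k t <= (2 * C * ((k.+1%:R ^+ 2)^-1))%:E)%E.
  rewrite ge0_integralZl_EFin //.
  apply: (@le_trans _ _ ((((k.+1)%:R ^+ 4)^-1)%:E * (C * ((k.+1) ^ 2).+1%:R)%:E)%E).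
    by apply: lee_wpmul2l; rewrite ?lee_fin //; exact: variance_le.
  rewrite -EFinM lee_fin; set a := k.+1%:R : R.
  have a1 : 1 <= a by rewrite ler1n.
  have -> : ((k.+1 ^ 2).+1)%:R = a ^+ 2 + 1 :> R by rewrite -natr1 natrX.
  have a2 : 0 < a ^+ 2 by rewrite exprn_gt0 //; lra.
  have a4 : 0 < a ^+ 4 by rewrite exprn_gt0 //; lra.
  rewrite mulrC ler_pdivrMr // (_ : _ * a ^+ 4 = C * (2 * a ^+ 2)).
    rewrite ler_wpM2l //; have a21 : 1 <= a ^+ 2 by rewrite exprn_ege1.
    lra.
  by field; apply: lt0r_neq0; lra.
have intZ : (\int[P]_t Z t < +oo)%E.
  rewrite /Z integral_nneseries //.
  apply: (@le_lt_trans _ _ (2 * C * 2)%:E); last by rewrite ltey.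
  apply: lime_le; first by apply: is_cvg_nneseries => k _ _; exact: integral_ge0.
  apply: nearW => n; apply: (@le_trans _ _ (\sum_(0 <=
    k < n) (2 * C * ((k.+1%:R ^+ 2)^-1))%:E)%E).
    by apply: lee_sum => k _; exact: intf.
  rewrite sumEFin lee_fin -mulr_sumr ler_wpM2l ?sum_inv_sqr // mulr_ge0 //.
have iZ : P.-integrable setT Z.
  apply/integrableP; split => //.
  suff -> : (\int[P]_t `|Z t| = \int[P]_t Z t)%E by [].
  by apply: eq_integral => t _; rewrite gee0_abs.
have := integrable_ae measurableT iZ.
apply: (@filterS _ _ (ae_filter_ringOfSetsType P)) => t /(_ I) Zfin e e0.
have ffin k : f k t \is a fin_num.
  rewrite ge0_fin_numE //; apply: (@le_lt_trans _ _ (Z t)); last by rewrite ltey_eq Zfin.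
  apply: le_trans (nneseries_lim_ge k.+1 (fun k _ _ => f0 k t)).
  by rewrite big_nat_recr //= leeDr // sume_ge0.
have : (fun k => fine (f k t)) @ \oo --> (0 : R).
  apply: cvg_series_cvg_0; apply: nondecreasing_is_cvgn.
    apply/nondecreasing_seqP => k; rewrite /series /= big_nat_recr //= lerDl.
    exact: fine_ge0.
  exists (fine (Z t)) => _ [n _ <-]; rewrite /series /= -lee_fin fineK //.
  rewrite -sumEFin (eq_bigr (fun k => f k t)); last by move=> k _; rewrite fineK.
  exact: (nneseries_lim_ge n (fun k _ _ => f0 k t)).
move=> /cvgrPdist_le /(_ (e ^+ 2)) []; first by rewrite exprn_gt0.
(* The terms [f k] are indexed from the square of [k.+1], to avoid division by 0. *)
move=> N _ HN; exists N.+1 => -[//|k] Nk.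
have k1 : 1 <= (k.+1%:R : R) by rewrite ler1n.
have := HN k Nk; rewrite /= sub0r normrN; have := ffin k; rewrite /f.
have := X0 (k.+1 ^ 2)%N t; rewrite /D; case: (X _ t) => [x x0 _| _|//]; last first.
  rewrite /= mulyy gt0_muley // lte_fin invr_gt0 exprn_gt0 //; lra.
rewrite -EFinB -!EFinM /= => h; split => //.
rewrite -(@ler_pXn2r _ 2) ?nnegrE // ?mulr_ge0 // ?(ltW e0) //.
rewrite real_normK ?num_real // exprMn natrX -exprM.
move: h; rewrite ger0_norm; last by rewrite mulr_ge0 // -expr2 sqr_ge0.
rewrite mulrC ler_pdivrMr ?exprn_gt0 -?expr2 //; lra.
Qed.

Lemma nat_sqrt n : exists k,
  [&& k ^ 2 <= n, n < k.+1 ^ 2, n - k ^ 2 <= (2 * k).+1 & k.+1 ^ 2 - n <= (2 * k).+1]%N.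
Proof.
have ex : exists k, (k ^ 2 <= n)%N by exists 0%N.
have bnd k : (k ^ 2 <= n)%N -> (k <= n)%N.
  by apply: leq_trans; case: k => // k; rewrite expnS expn1 leq_pmulr.
have [k kn kmax] := ex_maxnP ex bnd.
have nk : (n < k.+1 ^ 2)%N.
  by rewrite ltnNge; apply/negP => /kmax; rewrite ltnn.
exists k; move: kn nk; rewrite !expnS !expn0 !muln1 mulSn mulnS => kn nk.
by clear ex bnd kmax; lia.
Qed.

Lemma interpolate (x m : nat -> R) (K : R) : 0 <= K ->
  nondecreasing_seq x -> nondecreasing_seq m -> (forall n, m n.+1 <= m n + K) ->
  (forall e : R, 0 < e -> exists N, forall k, (N <= k)%N ->
    `|x (k ^ 2)%N - m (k ^ 2)%N| <= e * (k ^ 2)%:R) ->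
  forall e : R, 0 < e -> exists N, forall n, (N <= n)%N -> `|x n - m n| <= e * n%:R.
Proof.
move=> K0 xnd mnd mK h e e0.
have mKn n j : m (n + j)%N <= m n + K * j%:R.
  elim: j => [|j IH]; first by rewrite addn0 mulr0 addr0.
  rewrite addnS -natr1 mulrDr mulr1 addrA; apply: le_trans (mK _) _; lra.
(* Error budget: [(k + 1)^2 <= 4 * n] turns [e / 8] at the next square into [e / 2], and the growth
   of [m] between squares costs at most [3 / 8 * e], both relative to [n]. *)
have e8 : 0 < e / 8 by lra.
have [N HN] := h _ e8.
exists ((maxn N (Num.trunc (8 * K / e)).+2).+1 ^ 2)%N => n nN.
have [k /and4P[kn nk j1' j2']] := nat_sqrt n.
have : (maxn N (Num.trunc (8 * K / e)).+2 < k.+1)%N.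
  have := leq_ltn_trans nN nk; by rewrite ltn_exp2r // => /ltnW.
rewrite ltnS geq_max => /andP[Nk Tk].
have k1 : 1 <= (k%:R : R) by rewrite ler1n; apply: leq_trans Tk.
have Kk : 8 * K <= e * k%:R.
  rewrite [e * _]mulrC -ler_pdivrMr //;
    apply: (@le_trans _ _ (Num.trunc (8 * K / e)).+1%:R).
    by apply: ltW; exact: truncnS_gt.
  by rewrite ler_nat ltnW.
have h1 := HN k Nk; have h2 := HN k.+1 (leqW Nk).
have x1 : x (k ^ 2)%N <= x n by exact: xnd.
have x2 : x n <= x (k.+1 ^ 2)%N by apply: xnd; exact: ltnW.
have m1 := mKn (k ^ 2)%N (n - k ^ 2)%N; have m2 := mKn n (k.+1 ^ 2 - n)%N.
rewrite subnKC // in m1; rewrite subnKC ?(ltnW nk) // in m2.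
have kn' : k%:R ^+ 2 <= n%:R :> R by rewrite -natrX ler_nat.
have j1 : (n - k ^ 2)%:R <= 2 * k%:R + 1 :> R.
  by rewrite -(natrM R 2) natr1 ler_nat.
have j2 : (k.+1 ^ 2 - n)%:R <= 2 * k%:R + 1 :> R.
  by rewrite -(natrM R 2) natr1 ler_nat.
have Kj : K * (2 * k%:R + 1) <= 3 / 8 * e * n%:R.
  apply: (@le_trans _ _ (K * (3 * k%:R))); first by rewrite ler_wpM2l //; lra.
  have : 0 <= (e * k%:R - 8 * K) * k%:R by rewrite mulr_ge0 //; lra.
  have : 0 <= e * (n%:R - k%:R ^+ 2) by rewrite mulr_ge0 ?subr_ge0 // ltW.
  by rewrite expr2; lra.
have Kj1 : K * (n - k ^ 2)%:R <= 3 / 8 * e * n%:R.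
  by apply: le_trans Kj; rewrite ler_wpM2l.
have Kj2 : K * (k.+1 ^ 2 - n)%:R <= 3 / 8 * e * n%:R.
  by apply: le_trans Kj; rewrite ler_wpM2l.
have ek : e * (k ^ 2)%:R <= e * n%:R by rewrite ler_wpM2l ?ler_nat // ltW.
have ek1 : e * (k.+1 ^ 2)%:R <= 4 * (e * n%:R).
  rewrite mulrCA ler_wpM2l ?(ltW e0) // natrX -natr1.
  have : (k%:R + 1) ^+ 2 <= (2 * k%:R) ^+ 2 :> R by rewrite lerXn2r ?nnegrE //; lra.
  rewrite exprMn; lra.
move: h1 h2; rewrite !ler_norml => /andP[h1 _] /andP[_ h2].
have en : 0 <= e * n%:R by rewrite mulr_ge0 // ltW.
by apply/andP; split; lra.
Qed.

Lemma law_of_large_numbers X m (C K : R) : 0 <= C -> 0 <= K ->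
  (forall n, measurable_fun setT (X n)) -> (forall n t, 0 <= X n t)%E ->
  (forall n n' t, (n <= n')%N -> X n t <= X n' t)%E ->
  (forall n, 0 <= m n) -> (forall n, m n <= m n.+1 <= m n + K) ->
  (forall n, \int[P]_t X n t = (m n)%:E)%E ->
  (forall n, \int[P]_t (X n t * X n t) <= (m n ^+ 2 + C * n.+1%:R)%:E)%E ->
  {ae P, forall t, (forall n, X n t \is a fin_num) /\
    forall e : R, 0 < e -> exists N, forall n, (N <= n)%N ->
     `|fine (X n t) - m n| <= e * n%:R}.
Proof.
move=> C0 K0 mX X0 Xnd m0 mK EX EXX.
have := ae_subsequence C0 mX X0 m0 EX EXX.
apply: (@filterS _ _ (ae_filter_ringOfSetsType P)) => t ht.
(* Monotonicity spreads finiteness from large squares to every index; the tolerance 1 is an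
   arbitrary choice. *)
have Xfin n : X n t \is a fin_num.
  have [N /(_ (maxn N n) (leq_maxl _ _))[h _]] := ht 1 ltr01.
  rewrite ge0_fin_numE //; apply: (@le_lt_trans _ _ (X (maxn N n ^ 2)%N t)).
    apply: Xnd; apply: leq_trans (leq_maxr N n) _.
    by case: (maxn N n) => // k; rewrite expnS expn1 leq_pmulr.
  by rewrite -ge0_fin_numE.
split=> //; apply: (@interpolate _ _ K) => //.
- by move=> n n' nn'; rewrite fine_le // Xnd.
- by apply/nondecreasing_seqP => n; case/andP: (mK n).
- by move=> n; case/andP: (mK n).
- by move=> e e0; have [N HN] := ht e e0; exists N => k /HN[].
Qed.

End law_of_large_numbers.

(** * Oscillation of the mean *)

Section oscillation.
Variable R : realType.
Implicit Types (x y v : vert) (f g : vert -> R).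

Lemma iter_step_mean_le k f g x : (forall y, (depth y <= depth x + k)%N -> f y <= g y) ->
  iter k (@step_mean R) f x <= iter k (@step_mean R) g x.
Proof.
elim: k x => [|k IH] x h /=; first by apply: h; rewrite addn0.
apply: step_mean_le => y xy; apply: IH => w wy; apply: h; apply: leq_trans wy _.
rewrite addnS -addSn leq_add2r; case/andP: xy => _ /orP[/eqP <-|/eqP <-].
  by rewrite depth_parent; lia.
by rewrite depth_parent; lia.
Qed.

Lemma iter_step_meanD k f g x : iter k (@step_mean R) (fun y => f y + g y) x =
  iter k (@step_mean R) f x + iter k (@step_mean R) g x.
Proof.
elim: k x => [//|k IH] x /=; rewrite -step_meanD; apply: eq_step_mean => y _; exact: IH.
Qed.

Lemma iter_step_meanZ k c f x : iter k (@step_mean R) (fun y => c * f y) x =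
  c * iter k (@step_mean R) f x.
Proof.
elim: k x => [//|k IH] x /=; rewrite -step_meanZ; apply: eq_step_mean => y _; exact: IH.
Qed.

Lemma iter_step_mean_cst k c x : iter k (@step_mean R) (fun=> c) x = c.
Proof.
elim: k x => [//|k IH] x /=; rewrite -[RHS](step_mean_cst c x);
  apply: eq_step_mean => y _.
exact: IH.
Qed.

Lemma iter_step_mean_decay k x :
  iter k (@step_mean R) (decay R) x <= (17 / 18) ^+ k * decay R x.
Proof.
elim: k x => [|k IH] x /=; first by rewrite mul1r.
apply: le_trans (step_mean_le (fun y _ => IH y)) _; rewrite step_meanZ exprSr -mulrA.
by rewrite ler_wpM2l ?exprn_ge0 ?step_mean_decay //; lra.
Qed.

Definition below a x : R := (depth x < a)%:R.

(* A level below [a] is occupied with probability at most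
   [(17/18)^k (3/2)^a], and [(17/18)^8 < 2/3]. *)
Lemma occupation_le a n : \sum_(0 <= k < n) iter k (@step_mean R) (below a) root <=
  8 * a%:R + 18.
Proof.
have b1 k : iter k (@step_mean R) (below a) root <= 1.
  rewrite -[leRHS](iter_step_mean_cst k 1 root); apply: iter_step_mean_le => y _.
  by rewrite /below; case: (_ < _)%N.
have bd k : iter (8 * a + k) (@step_mean R) (below a) root <= (17 / 18) ^+ k.
  apply: (@le_trans _ _ ((3 / 2) ^+ a * iter (8 * a + k) (@step_mean R) (decay R) root)).
    rewrite -iter_step_meanZ; apply: iter_step_mean_le => y _; rewrite /below /decay.
    case: ltnP => ya; last by rewrite mulr_ge0 ?exprn_ge0 //; lra.
    rewrite -(subnK (ltnW ya)) exprD -mulrA -exprMn.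
    rewrite (_ : 3 / 2 * (2 / 3) = 1); last by field.
    by rewrite expr1n mulr1 exprn_ege1 //; lra.
  apply: le_trans (ler_wpM2l _ (iter_step_mean_decay _ _)) _;
    first by rewrite exprn_ge0 //; lra.
  rewrite /decay depth_root mulr1 exprD exprM mulrA -exprMn.
  rewrite -[leRHS]mul1r; apply: ler_wpM2r; first by rewrite exprn_ge0 //; lra.
  by apply: exprn_ile1; rewrite !exprS expr0; lra.
(* The first [8 * a] terms are at most 1 each, the others form a geometric series with sum at most
   [18 = (1 - 17 / 18)^-1]. *)
suff h : \sum_(0 <= k < n) iter k (@step_mean R) (below a) root <=
    (minn n (8 * a))%:R + 18 * (1 - (17 / 18) ^+ (n - 8 * a)).
  apply: le_trans h _; apply: lerD.
    by rewrite -natrM ler_nat geq_minr.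
  have : 0 <= (17 / 18 : R) ^+ (n - 8 * a) by rewrite exprn_ge0 //; lra.
  lra.
elim: n => [|n IH]; first by rewrite big_geq // min0n sub0n expr0; lra.
rewrite big_nat_recr //=; have [na|an] := ltnP n (8 * a).
  move: IH; rewrite (minn_idPl na) (minn_idPl (ltnW na)) -natr1.
  have -> : (n.+1 - 8 * a = 0)%N by apply/eqP; rewrite subn_eq0.
  have -> : (n - 8 * a = 0)%N by apply/eqP; rewrite subn_eq0 ltnW.
  by have := b1 n; rewrite expr0; lra.
move: IH; rewrite (minn_idPr an) (minn_idPr (leqW an)) subSn // exprS.
have := bd (n - 8 * a)%N; rewrite subnKC //; lra.
Qed.

Lemma mem_anc (s : seq vert) x v : path tadj root s -> v \in root :: s ->
  anc x v -> x \in root :: s.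
Proof.
move=> ps; elim/parent_ind: v => [|v v0 IH] vs; rewrite anc_parent.
  by rewrite eqxx orbF => /eqP ->; rewrite inE eqxx.
by case/orP => [/eqP ->//|/andP[_]]; apply: IH; exact: visited_parent_closed.
Qed.

(** The walk has visited every ancestor of its last position. *)
Lemma depth_last_le_undup (s : seq vert) : path tadj root s ->
  (depth (last root s) <= size (undup (root :: s)))%N.
Proof.
move=> ps; rewrite -[depth _]subn0 -{1}depth_root -size_chain.
apply: uniq_leq_size; first exact: uniq_chain.
move=> x; rewrite mem_chain mem_undup => /andP[xa _]; apply: mem_anc xa => //.
exact: mem_last.
Qed.

Variable p : R.
Hypothesis p0 : 0 <= p.
Hypothesis p20 : 20 * p < 1.
Let K := chi_max p.
Let K1 : 1 <= K. Proof. exact: chi_max_ge1. Qed.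
Local Notation h n := (mean_weight (top_mass p) n root).

Lemma mean_weight_ge_speed n : (1 - p) * iter n (@step_mean R) (fun x => (depth
  x)%:R) root <= h n.
Proof.
rewrite -(walk_mean_last n root (fun x => (depth x)%:R)) -walk_meanZ;
  apply: walk_mean_le => s ps _.
apply: (@le_trans _ _ (\sum_(v <- undup (root :: s)) (1 - p))); last first.
  by apply: ler_sum => v _; exact: top_mass_ge.
rewrite big_const_seq count_predT iter_addr_0 -[leRHS]mulr_natr.
by apply: ler_wpM2l; [move: p0 p20; lra|rewrite ler_nat; exact: depth_last_le_undup ps].
Qed.

(** The drift of the depth is [(20 - 1) / 21] from depth [a] on, and nonnegative before;
    [occupation_le] bounds the mean time spent before. *)
Lemma speed_ge a n : (forall l, (a <= l < n)%N -> branching l = 20) ->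
  19 / 21 * n%:R - (8 * a%:R + 18) <= iter n (@step_mean R) (fun x => (depth x)%:R) root.
Proof.
move=> hb; pose d x : R := 19 / 21 - below a x.
have step k : (k < n)%N -> iter k (@step_mean R) (fun x => (depth x)%:R) root + iter
  k (@step_mean R) d root <=
    iter k.+1 (@step_mean R) (fun x => (depth x)%:R) root.
  (* After [k < n] steps from the root the depth is below [n], so the walk has not left the
     block. *)
  move=> kn; rewrite iterSr -iter_step_meanD; apply: iter_step_mean_le => y;
    rewrite depth_root add0n => yk.
  rewrite (step_mean_depth (fun l => l%:R)) /d /below.
  have [->|y0] /= := eqVneq y root.
    rewrite depth_root /= mul0r !add0r mulr1 divff; last first.
      by have := branching_ge2R R 0; lra.
    by case: (_ < _)%N => /=; lra.
  have : (0 < depth y)%N by rewrite depth_gt0.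
  have := hb (depth y); case: (depth y) yk => // l lk hbl _ /=.
  rewrite ler_pdivlMr; last by have := branching_ge2R R l.+1; lra.
  case: (ltnP l.+1 a) hbl => [la _|al hbl] /=.
    by have := branching_ge2R R l.+1; rewrite -[l.+2%:R]natr1 -[l.+1%:R]natr1; lra.
  rewrite hbl; last exact: leq_ltn_trans lk kn.
  by rewrite -[l.+2%:R]natr1 -[l.+1%:R]natr1; lra.
have dk k : iter k (@step_mean R) d root = 19 / 21 - iter k (@step_mean R) (below a) root.
  rewrite /d -{2}(iter_step_mean_cst k (19 / 21) root) -mulN1r -iter_step_meanZ
    -iter_step_meanD.
  by congr (iter _ _ _ _); apply/funext => y; rewrite mulN1r.
have : forall m, (m <= n)%N -> \sum_(0 <= k < m) iter k (@step_mean R) d root <=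
    iter m (@step_mean R) (fun x => (depth x)%:R) root.
  elim=> [|m IH] mn; first by rewrite big_geq //= ler0n.
  rewrite big_nat_recr //=; apply: le_trans (step m mn); rewrite lerD2r.
  by apply: IH; exact: ltnW.
move=> /(_ n (leqnn n)); apply: le_trans.
under eq_bigr do rewrite dk.
rewrite sumrB lerB ?occupation_le //.
by rewrite sumr_const_nat subn0 mulr_natr.
Qed.

Lemma mean_weight_lower a n : (forall l, (a <= l < n)%N -> branching l = 20) ->
  (1 - p) * (19 / 21 * n%:R - (8 * a%:R + 18)) <= h n.
Proof.
move=> /speed_ge ha; apply: le_trans (mean_weight_ge_speed n).
by rewrite ler_wpM2l //; move: p0 p20; lra.
Qed.

(** A step towards the root discovers nothing, the visited set being closed under parents. *)
Lemma mean_weight_increment n : h n.+1 <= h n + iter n (@step_mean R) (fun x =>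
  step_mean (fun y => (depth x < depth y)%:R * top_mass p y) x) root.
Proof.
rewrite /mean_weight walk_mean_rcons -walk_mean_last -walk_meanD;
  apply: walk_mean_le => s ps sn.
rewrite -{1}(step_mean_cst (weight (top_mass p) (root :: s)) (last root s))
  -step_meanD; apply: step_mean_le => y ly.
rewrite weight_rcons lerD2l; have /andP[z0 _] := top_mass_bnd p0 p20 y.
rewrite ler_wpM2r // ler_nat; case: (boolP (y \in root :: s)) => // ys.
case/andP: ly => ly /orP[/eqP pl|/eqP py].
  case/negP: ys; rewrite -pl; exact: (visited_parent_closed ps (mem_last root s)).
have y0 : y != root by apply: contraNneq ys => ->; rewrite inE eqxx.
by rewrite -py depth_parent; have := depth_gt0 y; rewrite y0;
  case: (depth y) => //= l; rewrite ltnS leqnn.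
Qed.

(** Open paths shorter than [D] only see binary branching and give a series of ratio [2 * p]; longer
    ones are bounded by the tail of the series of ratio [20 * p]. *)
Lemma chi_ball_le_block (a T D N l : nat) :
  (forall i, (a <= i < T)%N -> branching i = 2) ->
  (a <= l)%N -> (l + D <= T)%N ->
  chi_ball p N l <= (1 - 2 * p)^-1 + (20 * p) ^+ D * K.
Proof.
move=> hb al lT; rewrite /chi_ball -[X in index_iota X N]add0n big_addn.
have r0 : 0 <= 20 * p by rewrite mulr_ge0.
have s0 : 0 <= 2 * p by rewrite mulr_ge0.
apply: (@le_trans _ _ (\sum_(0 <= j < N - l) ((2 * p) ^+ j +
    (D <= j)%:R * (20 * p) ^+ j))).
  apply: ler_sum => j _; rewrite addnK [(j + l)%N]addnC.
  have [Dj|jD] := leqP D j.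
    rewrite mul1r ler_wpDl ?exprn_ge0 // exprMn mulrC ler_wpM2r ?exprn_ge0 //.
    by rewrite -natrX ler_nat; apply: prod_branching_le => i _; exact: branching_le20.
  rewrite mul0r addr0 exprMn mulrC ler_wpM2r ?exprn_ge0 //.
  rewrite -natrX ler_nat; apply: prod_branching_le => i /andP[li ij]; rewrite hb //.
  by rewrite (leq_trans al li) (leq_trans ij) // (leq_trans _ lT) // leq_add2l ltnW.
rewrite big_split /=; apply: lerD.
  by apply: geometric_le => //; move: p0 p20; lra.
have tail n : \sum_(0 <= j < n) (D <= j)%:R * (20 * p) ^+ j <=
    (20 * p) ^+ D * \sum_(0 <= j < n) (20 * p) ^+ j.
  have [nD|Dn] := leqP n D.
    rewrite big_nat_cond big1 ?mulr_ge0 ?exprn_ge0 ?sumr_ge0 // => [j _|j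
      /andP[/andP[_ jn] _]].
      by rewrite exprn_ge0.
    by rewrite leqNgt (leq_trans jn nD) mul0r.
  rewrite (@big_cat_nat _ _ _ D) ?(ltnW Dn) //= big_nat_cond big1 ?add0r; last first.
    by move=> j /andP[/andP[_ jn] _]; rewrite leqNgt jn mul0r.
  rewrite -[X in index_iota X n]add0n big_addn mulr_sumr.
  rewrite (@big_cat_nat _ _ _ (n - D) 0 n) ?leq_subr //=.
  rewrite ler_wpDr //; first by apply: sumr_ge0 => j _; rewrite mulr_ge0 ?exprn_ge0.
  by apply: ler_sum => j _; rewrite leq_addl mul1r exprD mulrC.
apply: le_trans (tail _) _; rewrite ler_wpM2l ?exprn_ge0 //.
exact: geometric_le.
Qed.

(** Inside the block a step goes away from the root with probability [2 / 3] and adds at most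
    [(1 - p) * (9 / 8)], since [(1 - 2 * p)^-1 + 1 / 90 <= 10 / 9 + 1 / 90 <= 9 / 8]. Steps from
    depths below [a] cost at most [K] each, and the initial vertex turns 18 into 19. *)
Lemma mean_weight_upper (a T D n : nat) :
  (0 < a)%N -> (forall i, (a <= i < T)%N -> branching i = 2) ->
  (20 * p) ^+ D * K <= 1 / 90 -> (n + D <= T)%N ->
  h n <= (1 - p) * (3 / 4) * n%:R + K * (8 * a%:R + 19).
Proof.
move=> a0 hb hD nT.
have pp : 0 <= 1 - p by move: p0 p20; lra.
pose g x : R := (1 - p) * (3 / 4) + K * below a x.
have step k : (k < n)%N -> h k.+1 <= h k + iter k (@step_mean R) g root.
  move=> kn; apply: le_trans (mean_weight_increment k) _; rewrite lerD2l.
  apply: iter_step_mean_le => y; rewrite depth_root add0n => yk.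
  rewrite /g /below; have [ya|ay] := ltnP (depth y) a.
    rewrite mulr1; apply: ler_wpDl; first by rewrite mulr_ge0 //; lra.
    rewrite -[leRHS](step_mean_cst K y); apply: step_mean_le => w _.
    have /andP[z0 zK] := top_mass_bnd p0 p20 w.
    by case: (_ < _)%N; rewrite ?mul1r // mul0r (le_trans ler01).
  have y0 : y != root by rewrite -depth_gt0 (leq_trans a0).
  have zy w : depth w = (depth y).+1 -> top_mass p w <= (1 - p) * (9 / 8).
    move=> wy; rewrite /top_mass /opn_weight -depth_eq0 wy /= ler_wpM2l //.
    apply: chi_le => // N.
    apply: le_trans (@chi_ball_le_block a T D N (depth y).+1 hb _ _) _.
    - exact: leqW.
    - by apply: leq_trans nT; rewrite leq_add2r (leq_ltn_trans yk).
    have : (1 - 2 * p)^-1 <= 10 / 9.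
      have p2 : 0 < 1 - 2 * p by move: p0 p20; lra.
      by rewrite -[leLHS]mul1r ler_pdivrMr //; move: p20; lra.
    by move: hD; lra.
  rewrite mulr0 addr0.
  apply: (@le_trans _ _ (step_mean (fun w => (depth y < depth w)%:R * ((1 - p) * (9 /
    8))) y)).
    apply: step_mean_le => w yw; case: ltnP => yw'; last by rewrite !mul0r.
    rewrite !mul1r; apply: zy; case/andP: yw => _ /orP[/eqP pw|/eqP pw].
      by move: yw'; rewrite -pw depth_parent; lia.
    by move: yw'; rewrite -pw depth_parent; lia.
  rewrite (step_mean_depth (fun l => (depth y < l)%:R * ((1 - p) * (9 / 8)))) ltnSn
    y0 hb; last first.
    by rewrite ay (leq_ltn_trans yk) // (leq_trans kn) // (leq_trans _ nT) // leq_addr.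
  have -> : (depth y < (depth y).-1)%N = false by lia.
  by rewrite /= ler_pdivrMr; lra.
have gk k : iter k (@step_mean R) g root =
  (1 - p) * (3 / 4) + K * iter k (@step_mean R) (below a) root.
  by rewrite /g iter_step_meanD iter_step_mean_cst iter_step_meanZ.
have : forall m, (m <= n)%N -> h m <= h 0 + \sum_(0 <=
  k < m) iter k (@step_mean R) g root.
  elim=> [|m IH] mn; first by rewrite big_geq // addr0.
  rewrite big_nat_recr //= addrA; apply: le_trans (step m mn) _; rewrite lerD2r.
  by apply: IH; exact: ltnW.
move=> /(_ n (leqnn n)) /le_trans; apply.
under eq_bigr do rewrite gk.
rewrite big_split /= sumr_const_nat subn0 -[_ *+ n]mulr_natr -mulr_sumr.
have h0 : h 0 <= K.
  rewrite /mean_weight /= weight_cons /weight big_nil add0r mul1r.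
  by have /andP[] := top_mass_bnd p0 p20 root.
have := ler_wpM2l (le_trans ler01 K1) (occupation_le a n).
lra.
Qed.

End oscillation.

(** * Doubly exponential blocks *)

Section blocks.

Definition block i : nat := 2 ^ (2 ^ i).

Lemma branching_block i l : (block i <=
  l < block i.+1)%N -> branching l = if odd i then 20 else 2.
Proof.
move=> /andP[il li]; rewrite /branching.
have l0 : (0 < l)%N by apply: leq_trans il; rewrite expn_gt0.
have -> // : trunc_log 2 (trunc_log 2 l) = i.
apply: trunc_log_eq => //; rewrite trunc_log_max //=.
rewrite -(ltn_exp2l _ _ (ltnSn 1)); apply: leq_ltn_trans li; exact: trunc_logP.
Qed.

Lemma block_gt i : (i < block i)%N.
Proof. by apply: ltn_trans (ltn_expl i _) (ltn_expl _ _). Qed.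

Lemma blockS i : block i.+1 = (block i * block i)%N.
Proof. by rewrite /block expnS mul2n -addnn expnD. Qed.

End blocks.

(** * Comparison of upper and lower limits *)

Section limit_superior.
Variable R : realType.
Implicit Types (u v : (\bar R)^nat).

Lemma limn_esup_ge u c : (forall N, exists2 n, (N <= n)%N & (c <= u n)%E) ->
  (c <= limn_esup u)%E.
Proof.
move=> h; rewrite limn_esup_lim; apply: lime_ge; first exact: is_cvg_esups.
apply: nearW => N; have [n Nn cn] := h N; apply: le_trans cn _.
by apply: ereal_sup_ubound; exists n.
Qed.

Lemma limn_einf_le u c : (forall N, exists2 n, (N <= n)%N & (u n <= c)%E) ->
  (limn_einf u <= c)%E.
Proof.
move=> h; rewrite limn_einf_lim; apply: lime_le; first exact: is_cvg_einfs.
apply: nearW => N; have [n Nn cn] := h N; apply: le_trans cn.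
by apply: ereal_inf_lbound; exists n.
Qed.

Lemma limn_esup_le_near u v e N :
  (forall n, (N <= n)%N -> u n <= v n + e%:E)%E ->
  (limn_esup u <= limn_esup v + e%:E)%E.
Proof.
move=> h; rewrite -leeBlDr // [leRHS]limn_esup_lim.
apply: lime_ge; first exact: is_cvg_esups.
exists N => // n Nn; rewrite leeBlDr //.
apply: (@le_trans _ _ (esups u n)).
  rewrite limn_esup_lim; apply: lime_le; first exact: is_cvg_esups.
  by exists n => // m /= nm; exact: nonincreasing_esups.
apply: ge_ereal_sup => _ [m /= nm <-]; apply: le_trans (h m (leq_trans Nn nm)) _.
by rewrite leeD2r //; apply: ereal_sup_ubound; exists m.
Qed.

Lemma eq_limn_esup u v :
  (forall e : R, 0 < e -> exists N, forall n, (N <= n)%N ->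
     (u n <= v n + e%:E)%E /\ (v n <= u n + e%:E)%E) ->
  limn_esup u = limn_esup v.
Proof.
move=> h; apply/eqP; rewrite eq_le; apply/andP; split; apply/lee_addgt0Pr => e e0;
  have [N HN] := h e e0; apply: (@limn_esup_le_near _ _ _ N) => n /HN[] //.
Qed.

Lemma eq_limn_einf u v :
  (forall e : R, 0 < e -> exists N, forall n, (N <= n)%N ->
     (u n <= v n + e%:E)%E /\ (v n <= u n + e%:E)%E) ->
  limn_einf u = limn_einf v.
Proof.
move=> h; rewrite /limn_einf; congr (- _)%E; apply: eq_limn_esup => e e0.
have [N HN] := h e e0; exists N => n /HN[uv vu].
by split; rewrite /= -leeBlDr // -fin_num_oppeD // leeN2.
Qed.

End limit_superior.

Lemma bernoulli_ineq (R : realType) (x : R) n : 0 <= x -> 1 + n%:R * x <= (1 + x) ^+ n.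
Proof.
move=> x0; elim: n => [|n IH]; first by rewrite mul0r addr0.
have y0 : 0 <= n%:R * x * x by rewrite !mulr_ge0.
rewrite exprS -natr1; apply: le_trans (ler_wpM2l _ IH); lra.
Qed.

(** * An upper bound for the percolation threshold *)

Section susceptibility.
Variables (R : realType) (p : R).
Hypothesis p01 : 0 <= p <= 1.
Local Notation P := (percolation_law osc_tree p).

Lemma cluster_root (e : config osc_tree) :
  Defs.cluster e (root : osc_tree) = [set w | top e w = root].
Proof.
have r e' : top e' root = root by rewrite top_rec opn_root.
by apply/seteqP; split => w; [move/clusterP => /= <-|move=> /= h; apply/clusterP];
  rewrite r.
Qed.

Lemma mean_cluster_ge_ball N :
  ((chi_ball p N 0)%:E <= \int[P]_e counting (Defs.cluster e (root : osc_tree)))%E.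
Proof.
have indE e w : \1_(top_event root w) e = (w \in [set w | top e w = root])%:R :> R.
  rewrite indicE; suff -> : (e \in top_event root w) = (w \in [set w | top e w =
    root]) by [].
  by apply/idP/idP; rewrite !inE.
have E e n : ball_count R (Defs.cluster e (root :
  osc_tree)) n = \sum_(w <- ball n) \1_(top_event root w) e.
  by rewrite cluster_root; apply: eq_bigr => w _; rewrite indE.
have mE n : measurable_fun setT (fun e :
  config osc_tree => ball_count R (Defs.cluster e (root : osc_tree)) n).
  have -> : (fun e : config osc_tree => ball_count R (Defs.cluster e (root :
    osc_tree)) n) =
      (fun e => \sum_(w <- ball n) \1_(top_event root w) e) by apply/funext => e.
  by apply: measurable_sum => w; apply: measurable_indic; exact: measurable_top_event.
have -> : (chi_ball p N 0)%:E = (\int[P]_e (ball_count R (Defs.cluster e (root :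
  osc_tree)) N)%:E)%E.
  under eq_integral do rewrite E.
  rewrite integral_sum_indic; last by move=> w; exact: measurable_top_event.
  rewrite -depth_root -sum_two_point -sumEFin; apply: eq_bigr => w _.
  rewrite [RHS](prob_top_event p01 root w).
  by rewrite /top_prob /two_point /opn_weight eqxx mul1r.
apply: ge0_le_integral => //.
- by move=> e _; rewrite lee_fin ball_count_ge0.
- exact/measurable_EFinP.
- apply: (emeasurable_fun_cvg (fun n e => (ball_count R (Defs.cluster e (root :
  osc_tree)) n)%:E)).
    by move=> n; exact/measurable_EFinP.
  by move=> e _; exact: ball_count_cvg.
- move=> e _; apply: (@le_trans _ _ (limn (fun n => (ball_count R (Defs.cluster e
  (root : osc_tree)) n)%:E))).
    apply: lime_ge; first by apply/cvg_ex; eexists; exact: ball_count_cvg.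
    by exists N => // n /= Nn; rewrite lee_fin ball_count_nd.
  by rewrite le_eqVlt; apply/orP; left; apply/eqP/cvg_lim => //; exact: ball_count_cvg.
Qed.

(** At the end [T = a^2] of a block of odd index starting at [a], the last sphere alone contributes
    at least [p^T * 20^(T - a) = ((20 * p)^a / 20)^a], which is at least [M] once
    [(20 * p)^a >= 20 * M]. *)
Lemma chi_ball_unbounded M : 1 <= M -> 1 < 20 * p -> exists N, M <= chi_ball p N 0.
Proof.
move=> M1 p20; have p0 : 0 <= p by case/andP: p01.
have x0 : 0 < 20 * p - 1 by rewrite subr_gt0.
(* An odd index, large enough for the Bernoulli inequality because [i < block i]. *)
pose i := (2 * Num.trunc (20 * M / (20 * p - 1))).+1.
have hi : 20 * M <= (20 * p) ^+ block i.
  rewrite (_ : (20 * p) ^+ _ = (1 + (20 * p - 1)) ^+ block i);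
    last by congr (_ ^+ _); ring.
  apply: le_trans (bernoulli_ineq (block i) (ltW x0)).
  apply: (@le_trans _ _ ((block i)%:R * (20 * p - 1))); last by lra.
  rewrite -ler_pdivrMr //; apply: le_trans (ltW (truncnS_gt _)) _.
  by rewrite ler_nat (leq_trans _ (block_gt i)) // ltnS /i leqW // leq_pmull.
have a0 : (0 < block i)%N by rewrite expn_gt0.
pose T := block i.+1; exists T.+1.
have aT : (block i <= T)%N by rewrite /T blockS leq_pmulr.
have prodT : (20 ^ (T - block i) <= \prod_(0 <= j < T) branching j)%N.
  rewrite (@big_cat_nat _ _ _ (block i)) //=.
  rewrite -[X in (X <= _)%N]mul1n; apply: leq_mul.
    by rewrite prodn_gt0 // => j; apply: leq_trans (branching_ge2 j).
  rewrite big_nat (eq_bigr (fun=> 20)); last first.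
    by move=> j ij; rewrite (branching_block ij) /i /= mul2n odd_double.
  by rewrite -big_nat prod_nat_const_nat.
have term : p ^+ T * (20 ^ (T - block i))%:R <= chi_ball p T.+1 0.
  rewrite /chi_ball big_nat_recr //= subn0 ler_wpDl //.
    by apply: sumr_ge0 => m _; rewrite mulr_ge0 // exprn_ge0.
  by rewrite ler_wpM2l ?exprn_ge0 // ler_nat.
apply: le_trans term; rewrite natrX -(ler_pM2r (exprn_gt0 (block i) (ltr0n R 20))).
rewrite -mulrA -exprD subnK // -exprMn [p * _]mulrC /T blockS exprM.
apply: (@le_trans _ _ ((20 * M) ^+ block i)); last first.
  by rewrite lerXn2r ?nnegrE ?exprn_ge0 ?mulr_ge0 //; lra.
rewrite exprMn mulrC ler_wpM2l ?exprn_ge0 //.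
by rewrite -[leLHS]expr1 ler_weXn2l.
Qed.

Lemma mean_cluster_infinite : 1 < 20 * p ->
  (\int[P]_e counting (Defs.cluster e (root : osc_tree)) = +oo)%E.
Proof.
move=> p20; apply: eq_infty => M.
have M1 : 1 <= Num.max 1 M by rewrite le_max lexx.
have [N MN] := chi_ball_unbounded M1 p20.
apply: le_trans (mean_cluster_ge_ball N); rewrite lee_fin (le_trans _ MN) //.
by rewrite le_max lexx orbT.
Qed.

End susceptibility.

(** Otherwise the midpoint of [p] and the infimum exceeds [1 / 20], so its mean cluster is infinite
    although it lies below the infimum. *)
Lemma lt_p_T (R : realType) (p : R) : 0 <= p < p_T R (root : osc_tree) -> 20 * p < 1.
Proof.
move=> /andP[p0]; rewrite /p_T; set A := mkset _ => pA; rewrite ltNge; apply/negP => p20.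
have Ain q : 1 < 20 * q -> q <= 1 -> A q.
  move=> q20 q1; have q01 : 0 <= q <= 1 by rewrite q1 andbT; lra.
  by split => //; exact: mean_cluster_infinite.
have lb : has_lbound A by exists 0 => q [/andP[]].
have A1 : inf A <= 1 by apply: ge_inf => //; apply: Ain; lra.
have : inf A <= (p + inf A) / 2 by apply: ge_inf => //; apply: Ain; lra.
lra.
Qed.

(** Since [84 * (16 / 21 - 3 / 4) = 1], the claim is [K * (8 * a + 19) <= q * n]; the hypotheses
    give [q * n >= 10000 * K * (a - 1)], with much room. *)
Lemma block_gap (R : realType) (K q a n : R) :
  1 <= K -> 0 < q -> 10000 * K <= a * q -> a * a - a <= n -> 2 <= a ->
  84 * q * (3 / 4) * n + K * (8 * a + 19) <= 84 * q * (16 / 21) * n.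
Proof.
move=> K1 q0 Ka na a2.
have h1 : 0 <= q * (n - (a * a - a)) by rewrite mulr_ge0 ?subr_ge0 // ltW.
have h2 : 0 <= (a * q - 10000 * K) * (a - 1).
  by apply: mulr_ge0; rewrite subr_ge0 //; lra.
have h3 : 0 <= K * (a - 2) by apply: mulr_ge0; lra.
lra.
Qed.

(** * Times of fast and of slow growth *)

Section oscillating_mean.
Variables (R : realType) (p : R).
Hypothesis p0 : 0 <= p.
Hypothesis p20 : 20 * p < 1.
Local Notation h n := (mean_weight (top_mass p) n root).

Lemma exists_block (b : bool) (N : nat) (x : R) :
  exists i, [/\ odd i = b, (N <= block i)%N & x <= (block i)%:R].
Proof.
have := truncnS_gt x; set t := (Num.trunc x).+1 => xt; move: t xt => t xt.
exists (b + (maxn N t).*2)%N; split.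
- by rewrite oddD odd_double addbF; case: b.
- by apply: leq_trans (ltnW (block_gt _)); clear; case: b; lia.
- apply: le_trans (ltW xt) _; rewrite ler_nat.
  by apply: leq_trans (ltnW (block_gt _)); clear; case: b; lia.
Qed.

Lemma mean_weight_large N : exists2 n, (N <= n)%N & (1 - p) * (18 / 21) * n%:R <= h n.
Proof.
(* For [a >= 200] and [n = a^2], the loss [8 * a + 18] is at most [n / 21], the difference between
   the rates [19 / 21] and [18 / 21]. *)
have [i [oi Ni ai]] := exists_block true N 200.
exists (block i.+1).
  by rewrite blockS (leq_trans Ni) // leq_pmulr // expn_gt0.
have hb l : (block i <= l < block i.+1)%N -> branching l = 20.
  by move=> /branching_block ->; rewrite oi.
apply: le_trans (mean_weight_lower p0 p20 hb); rewrite -mulrA ler_wpM2l //.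
  by move: p0 p20; lra.
rewrite blockS natrM; set a := (block i)%:R in ai *.
have : 0 <= (a - 200) * a by rewrite mulr_ge0; lra.
lra.
Qed.

Lemma mean_weight_small N : exists2 n, (N <= n)%N & h n <= (1 - p) * (16 / 21) * n%:R.
Proof.
have K1 := chi_max_ge1 p0 p20; set K := chi_max p in K1 *.
have [D hD] : exists D, (20 * p) ^+ D * K <= 1 / 90.
  have : (geometric K (20 * p)) @ \oo --> 0.
    by apply: cvg_geometric; rewrite ger0_norm // mulr_ge0.
  move=> /cvgrPdist_le /(_ (1 / 90)) []; first by lra.
  move=> D _ /(_ D (leqnn D)); rewrite /= sub0r normrN /geometric /= mulrC.
  by move=> /ler_normlW; exists D.
have q0 : 0 < (1 - p) / 84 by move: p0 p20; lra.
have [i [oi Ni ai]] := exists_block false (maxn N (D.+1)) (10000 * K / ((1 - p) / 84)).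
move: Ni; rewrite geq_max => /andP[Ni Di].
have hb l : (block i <= l < block i.+1)%N -> branching l = 2.
  by move=> /branching_block ->; rewrite oi.
have a2 : (2 <= block i)%N by rewrite -[X in (X <= _)%N]expn1 leq_exp2l // expn_gt0.
have aD : (D + block i <= block i.+1)%N.
  rewrite blockS (@leq_trans (block i * 2)) //; last by rewrite leq_mul2l a2 orbT.
  by rewrite muln2 -addnn leq_add2r ltnW.
have DT : (D <= block i.+1)%N by apply: leq_trans aD; exact: leq_addr.
(* Stopping [D] levels before the end of the block keeps the first [D] levels below every visited
   vertex out of the next, denser block. *)
exists (block i.+1 - D)%N.
  by rewrite leq_subRL // (leq_trans _ aD) // leq_add2l.
have a0 : (0 < block i)%N by apply: leq_trans a2.
have nD : (block i.+1 - D + D <= block i.+1)%N by rewrite subnK.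
apply: le_trans (mean_weight_upper p0 p20 a0 hb hD nD) _.
rewrite ler_pdivrMr // in ai.
have n_ge : (block i)%:R * (block i)%:R - (block i)%:R <= (block i.+1 - D)%:R :> R.
  rewrite natrB // blockS natrM lerD2l lerN2 ler_nat; exact: ltnW.
have a2R : 2 <= (block i)%:R :> R by rewrite (ler_nat R 2).
have -> : 1 - p = 84 * ((1 - p) / 84) by field.
exact: block_gap.
Qed.

Lemma mean_U_oscillates :
  (limn_einf (fun n => (n%:R^-1 * h n)%:E) <= ((1 - p) * (16 / 21))%:E)%E /\
  (((1 - p) * (18 / 21))%:E <= limn_esup (fun n => (n%:R^-1 * h n)%:E))%E.
Proof.
split.
  apply: limn_einf_le => N; have [n Nn hn] := mean_weight_small N.+1.
  exists n; first exact: ltnW.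
  rewrite lee_fin mulrC ler_pdivrMr // ltr0n; exact: leq_ltn_trans Nn.
apply: limn_esup_ge => N; have [n Nn hn] := mean_weight_large N.+1.
exists n; first exact: ltnW.
rewrite lee_fin [leRHS]mulrC ler_pdivlMr // ltr0n; exact: leq_ltn_trans Nn.
Qed.

End oscillating_mean.

Theorem theorem1p6 (R : realType) :
  exists (G : sgraph) (o : G),
    [/\ infinite_set [set: G], connected_graph G, bounded_degree G,
        transient R G /\ ~ vertex_transitive G &
        forall p : R, 0 <= p < p_T R o ->
          {ae joint_law o p, forall z : trajectory o * config G,
            [/\ limn_einf (fun n => n%:R^-1%:E * mean_U o p n)%E =
                  limn_einf (fun n => n%:R^-1%:E * U R n z)%E,
                (limn_einf (fun n => n%:R^-1%:E * U R n z) <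
                  limn_esup (fun n => n%:R^-1%:E * U R n z))%E &
                limn_esup (fun n => n%:R^-1%:E * U R n z)%E =
                  limn_esup (fun n => n%:R^-1%:E * mean_U o p n)%E]}].
Proof.
exists osc_tree, (root : osc_tree); split.
- exact: infinite_osc_tree.
- exact: connected_osc_tree.
- exact: bounded_degree_osc_tree.
- by split; [exact: transient_osc_tree|exact: not_vertex_transitive_osc_tree].
move=> p pT; have p20 := lt_p_T pT; have p0 : 0 <= p by case/andP: pT.
have K1 := chi_max_ge1 p0 p20; have K0 : 0 <= chi_max p by apply: le_trans K1.
have zb := top_mass_bnd p0 p20.
pose m n := mean_weight (top_mass p) n root.
have m0 n : 0 <= m n.
  rewrite /m /mean_weight -(walk_mean_cst n root 0); apply: walk_mean_le => s _ _.
  exact: weight_ge0 zb _.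
have mK n : m n <= m n.+1 <= m n + chi_max p.
  by rewrite /m (mean_weight_ge zb) (mean_weight_leD zb).
have C0 : 0 <= 47 * chi_max p ^+ 3 by rewrite mulr_ge0 // exprn_ge0.
have EX n : (\int[joint_law (root : osc_tree) p]_z U R n z = (m n)%:E)%E by exact: mean_UE.
have meanE : (fun n => n%:R^-1%:E * mean_U (root : osc_tree) p n)%E =
    (fun n => (n%:R^-1 * m n)%:E).
  by apply/funext => n; rewrite mean_UE.
have [osc1 osc2] := mean_U_oscillates p0 p20.
have := law_of_large_numbers C0 K0 (measurable_U (R := R)) (@U_ge0 R)
  (fun n n' z => @U_nd R n n' z) m0 mK EX (mean_sqr_U p0 p20).
apply: (@filterS _ _ (ae_filter_ringOfSetsType (joint_law (root : osc_tree) p))) => z [Ufin Uclose].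
have close (e : R) : 0 < e -> exists N, forall n, (N <= n)%N ->
    ((n%:R^-1 * m n)%:E <= n%:R^-1%:E * U R n z + e%:E)%E /\
    (n%:R^-1%:E * U R n z <= (n%:R^-1 * m n)%:E + e%:E)%E.
  (* The successor excludes [n = 0], where the inverse is 0 by convention. *)
  move=> e0; have [N HN] := Uclose e e0; exists N.+1 => n Nn.
  have := HN n (ltnW Nn); rewrite -(fineK (Ufin n)) -EFinM -!EFinD !lee_fin.
  have n0 : (0 : R) < n%:R by rewrite ltr0n; exact: leq_ltn_trans Nn.
  rewrite fineK // ler_norml => /andP[h1 h2].
  have n1 : n%:R != 0 :> R by exact: lt0r_neq0.
  by split; rewrite -(ler_pM2l n0) mulrDr !(mulVKf n1); lra.
have einfE : limn_einf (fun n => n%:R^-1%:E * mean_U (root : osc_tree) p n)%E =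
    limn_einf (fun n => n%:R^-1%:E * U R n z)%E.
  by rewrite meanE; apply: eq_limn_einf.
have esupE : limn_esup (fun n => n%:R^-1%:E * mean_U (root : osc_tree) p n)%E =
    limn_esup (fun n => n%:R^-1%:E * U R n z)%E.
  by rewrite meanE; apply: eq_limn_esup.
split => //; rewrite -einfE -esupE meanE.
apply: (le_lt_trans osc1); apply: lt_le_trans osc2.
by rewrite lte_fin ltr_pM2l; move: p0 p20; lra.
Qed.
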